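(* There exists $u\in\dot{\mathscr W}^{1,2}$ such that $\mathcal E(u)\le\mathcal E(v)$ for all $v\in\dot{\mathscr W}^{1,2}$.
   Context: Let $\mathsf R_6$ be rotation through $\pi/3$, $a_1=(1,0)^T$, $a_i=\mathsf R_6^{i-1}a_1$, $\Lambda:=(\tfrac12,\tfrac{\sqrt3}{6})^T+\{m a_1+n a_2:m,n\in\mathbb Z\}$. Bonds: $\mathcal B=\{(\xi,\eta)\in\Lambda^2:|\xi-\eta|=1\}$ (ordered pairs); $Dy_b=y(\eta)-y(\xi)$ for $b=(\xi,\eta)$. Let $\xi_0=(0,\sqrt3/3)^T$, $\mathscr W_0=\{v:\Lambda\to\mathbb R: v(\xi_0)=0,\ \{b:Dv_b\neq0\}\text{ bounded}\}$, and $\dot{\mathscr W}^{1,2}=\{v:\Lambda\to\mathbb R: v(\xi_0)=0,\ Dv\in\ell^2(\mathcal B)\}$ with norm $\|Dv\|_2=(\sum_{b\in\mathcal B}|Dv_b|^2)^{1/2}$ ($\mathscr W_0$ is dense in it). The potential $\psi\in C(\mathbb R)\cap C^4(\mathbb R\setminus(\mathbb Z+\tfrac12))$ satisfies: ($\psi$1) 1-periodic; ($\psi$2) $\psi$ and $\psi(\tfrac12+\cdot)$ even; ($\psi$3) $\psi(r)=0$ iff $r\in\mathbb Z$; ($\psi$4) $\psi''(0)=\mu>0$; ($\psi$5) $\psi(x)\ge\tfrac12\psi''(0)x^2$ for $x\in[-\tfrac12,\tfrac12]$. Let $\hat y(x)=\frac1{2\pi}\arg(x)$ (identifying $x$ with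 $x_1+ix_2$, branch cut along the positive $x_1$-axis), restricted to $\Lambda$. For $u\in\mathscr W_0$ set $\mathcal E(u):=\sum_{b\in\mathcal B}[\psi(D\hat y_b+Du_b)-\psi(D\hat y_b)]$ (a finite sum); $\mathcal E$ is continuous on $\mathscr W_0$ with respect to $\|D\cdot\|_2$ and $\mathcal E$ on $\dot{\mathscr W}^{1,2}$ denotes its unique continuous extension.
   Formalization: The normalisation point ξ₀=(0,√3/3) does not lie in Λ, so v(ξ₀) is undefined; the formal statement normalises at the lattice point (0,−√3/3) instead, which does not matter since the energy depends only on Dv. *)

(* Defs.v *)
From Stdlib Require Import Reals Lra List.
From Coquelicot Require Import Coquelicot.
Open Scope R_scope.

Definition vec := (R * R)%type.
Definition vadd (x y : vec) : vec := (fst x + fst y, snd x + snd y).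
Definition vsub (x y : vec) : vec := (fst x - fst y, snd x - snd y).
Definition vscal (c : R) (x : vec) : vec := (c * fst x, c * snd x).
Definition vnorm (x : vec) : R := sqrt (fst x ^ 2 + snd x ^ 2).

Definition R6 (x : vec) : vec :=
  (cos (PI / 3) * fst x - sin (PI / 3) * snd x,
   sin (PI / 3) * fst x + cos (PI / 3) * snd x).
Definition a1 : vec := (1, 0).
Definition a2 : vec := R6 a1.

(* The lattice Lambda is parametrized by Z x Z:
   site (m,n) is (1/2, sqrt3/6) + m a1 + n a2 (injective parametrization). *)
Definition site := (Z * Z)%type.
Definition pos (p : site) : vec :=
  vadd (vadd (1/2, sqrt 3 / 6) (vscal (IZR (fst p)) a1)) (vscal (IZR (snd p)) a2).

Definition bond (p q : site) : Prop := vnorm (vsub (pos p) (pos q)) = 1.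

(* normalisation site: the lattice point (0, -sqrt3/3) *)
Definition xi0 : site := (0%Z, (-1)%Z).

Definition D (v : site -> R) (p q : site) : R := v q - v p.

Definition bond_list (l : list (site * site)) : Prop :=
  NoDup l /\ List.Forall (fun b => bond (fst b) (snd b)) l.

Fixpoint sumsq (g : site -> site -> R) (l : list (site * site)) : R :=
  match l with
  | nil => 0
  | b :: l' => (g (fst b) (snd b)) ^ 2 + sumsq g l'
  end.

Definition partial_sq_sums (g : site -> site -> R) (x : R) : Prop :=
  exists l, bond_list l /\ x = sumsq g l.

Definition in_l2 (g : site -> site -> R) : Prop :=
  exists C, forall x, partial_sq_sums g x -> x <= C.

(* ||g||_2 = (sum over bonds of |g_b|^2)^(1/2), the sum of a nonnegative family
   being the supremum of its finite partial sums *)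
Definition l2norm (g : site -> site -> R) : R :=
  sqrt (real (Lub_Rbar (partial_sq_sums g))).

Definition W0 (v : site -> R) : Prop :=
  v xi0 = 0 /\
  exists Rb, forall p q, bond p q -> D v p q <> 0 ->
    vnorm (pos p) <= Rb /\ vnorm (pos q) <= Rb.

Definition W12 (v : site -> R) : Prop := v xi0 = 0 /\ in_l2 (D v).

(* argument in [0, 2*pi), branch cut along the positive x1-axis *)
Definition arg (x : vec) : R :=
  if Rle_dec 0 (snd x) then acos (fst x / vnorm x)
  else 2 * PI - acos (fst x / vnorm x).

Definition yhat (p : site) : R := arg (pos p) / (2 * PI).

Definition bond_energy (psi : R -> R) (u : site -> R) (p q : site) : R :=
  psi (D yhat p q + D u p q) - psi (D yhat p q).

(* E(u) for u in W0: the (finite) sum over all bonds; bonds with Du_b = 0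
   contribute 0, so it is the sum over any finite duplicate-free list of bonds
   containing every bond with Du_b <> 0. *)
Fixpoint sum_list (f : site -> site -> R) (l : list (site * site)) : R :=
  match l with
  | nil => 0
  | b :: l' => f (fst b) (snd b) + sum_list f l'
  end.

Definition E0_value (psi : R -> R) (u : site -> R) (e : R) : Prop :=
  exists l, bond_list l /\
    (forall p q, bond p q -> D u p q <> 0 -> In (p, q) l) /\
    e = sum_list (bond_energy psi u) l.

(* L is the value at u of the continuous extension of E from W0 to W^{1,2}:
   E(w) -> L as w -> u in W0 w.r.t. ||D.||_2 *)
Definition E_ext_value (psi : R -> R) (u : site -> R) (L : R) : Prop :=
  forall eps, 0 < eps -> exists delta, 0 < delta /\
    forall w, W0 w -> l2norm (fun p q => D w p q - D u p q) < delta ->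
      forall e, E0_value psi w e -> Rabs (e - L) < eps.

Definition half_integer (x : R) : Prop := exists k : Z, x = IZR k + 1/2.

Definition psi_hyp (psi : R -> R) : Prop :=
  (forall x, continuous psi x) /\
  (forall x, ~ half_integer x ->
     (forall k, (k <= 4)%nat -> ex_derive_n psi k x) /\
     continuous (Derive_n psi 4) x) /\
  (forall x, psi (x + 1) = psi x) /\
  (forall x, psi (- x) = psi x) /\
  (forall x, psi (1/2 + - x) = psi (1/2 + x)) /\
  (forall r, psi r = 0 <-> exists k : Z, r = IZR k) /\
  0 < Derive_n psi 2 0 /\
  (forall x, -1/2 <= x <= 1/2 -> psi x >= 1/2 * Derive_n psi 2 0 * x ^ 2).

(* Main.v *)
From Stdlib Require Import Reals Lra Lia ZArith List Permutation Cantor ClassicalEpsilon FunctionalExtensionality.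
From Coquelicot Require Import Coquelicot.
Require Import Defs.
Import ListNotations.
Open Scope R_scope.

(** Reducing the bond differences of yhat + u modulo 1 gives strains in [-1/2, 1/2] whose circulation around
    each lattice triangle is a charge in {-1, 0, 1}; the charges are finitely many, of total 1.

    The reference strain of yhat differs by a square-summable field from the rotated gradient of -A log|x|,
    A = sqrt 3 / (2 pi), evaluated at triangle centres.  As rotated gradients are orthogonal to gradients, the
    energy becomes an absolutely convergent sum, continuous in l2.

    Coercivity modulo lattice symmetries: for the rotated gradient j of a function h of the distance to a charge z,
    the energy is bounded below by |strain - j|^2 - |reference strain at z - j|^2 + 2 sum_f q_f h_f.  Taking
    h' = -A/r on the radii r for which the disc around z has charge at least 1 and h' = 0 elsewhere, the last sum is
    nonnegative and the middle term is A times the logarithmic measure of the remaining radii.  A single-linkage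
    clustering of the charges yields a centre z for which this loss is smaller than the energy that the charges
    force on strain - j, so their number is bounded.  After z has been moved to the origin by a lattice symmetry
    the strain is at bounded l2 distance from the reference strain.  A charge of a field of bounded energy lies in
    a neutral box of bounded size (otherwise its circulation along concentric boxes costs a divergent harmonic
    sum), so adding boundedly many integers turns the difference into a gradient.

    Minimising sequences in W0 can therefore be taken bounded, and the energy is lower semicontinuous under
    pointwise convergence.  The minimum over W0 is the minimum over W12 because W0 is dense: the distance from
    grad v to the gradients of W0 is attained in the limit, with a residual that is the gradient of a harmonic
    function and square-summable, hence zero. *)

(** * Finite and unordered sums *)

Fixpoint lsum {A : Type} (f : A -> R) (l : list A) : R :=
  match l with
  | nil => 0
  | a :: l' => f a + lsum f l'
  end.

Lemma lsum_app {A} (f : A -> R) l l' : lsum f (l ++ l') = lsum f l + lsum f l'.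
Proof. induction l as [|a l IH]; simpl; lra. Qed.

Lemma lsum_plus {A} (f g : A -> R) l :
  lsum (fun a => f a + g a) l = lsum f l + lsum g l.
Proof. induction l as [|a l IH]; simpl; lra. Qed.

Lemma lsum_scal {A} c (f : A -> R) l : lsum (fun a => c * f a) l = c * lsum f l.
Proof. induction l as [|a l IH]; simpl; lra. Qed.

Lemma lsum_minus {A} (f g : A -> R) l :
  lsum (fun a => f a - g a) l = lsum f l - lsum g l.
Proof. induction l as [|a l IH]; simpl; lra. Qed.

Lemma lsum_const {A} c (l : list A) : lsum (fun _ => c) l = c * INR (length l).
Proof.
  induction l as [|a l IH]; simpl length; simpl lsum; [simpl; lra|].
  rewrite S_INR, IH. lra.
Qed.

Lemma lsum_le {A} (f g : A -> R) l :
  (forall a, In a l -> f a <= g a) -> lsum f l <= lsum g l.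
Proof.
  induction l as [|a l IH]; simpl; intros H; [lra|].
  apply Rplus_le_compat; auto.
Qed.

Lemma lsum_ext {A} (f g : A -> R) l :
  (forall a, In a l -> f a = g a) -> lsum f l = lsum g l.
Proof. intros H; apply Rle_antisym; apply lsum_le; intros; rewrite H; auto; lra. Qed.

Lemma lsum_0 {A} (f : A -> R) l : (forall a, In a l -> f a = 0) -> lsum f l = 0.
Proof. intros H. rewrite (lsum_ext f (fun _ => 0)), lsum_const; auto; lra. Qed.

Lemma lsum_nonneg {A} (f : A -> R) l : (forall a, In a l -> 0 <= f a) -> 0 <= lsum f l.
Proof.
  intros H. rewrite <- (lsum_0 (fun _ : A => 0) l) by auto. now apply lsum_le.
Qed.

Lemma Rabs_lsum_le {A} (f : A -> R) l : Rabs (lsum f l) <= lsum (fun a => Rabs (f a)) l.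
Proof.
  induction l as [|a l IH]; simpl; [rewrite Rabs_R0; lra|].
  eapply Rle_trans; [apply Rabs_triang|]. lra.
Qed.

Lemma lsum_map {A B} (s : A -> B) (f : B -> R) l :
  lsum f (map s l) = lsum (fun a => f (s a)) l.
Proof. induction l as [|a l IH]; simpl; lra. Qed.

Lemma lsum_perm {A} (f : A -> R) l l' : Permutation l l' -> lsum f l = lsum f l'.
Proof. induction 1; simpl; lra. Qed.

Lemma lsum_flat_map {A B} (s : A -> list B) (f : B -> R) l :
  lsum f (flat_map s l) = lsum (fun a => lsum f (s a)) l.
Proof. induction l as [|a l IH]; simpl; [lra|]. rewrite lsum_app; lra. Qed.

Lemma lsum_list_prod {A B} (f : A * B -> R) la lb :
  lsum f (list_prod la lb) = lsum (fun a => lsum (fun b => f (a, b)) lb) la.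
Proof.
  induction la as [|a la IH]; simpl; [lra|].
  rewrite lsum_app, lsum_map, IH. lra.
Qed.

Lemma lsum_swap {A B} (f : A -> B -> R) la lb :
  lsum (fun a => lsum (fun b => f a b) lb) la = lsum (fun b => lsum (fun a => f a b) la) lb.
Proof.
  induction la as [|a la IH]; simpl.
  - symmetry. now apply lsum_0.
  - rewrite IH, <- lsum_plus. reflexivity.
Qed.

Lemma sqr_lsum_le {A} (f : A -> R) l :
  (lsum f l) ^ 2 <= INR (length l) * lsum (fun a => f a ^ 2) l.
Proof.
  induction l as [|a l IH]; [simpl; lra|].
  cbn [lsum length]. rewrite S_INR.
  set (s := lsum f l) in *. set (t := lsum (fun a => f a ^ 2) l) in *. set (n := INR (length l)) in *.
  assert (n_nonneg : 0 <= n) by apply pos_INR.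
  assert (t_nonneg : 0 <= t) by (apply lsum_nonneg; intros; nra).
  assert (cross_term : 2 * f a * s <= n * f a ^ 2 + t); [|nra].
  destruct n_nonneg as [n_pos|n_0].
  - apply (Rmult_le_reg_l n); [auto|]. pose proof (pow2_ge_0 (n * f a - s)). nra.
  - assert (s = 0) by nra. nra.
Qed.

Definition select {A : Type} (P : A -> Prop) (l : list A) : list A :=
  filter (fun a => if excluded_middle_informative (P a) then true else false) l.

Lemma in_select {A} (P : A -> Prop) l a : In a (select P l) <-> In a l /\ P a.
Proof. unfold select. rewrite filter_In. destruct excluded_middle_informative; intuition congruence. Qed.

Lemma NoDup_select {A} (P : A -> Prop) l : NoDup l -> NoDup (select P l).
Proof. apply NoDup_filter. Qed.

Lemma lsum_select_split {A} (P : A -> Prop) (f : A -> R) l :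
  lsum f l = lsum f (select P l) + lsum f (select (fun a => ~ P a) l).
Proof.
  induction l as [|a l IH]; simpl; [lra|].
  destruct (excluded_middle_informative (P a)), (excluded_middle_informative (~ P a));
    simpl; try tauto; lra.
Qed.

Lemma length_select_split {A} (P : A -> Prop) (l : list A) :
  length l = (length (select P l) + length (select (fun a => ~ P a) l))%nat.
Proof.
  induction l as [|a l IH]; simpl; auto.
  destruct (excluded_middle_informative (P a)), (excluded_middle_informative (~ P a));
    simpl; try tauto; lia.
Qed.

Lemma lsum_incl_split {A} (f : A -> R) l l' : NoDup l -> NoDup l' -> incl l l' ->
  lsum f l' = lsum f l + lsum f (select (fun a => ~ In a l) l').
Proof.
  intros nodup_l nodup_l' l_in_l'. rewrite (lsum_select_split (fun a => In a l) f l'). f_equal.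
  apply lsum_perm, NoDup_Permutation; auto using NoDup_select.
  intros a. rewrite in_select. split; [tauto|auto].
Qed.

Lemma lsum_incl_le {A} (f : A -> R) l l' :
  NoDup l -> NoDup l' -> incl l l' -> (forall a, In a l' -> ~ In a l -> 0 <= f a) ->
  lsum f l <= lsum f l'.
Proof.
  intros nodup_l nodup_l' l_in_l' f_nonneg. rewrite (lsum_incl_split f l l') by auto.
  assert (0 <= lsum f (select (fun a => ~ In a l) l')); [|lra].
  apply lsum_nonneg. intros a a_out. apply in_select in a_out. apply f_nonneg; tauto.
Qed.

Lemma lsum_incl_eq {A} (f : A -> R) l l' :
  NoDup l -> NoDup l' -> incl l l' -> (forall a, In a l' -> ~ In a l -> f a = 0) ->
  lsum f l = lsum f l'.
Proof.
  intros nodup_l nodup_l' l_in_l' f_0. rewrite (lsum_incl_split f l l') by auto.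
  rewrite (lsum_0 f (select _ _)); [ring|].
  intros a a_out. apply in_select in a_out. apply f_0; tauto.
Qed.

Definition classic_eq_dec {A : Type} (a b : A) : {a = b} + {a <> b} :=
  excluded_middle_informative (a = b).

Definition union {A : Type} (l l' : list A) : list A := nodup classic_eq_dec (l ++ l').

Lemma NoDup_union {A} (l l' : list A) : NoDup (union l l').
Proof. apply NoDup_nodup. Qed.

Lemma incl_union_l {A} (l l' : list A) : incl l (union l l').
Proof. intros a a_in. apply nodup_In, in_app_iff; auto. Qed.

Lemma incl_union_r {A} (l l' : list A) : incl l' (union l l').
Proof. intros a a_in. apply nodup_In, in_app_iff; auto. Qed.

Lemma lsum_support_eq {A} (f : A -> R) l l' : NoDup l -> NoDup l' ->
  (forall a, f a <> 0 -> In a l) -> (forall a, f a <> 0 -> In a l') -> lsum f l = lsum f l'.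
Proof.
  intros nodup_l nodup_l' supp_l supp_l'.
  rewrite (lsum_incl_eq f l (union l l')), (lsum_incl_eq f l' (union l l'));
    auto using NoDup_union, incl_union_l, incl_union_r;
    intros a _ a_out; apply NNPP; auto.
Qed.

Lemma lsum_le_of_support {A} (f : A -> R) l l0 : NoDup l -> NoDup l0 ->
  (forall a, 0 <= f a) -> (forall a, f a <> 0 -> In a l0) -> lsum f l <= lsum f l0.
Proof.
  intros nodup_l nodup_l0 f_nonneg supp_l0. rewrite (lsum_support_eq f l0 (union l0 l)); auto using NoDup_union.
  - apply lsum_incl_le; auto using NoDup_union, incl_union_r.
  - intros a fa_neq_0. apply incl_union_l. auto.
Qed.

Definition has_sum {A : Type} (f : A -> R) (S : R) : Prop :=
  forall eps, 0 < eps -> exists l0,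
    forall l, NoDup l -> incl l0 l -> Rabs (lsum f l - S) < eps.

Definition summable {A : Type} (f : A -> R) : Prop :=
  exists C, forall l, NoDup l -> lsum (fun a => Rabs (f a)) l <= C.

(* A junk value when f has no sum. *)
Definition tsum {A : Type} (f : A -> R) : R := epsilon (inhabits 0) (has_sum f).

Section UnorderedSums.

Context {A : Type}.
Implicit Types (f g : A -> R) (l : list A).

Lemma has_sum_unique f S S' : has_sum f S -> has_sum f S' -> S = S'.
Proof.
  intros sum_S sum_S'. apply NNPP. intros S_neq_S'.
  assert (gap : 0 < Rabs (S - S') / 2) by (assert (0 < Rabs (S - S')) by (apply Rabs_pos_lt; lra); lra).
  destruct (sum_S _ gap) as (l & near_S). destruct (sum_S' _ gap) as (l' & near_S').
  specialize (near_S (union l l') (NoDup_union _ _) (incl_union_l _ _)).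
  specialize (near_S' (union l l') (NoDup_union _ _) (incl_union_r _ _)).
  revert near_S near_S' gap. unfold Rabs. repeat destruct Rcase_abs; lra.
Qed.

Lemma has_sum_plus f g S S' :
  has_sum f S -> has_sum g S' -> has_sum (fun a => f a + g a) (S + S').
Proof.
  intros sum_f sum_g eps eps_pos.
  destruct (sum_f (eps/2)) as (l & near_S); [lra|]. destruct (sum_g (eps/2)) as (l' & near_S'); [lra|].
  exists (l ++ l'). intros k nodup_k incl_k. apply incl_app_inv in incl_k. rewrite lsum_plus.
  specialize (near_S k nodup_k (proj1 incl_k)). specialize (near_S' k nodup_k (proj2 incl_k)).
  revert near_S near_S'. unfold Rabs. repeat destruct Rcase_abs; lra.
Qed.

Lemma has_sum_scal c f S : has_sum f S -> has_sum (fun a => c * f a) (c * S).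
Proof.
  intros sum_f eps eps_pos. pose proof (Rabs_pos c) as abs_c.
  destruct (sum_f (eps / (Rabs c + 1))) as (l & near_S); [apply Rdiv_lt_0_compat; lra|].
  exists l. intros k nodup_k incl_k. specialize (near_S k nodup_k incl_k).
  rewrite lsum_scal, <- Rmult_minus_distr_l, Rabs_mult.
  pose proof (Rabs_pos (lsum f k - S)).
  apply (Rmult_lt_compat_l (Rabs c + 1)) in near_S; [|lra].
  replace ((Rabs c + 1) * (eps / (Rabs c + 1))) with eps in near_S by (field; lra). lra.
Qed.

Lemma has_sum_ext f g S : (forall a, f a = g a) -> has_sum f S -> has_sum g S.
Proof.
  intros f_eq_g sum_f eps eps_pos. destruct (sum_f eps eps_pos) as (l & near_S).
  exists l. intros k nodup_k incl_k. rewrite <- (lsum_ext f g); auto.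
Qed.

Lemma nonneg_has_sum f : (forall a, 0 <= f a) -> summable f -> exists S, has_sum f S.
Proof.
  intros f_nonneg (C & bound_C).
  destruct (completeness (fun x => exists l, NoDup l /\ x = lsum f l)) as (S & S_ub & S_least).
  - exists C. intros x (l & nodup_l & ->). eapply Rle_trans; [|apply (bound_C l nodup_l)].
    apply lsum_le. intros; apply Rle_abs.
  - exists 0, nil. split; [constructor|reflexivity].
  - exists S. intros eps eps_pos.
    destruct (classic (exists l, NoDup l /\ S - eps < lsum f l)) as [(l & nodup_l & above)|none_above].
    + exists l. intros k nodup_k incl_k.
      assert (lsum f l <= lsum f k) by (apply lsum_incl_le; auto).
      assert (lsum f k <= S) by (apply S_ub; eauto).
      apply Rabs_def1; lra.
    + exfalso. assert (S <= S - eps); [|lra].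
      apply S_least. intros x (l & nodup_l & ->). apply Rnot_lt_le. eauto.
Qed.

Lemma summable_le f g : (forall a, Rabs (f a) <= g a) -> summable g -> summable f.
Proof.
  intros f_le_g (C & bound_C). exists C. intros l nodup_l. eapply Rle_trans; [|apply (bound_C l nodup_l)].
  apply lsum_le. intros a _. eapply Rle_trans; [apply f_le_g|]. apply Rle_abs.
Qed.

Lemma summable_plus f g : summable f -> summable g -> summable (fun a => f a + g a).
Proof.
  intros (C & bound_C) (C' & bound_C'). exists (C + C'). intros l nodup_l.
  apply Rle_trans with (lsum (fun a => Rabs (f a) + Rabs (g a)) l).
  - apply lsum_le; intros; apply Rabs_triang.
  - rewrite lsum_plus. specialize (bound_C l nodup_l). specialize (bound_C' l nodup_l). lra.
Qed.

Lemma summable_scal c f : summable f -> summable (fun a => c * f a).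
Proof.
  intros (C & bound_C). exists (Rabs c * C). intros l nodup_l.
  rewrite (lsum_ext _ (fun a => Rabs c * Rabs (f a))) by (intros; apply Rabs_mult).
  rewrite lsum_scal. apply Rmult_le_compat_l; auto using Rabs_pos.
Qed.

Lemma summable_ext f g : (forall a, f a = g a) -> summable f -> summable g.
Proof.
  intros f_eq_g (C & bound_C). exists C. intros l nodup_l.
  rewrite <- (lsum_ext (fun a => Rabs (f a))); auto. intros; now rewrite f_eq_g.
Qed.

Lemma summable_abs f : summable f -> summable (fun a => Rabs (f a)).
Proof.
  intros (C & bound_C). exists C. intros l nodup_l. rewrite (lsum_ext _ (fun a => Rabs (f a))); auto.
  intros; apply Rabs_Rabsolu.
Qed.

Lemma summable_minus f g : summable f -> summable g -> summable (fun a => f a - g a).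
Proof.
  intros summable_f summable_g. apply summable_ext with (fun a => f a + -1 * g a); [intros; ring|].
  apply summable_plus; auto using summable_scal.
Qed.

Lemma summable_mul f g :
  summable (fun a => f a ^ 2) -> summable (fun a => g a ^ 2) -> summable (fun a => f a * g a).
Proof.
  intros summable_f summable_g. apply (summable_le _ (fun a => f a ^ 2 + g a ^ 2)); [|now apply summable_plus].
  intros a. apply Rabs_le. split; nra.
Qed.

Lemma summable_has_sum f : summable f -> exists S, has_sum f S.
Proof.
  intros summable_f.
  destruct (nonneg_has_sum (fun a => Rabs (f a))) as (S1 & sum_abs); auto using Rabs_pos, summable_abs.
  destruct (nonneg_has_sum (fun a => Rabs (f a) + f a)) as (S2 & sum_shifted).
  - intros a. unfold Rabs; destruct Rcase_abs; lra.
  - apply summable_plus; auto using summable_abs.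
  - exists (S2 + -1 * S1). apply has_sum_ext with (fun a => (Rabs (f a) + f a) + -1 * Rabs (f a)).
    + intros; ring.
    + apply has_sum_plus; auto using has_sum_scal.
Qed.

Lemma tsum_has_sum f : summable f -> has_sum f (tsum f).
Proof. intros summable_f. apply (epsilon_spec (inhabits 0) (has_sum f)). now apply summable_has_sum. Qed.

Lemma tsum_unique f S : has_sum f S -> tsum f = S.
Proof.
  intros sum_f. apply (has_sum_unique f); auto.
  apply (epsilon_spec (inhabits 0) (has_sum f)). eauto.
Qed.

Lemma tsum_ext f g : (forall a, f a = g a) -> tsum f = tsum g.
Proof.
  intros f_eq_g. assert (f = g) as -> by (now apply functional_extensionality). reflexivity.
Qed.

Lemma tsum_plus f g : summable f -> summable g -> tsum (fun a => f a + g a) = tsum f + tsum g.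
Proof. intros. apply tsum_unique, has_sum_plus; now apply tsum_has_sum. Qed.

Lemma tsum_scal c f : summable f -> tsum (fun a => c * f a) = c * tsum f.
Proof. intros. apply tsum_unique, has_sum_scal; now apply tsum_has_sum. Qed.

Lemma tsum_minus f g : summable f -> summable g -> tsum (fun a => f a - g a) = tsum f - tsum g.
Proof.
  intros. rewrite (tsum_ext _ (fun a => f a + -1 * g a)) by (intros; ring).
  rewrite tsum_plus, tsum_scal; auto using summable_scal. ring.
Qed.

Lemma tsum_ge f l B : summable f -> (forall k, NoDup k -> incl l k -> B <= lsum f k) -> B <= tsum f.
Proof.
  intros summable_f lower. apply Rnot_lt_le. intros below.
  destruct (tsum_has_sum f summable_f (B - tsum f)) as (l0 & near_sum); [lra|].
  specialize (near_sum (union l l0) (NoDup_union _ _) (incl_union_r _ _)).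
  specialize (lower (union l l0) (NoDup_union _ _) (incl_union_l _ _)).
  apply Rabs_def2 in near_sum. lra.
Qed.

Lemma tsum_le_bound f B : summable f -> (forall l, NoDup l -> lsum f l <= B) -> tsum f <= B.
Proof.
  intros summable_f upper. assert (- B <= -1 * tsum f); [|lra].
  rewrite <- tsum_scal by auto. apply (tsum_ge _ nil).
  - now apply summable_scal.
  - intros k nodup_k _. rewrite lsum_scal. specialize (upper k nodup_k). lra.
Qed.

Lemma tsum_nonneg f : summable f -> (forall a, 0 <= f a) -> 0 <= tsum f.
Proof. intros summable_f f_nonneg. apply (tsum_ge _ nil); auto. intros; now apply lsum_nonneg. Qed.

Lemma tsum_le f g : summable f -> summable g -> (forall a, f a <= g a) -> tsum f <= tsum g.
Proof.
  intros summable_f summable_g f_le_g. assert (0 <= tsum (fun a => g a - f a)) as diff_nonneg.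
  - apply tsum_nonneg; auto using summable_minus. intros a. specialize (f_le_g a); lra.
  - rewrite tsum_minus in diff_nonneg; auto. lra.
Qed.

Lemma Rabs_tsum_le_bound f B :
  summable f -> (forall l, NoDup l -> Rabs (lsum f l) <= B) -> Rabs (tsum f) <= B.
Proof.
  intros summable_f bounded. apply Rabs_le. split.
  - apply (tsum_ge _ nil); auto. intros k nodup_k _. specialize (bounded k nodup_k).
    apply Rabs_le_between in bounded. lra.
  - apply tsum_le_bound; auto. intros k nodup_k. specialize (bounded k nodup_k).
    apply Rabs_le_between in bounded. lra.
Qed.

Lemma lsum_le_tsum f l : summable f -> (forall a, 0 <= f a) -> NoDup l -> lsum f l <= tsum f.
Proof. intros. apply (tsum_ge f l); auto. intros k nodup_k incl_k. now apply lsum_incl_le. Qed.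

Lemma summable_of_support f l : (forall a, f a <> 0 -> In a l) -> summable f.
Proof.
  intros supp_f. set (l0 := nodup classic_eq_dec l).
  exists (lsum (fun a => Rabs (f a)) l0). intros k nodup_k.
  apply lsum_le_of_support; auto using Rabs_pos; [apply NoDup_nodup|].
  intros a neq_0. apply nodup_In, supp_f. intros fa_0. apply neq_0. rewrite fa_0. apply Rabs_R0.
Qed.

Lemma tsum_finite f l : NoDup l -> (forall a, f a <> 0 -> In a l) -> tsum f = lsum f l.
Proof.
  intros nodup_l supp_f. apply tsum_unique. intros eps eps_pos. exists l. intros k nodup_k incl_k.
  rewrite (lsum_support_eq f k l) by auto. rewrite Rminus_diag, Rabs_R0; auto.
Qed.

Lemma tsum_tail f eps : summable f -> 0 < eps ->
  exists l0, NoDup l0 /\ forall l, NoDup l -> (forall a, In a l -> ~ In a l0) ->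
    lsum (fun a => Rabs (f a)) l <= eps.
Proof.
  intros summable_f eps_pos.
  destruct (tsum_has_sum _ (summable_abs _ summable_f) (eps/2)) as (l1 & near_sum); [lra|].
  set (l0 := nodup classic_eq_dec l1). assert (l1_in_l0 : incl l1 l0) by (intros a a_in; now apply nodup_In).
  exists l0. split; [apply NoDup_nodup|]. intros l nodup_l disjoint.
  assert (near_l0 := near_sum l0 (NoDup_nodup _ _) l1_in_l0).
  assert (near_l := near_sum (l ++ l0) (NoDup_app nodup_l (NoDup_nodup _ _) disjoint) (incl_appr _ l1_in_l0)).
  rewrite lsum_app in near_l. apply Rabs_def2 in near_l0. apply Rabs_def2 in near_l. lra.
Qed.

End UnorderedSums.

Section Reindexing.

Context {A B : Type} (s : A -> B) (s' : B -> A).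
Hypothesis s'_s : forall a, s' (s a) = a.

Lemma NoDup_map_retract l : NoDup l -> NoDup (map s l).
Proof. apply FinFun.Injective_map_NoDup. intros x y s_eq. now rewrite <- (s'_s x), s_eq, s'_s. Qed.

Lemma summable_reindex (f : B -> R) : summable f -> summable (fun a => f (s a)).
Proof.
  intros (C & bound_C). exists C. intros l nodup_l.
  rewrite <- (lsum_map s (fun b => Rabs (f b))). now apply bound_C, NoDup_map_retract.
Qed.

Lemma tsum_reindex (f : B -> R) :
  (forall b, s (s' b) = b) -> summable f -> tsum (fun a => f (s a)) = tsum f.
Proof.
  intros s_s' summable_f. apply tsum_unique. intros eps eps_pos.
  destruct (tsum_has_sum f summable_f eps eps_pos) as (l & near_sum). exists (map s' l).
  intros k nodup_k incl_k. rewrite <- (lsum_map s f). apply near_sum; [now apply NoDup_map_retract|].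
  intros b b_in. apply in_map_iff. exists (s' b). split; auto. apply incl_k. now apply in_map.
Qed.

End Reindexing.

(** * Boxes and weights on the lattice *)

Lemma NoDup_list_prod {A B} (l : list A) (l' : list B) :
  NoDup l -> NoDup l' -> NoDup (list_prod l l').
Proof.
  intros nodup_l nodup_l'. induction nodup_l as [|a l a_notin _ IH]; simpl; [constructor|].
  apply NoDup_app; auto.
  - apply FinFun.Injective_map_NoDup; auto. intros x y; congruence.
  - intros [x y] in_row in_prod. apply in_map_iff in in_row. destruct in_row as (b & [= <- <-] & _).
    apply in_prod_iff in in_prod. tauto.
Qed.

Definition Zrange (N : nat) : list Z := map (fun k => (Z.of_nat k - Z.of_nat N)%Z) (seq 0 (2 * N + 1)).

Lemma in_Zrange N m : In m (Zrange N) <-> (Z.abs m <= Z.of_nat N)%Z.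
Proof.
  unfold Zrange. rewrite in_map_iff. split.
  - intros (k & <- & k_in). apply in_seq in k_in. lia.
  - intros m_le. exists (Z.to_nat (m + Z.of_nat N)). split; [lia|]. apply in_seq. lia.
Qed.

Lemma NoDup_Zrange N : NoDup (Zrange N).
Proof. apply FinFun.Injective_map_NoDup; [|apply seq_NoDup]. intros x y. cbv beta. lia. Qed.

Lemma length_Zrange N : INR (length (Zrange N)) = 2 * INR N + 1.
Proof. unfold Zrange. rewrite length_map, length_seq, plus_INR, mult_INR. simpl; ring. Qed.

Definition box (N : nat) : list site := list_prod (Zrange N) (Zrange N).

Lemma in_box N p : In p (box N) <-> (Z.abs (fst p) <= Z.of_nat N /\ Z.abs (snd p) <= Z.of_nat N)%Z.
Proof. destruct p as [m n]. cbn [fst snd]. rewrite <- !in_Zrange. apply in_prod_iff. Qed.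

Lemma NoDup_box N : NoDup (box N).
Proof. apply NoDup_list_prod; apply NoDup_Zrange. Qed.

Lemma length_box N : INR (length (box N)) = (2 * INR N + 1) ^ 2.
Proof. unfold box, site. rewrite length_prod, mult_INR, length_Zrange. ring. Qed.

Lemma incl_box N M : (N <= M)%nat -> incl (box N) (box M).
Proof. intros N_le_M p p_in. apply in_box in p_in. apply in_box. lia. Qed.

Lemma incl_some_box (l : list site) : exists N, incl l (box N).
Proof.
  induction l as [|[m n] l (N & l_in_box)].
  - exists O. intros x [].
  - exists (N + Z.to_nat (Z.abs m) + Z.to_nat (Z.abs n))%nat. apply incl_cons.
    + apply in_box; simpl; lia.
    + eapply incl_tran; [exact l_in_box|]. apply incl_box. lia.
Qed.

Lemma tsum_box_limit (f : site -> R) eps : summable f -> 0 < eps ->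
  exists N0, forall N, (N0 <= N)%nat -> Rabs (lsum f (box N) - tsum f) < eps.
Proof.
  intros summable_f eps_pos. destruct (tsum_has_sum f summable_f eps eps_pos) as (l0 & near_sum).
  destruct (incl_some_box l0) as (N0 & l0_in_box). exists N0. intros N N0_le_N.
  apply near_sum; [apply NoDup_box|]. eapply incl_tran; [exact l0_in_box|]. now apply incl_box.
Qed.

Lemma lsum_box_growth (f : site -> R) B K s : (forall p, ~ In p (box K) -> f p <= B) ->
  lsum f (box (K + s)) <= lsum f (box K) + B * ((2 * INR (K + s) + 1) ^ 2 - (2 * INR K + 1) ^ 2).
Proof.
  intros f_le_B.
  assert (mono : lsum (fun p => B - f p) (box K) <= lsum (fun p => B - f p) (box (K + s))).
  { apply lsum_incl_le; auto using NoDup_box.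
    - apply incl_box. lia.
    - intros p _ p_out. specialize (f_le_B p p_out). lra. }
  rewrite !lsum_minus, !lsum_const, !length_box in mono. lra.
Qed.

Definition weight (p : site) : R := 1 + Rabs (IZR (fst p)) + Rabs (IZR (snd p)).

Lemma weight_IZR p : weight p = IZR (1 + Z.abs (fst p) + Z.abs (snd p)).
Proof. unfold weight. now rewrite !plus_IZR, !abs_IZR. Qed.

Lemma weight_ge_1 p : 1 <= weight p.
Proof. rewrite weight_IZR. apply IZR_le. lia. Qed.

Lemma weight_pos p : 0 < weight p.
Proof. pose proof (weight_ge_1 p); lra. Qed.

Lemma inv_weight_bounds p : 0 < / weight p <= 1.
Proof.
  pose proof (weight_ge_1 p). split; [apply Rinv_0_lt_compat; lra|].
  rewrite <- Rinv_1. apply Rinv_le_contravar; lra.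
Qed.

Lemma inv_weight_pow_pos p k : 0 < / weight p ^ k.
Proof. apply Rinv_0_lt_compat, pow_lt, weight_pos. Qed.

Lemma lt_weight_out_box N p : ~ In p (box N) -> INR N < weight p.
Proof. rewrite in_box, weight_IZR, INR_IZR_INZ. intros p_out. apply IZR_lt. lia. Qed.

Lemma weight_le_in_box N p : In p (box N) -> weight p <= 1 + 2 * INR N.
Proof.
  rewrite in_box, weight_IZR, INR_IZR_INZ, <- mult_IZR, <- plus_IZR. intros p_in. apply IZR_le. lia.
Qed.

Lemma lsum_Zrange_S (f : Z -> R) N :
  lsum f (Zrange (S N)) = f (Z.of_nat (S N)) + f (- Z.of_nat (S N))%Z + lsum f (Zrange N).
Proof.
  rewrite (lsum_perm f _ (Z.of_nat (S N) :: (- Z.of_nat (S N))%Z :: Zrange N)); [cbn [lsum]; ring|].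
  apply NoDup_Permutation; [apply NoDup_Zrange| |].
  - repeat constructor; [intros [|m_in]; [lia|]|intros m_in|apply NoDup_Zrange];
      apply in_Zrange in m_in; lia.
  - intros m. cbn [In]. rewrite !in_Zrange. lia.
Qed.

Lemma lsum_Zrange_inv_sqr N : lsum (fun m => / (1 + Rabs (IZR m)) ^ 2) (Zrange N) <= 3.
Proof.
  apply Rle_trans with (3 - 2 / (INR N + 1)).
  2:{ assert (0 < 2 / (INR N + 1)) by (apply Rdiv_lt_0_compat; pose proof (pos_INR N); lra). lra. }
  induction N as [|N IH]; [simpl; rewrite Rabs_R0; lra|].
  rewrite lsum_Zrange_S, opp_IZR, Rabs_Ropp, <- INR_IZR_INZ, Rabs_pos_eq, S_INR by apply pos_INR.
  pose proof (pos_INR N). set (x := INR N + 1) in *.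
  assert (/ (1 + x) ^ 2 <= / x - / (x + 1)); [|unfold Rdiv in *; lra].
  replace (/ x - / (x + 1)) with (/ (x * (x + 1))) by (field; unfold x; lra).
  apply Rinv_le_contravar; unfold x; nra.
Qed.

Lemma lsum_inv_weight4 l : NoDup l -> lsum (fun p => / weight p ^ 4) l <= 9.
Proof.
  intros nodup_l. destruct (incl_some_box l) as (N & l_in_box).
  set (a := fun m : Z => / (1 + Rabs (IZR m)) ^ 2).
  assert (a_nonneg : forall m, 0 <= a m).
  { intros m. left. apply Rinv_0_lt_compat, pow_lt. pose proof (Rabs_pos (IZR m)); lra. }
  apply Rle_trans with (lsum (fun p => / weight p ^ 4) (box N)).
  { apply lsum_incl_le; auto using NoDup_box. intros; left; apply inv_weight_pow_pos. }
  apply Rle_trans with (lsum (fun p : site => a (fst p) * a (snd p)) (box N)).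
  - apply lsum_le. intros p _. unfold a, weight. rewrite <- Rinv_mult.
    pose proof (Rabs_pos (IZR (fst p))). pose proof (Rabs_pos (IZR (snd p))).
    apply Rinv_le_contravar; [apply Rmult_lt_0_compat; apply pow_lt; lra|].
    rewrite <- Rpow_mult_distr, (pow_mult _ 2 2 : _ ^ 4 = _). apply pow_incr. nra.
  - unfold box, site. rewrite lsum_list_prod. cbn [fst snd].
    rewrite (lsum_ext _ (fun m => lsum a (Zrange N) * a m)) by (intros; rewrite lsum_scal; ring).
    rewrite lsum_scal. pose proof (lsum_Zrange_inv_sqr N) as range_sum. fold a in range_sum.
    assert (0 <= lsum a (Zrange N)) by (apply lsum_nonneg; auto). nra.
Qed.

Lemma summable_inv_weight4 : summable (fun p => / weight p ^ 4).
Proof.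
  exists 9. intros l nodup_l. rewrite (lsum_ext _ (fun p => / weight p ^ 4)); [now apply lsum_inv_weight4|].
  intros p _. apply Rabs_pos_eq. left. apply inv_weight_pow_pos.
Qed.

(** * Fields on bonds and functions on triangles *)

(* The cell at p carries the bonds p -> p+a1, p -> p+a2 and p+a1 -> p+a2;
   every unordered bond belongs to exactly one cell. *)
Inductive dir := East | NorthEast | NorthWest.

Definition shift (a b : Z) (p : site) : site := (fst p + a, snd p + b)%Z.

Definition source (i : dir) (p : site) : site :=
  match i with NorthWest => shift 1 0 p | _ => p end.
Definition target (i : dir) (p : site) : site :=
  match i with East => shift 1 0 p | _ => shift 0 1 p end.

Definition field := dir -> site -> R.

Definition grad (u : site -> R) : field := fun i p => u (target i p) - u (source i p).

Definition face := (site * bool)%type.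

(* The triangle (p, p+a1, p+a2). *)
Definition up_face (p : site) : face := (p, false).
(* The triangle (p+a1, p+a1+a2, p+a2). *)
Definition down_face (p : site) : face := (p, true).

(* The triangle centred at the branch point of yhat. *)
Definition origin_face : face := down_face (-1, -1)%Z.

Definition left_face (i : dir) (p : site) : face :=
  match i with
  | East | NorthWest => up_face p
  | NorthEast => down_face (shift (-1) 0 p)
  end.

Definition right_face (i : dir) (p : site) : face :=
  match i with
  | East => down_face (shift 0 (-1) p)
  | NorthEast => up_face p
  | NorthWest => down_face p
  end.

Definition rot (h : face -> R) : field := fun i p => h (left_face i p) - h (right_face i p).

Definition curl (b : field) (f : face) : R :=
  if snd f
  then b NorthEast (shift 1 0 (fst f)) - b East (shift 0 1 (fst f)) - b NorthWest (fst f)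
  else b East (fst f) + b NorthWest (fst f) - b NorthEast (fst f).

Definition cell_sum (b : field) (p : site) : R := b East p + b NorthEast p + b NorthWest p.
Definition face_cell_sum (h : face -> R) (p : site) : R := h (up_face p) + h (down_face p).

Definition field_sqr (b : field) : field := fun i p => b i p ^ 2.
Definition field_abs (b : field) : field := fun i p => Rabs (b i p).

Definition field_summable (b : field) : Prop := forall i, summable (b i).
Definition field_sum (b : field) : R := tsum (cell_sum b).
Definition face_sum (h : face -> R) : R := tsum (face_cell_sum h).

Definition field_supported (b : field) (l : list site) : Prop := forall i p, b i p <> 0 -> In p l.
Definition face_supported (h : face -> R) (l : list site) : Prop := forall f, h f <> 0 -> In (fst f) l.

Definition l1_bounded (b : field) (C : R) : Prop :=
  forall l, NoDup l -> lsum (cell_sum (field_abs b)) l <= C.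
Definition l2_bounded (b : field) (C : R) : Prop :=
  forall l, NoDup l -> lsum (cell_sum (field_sqr b)) l <= C.

Definition decays (k : nat) (b : field) : Prop :=
  exists C, 0 < C /\ forall i p, Rabs (b i p) <= C / weight p ^ k.

Lemma shift_shift a b c d p : shift a b (shift c d p) = shift (c + a) (d + b) p.
Proof. unfold shift; simpl. f_equal; lia. Qed.

Lemma shift_0 p : shift 0 0 p = p.
Proof. destruct p; unfold shift; simpl; f_equal; lia. Qed.

Lemma shift_shift_opp a b p : shift a b (shift (-a) (-b) p) = p.
Proof. rewrite shift_shift, !Z.add_opp_diag_l. apply shift_0. Qed.

Lemma shift_opp_shift a b p : shift (-a) (-b) (shift a b p) = p.
Proof. rewrite shift_shift, !Z.add_opp_diag_r. apply shift_0. Qed.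

Lemma summable_shift a b f : summable f -> summable (fun p => f (shift a b p)).
Proof. apply (summable_reindex _ (shift (-a) (-b))), shift_opp_shift. Qed.

Lemma tsum_shift a b f : summable f -> tsum (fun p => f (shift a b p)) = tsum f.
Proof.
  intros. apply (tsum_reindex _ (shift (-a) (-b)));
    auto using shift_opp_shift, shift_shift_opp.
Qed.

Lemma in_box_shift N a b p : (-1 <= a <= 1)%Z -> (-1 <= b <= 1)%Z ->
  In p (box N) -> In (shift a b p) (box (S N)).
Proof. intros a_le b_le p_in. apply in_box in p_in. apply in_box. unfold shift; simpl. lia. Qed.

Lemma source_in_box N i p : In p (box N) -> In (source i p) (box (S N)).
Proof. rewrite !in_box. destruct i; simpl; lia. Qed.

Lemma target_in_box N i p : In p (box N) -> In (target i p) (box (S N)).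
Proof. rewrite !in_box. destruct i; simpl; lia. Qed.

Lemma left_face_in_box N i p : In p (box N) -> In (fst (left_face i p)) (box (S N)).
Proof. rewrite !in_box. destruct i; simpl; lia. Qed.

Lemma right_face_in_box N i p : In p (box N) -> In (fst (right_face i p)) (box (S N)).
Proof. rewrite !in_box. destruct i; simpl; lia. Qed.

Lemma in_box_of_left_face N i p : In (fst (left_face i p)) (box N) -> In p (box (S N)).
Proof. rewrite !in_box. destruct i; simpl; lia. Qed.

Lemma in_box_of_right_face N i p : In (fst (right_face i p)) (box N) -> In p (box (S N)).
Proof. rewrite !in_box. destruct i; simpl; lia. Qed.

Lemma cell_sum_le a b p : (forall i, a i p <= b i p) -> cell_sum a p <= cell_sum b p.
Proof.
  intros a_le_b. unfold cell_sum.
  pose proof (a_le_b East); pose proof (a_le_b NorthEast); pose proof (a_le_b NorthWest). lra.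
Qed.

Lemma cell_sum_ext a b p : (forall i, a i p = b i p) -> cell_sum a p = cell_sum b p.
Proof. intros a_eq_b. unfold cell_sum. now rewrite !a_eq_b. Qed.

Lemma cell_sum_const c p : cell_sum (fun _ _ => c) p = 3 * c.
Proof. unfold cell_sum; ring. Qed.

Lemma cell_sum_0 b p : (forall i, b i p = 0) -> cell_sum b p = 0.
Proof. intros b_0. rewrite (cell_sum_ext b (fun _ _ => 0)), cell_sum_const by auto. ring. Qed.

Lemma cell_sum_nonneg b p : (forall i, 0 <= b i p) -> 0 <= cell_sum b p.
Proof.
  intros b_nonneg. replace 0 with (cell_sum (fun _ _ => 0) p) by (rewrite cell_sum_const; ring).
  now apply cell_sum_le.
Qed.

Lemma le_cell_sum b p i : (forall j, 0 <= b j p) -> b i p <= cell_sum b p.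
Proof.
  intros b_nonneg. unfold cell_sum.
  pose proof (b_nonneg East); pose proof (b_nonneg NorthEast); pose proof (b_nonneg NorthWest).
  destruct i; lra.
Qed.

Lemma Rabs_cell_sum_le b p : Rabs (cell_sum b p) <= cell_sum (field_abs b) p.
Proof.
  apply Rabs_le. split; [|apply (cell_sum_le b); intros; apply Rle_abs].
  assert (cell_sum (fun i p => - b i p) p <= cell_sum (field_abs b) p); [|unfold cell_sum in *; lra].
  apply cell_sum_le. intros i. unfold field_abs. rewrite <- Rabs_Ropp. apply Rle_abs.
Qed.

Lemma lsum_cell_sum_plus a b l :
  lsum (cell_sum (fun i p => a i p + b i p)) l = lsum (cell_sum a) l + lsum (cell_sum b) l.
Proof. rewrite <- lsum_plus. apply lsum_ext. intros. unfold cell_sum. ring. Qed.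

Lemma lsum_cell_sum_minus a b l :
  lsum (cell_sum (fun i p => a i p - b i p)) l = lsum (cell_sum a) l - lsum (cell_sum b) l.
Proof. rewrite <- lsum_minus. apply lsum_ext. intros. unfold cell_sum. ring. Qed.

Lemma lsum_cell_sum_scal c b l :
  lsum (cell_sum (fun i p => c * b i p)) l = c * lsum (cell_sum b) l.
Proof. rewrite <- lsum_scal. apply lsum_ext. intros. unfold cell_sum. ring. Qed.

Lemma lsum_cell_sum_le a b l :
  (forall i p, In p l -> a i p <= b i p) -> lsum (cell_sum a) l <= lsum (cell_sum b) l.
Proof. intros a_le_b. apply lsum_le. intros p p_in. apply cell_sum_le. auto. Qed.

Lemma lsum_cell_sum_ext a b l :
  (forall i p, In p l -> a i p = b i p) -> lsum (cell_sum a) l = lsum (cell_sum b) l.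
Proof. intros a_eq_b. apply lsum_ext. intros p p_in. apply cell_sum_ext. auto. Qed.

Lemma field_sqr_nonneg b i p : 0 <= field_sqr b i p.
Proof. apply pow2_ge_0. Qed.

Lemma summable_cell_sum b : field_summable b -> summable (cell_sum b).
Proof. intros summable_b. unfold cell_sum. repeat apply summable_plus; apply summable_b. Qed.

Lemma field_summable_plus a b :
  field_summable a -> field_summable b -> field_summable (fun i p => a i p + b i p).
Proof. intros summable_a summable_b i. apply summable_plus; auto. Qed.

Lemma field_summable_minus a b :
  field_summable a -> field_summable b -> field_summable (fun i p => a i p - b i p).
Proof. intros summable_a summable_b i. apply summable_minus; auto. Qed.

Lemma field_summable_scal c b : field_summable b -> field_summable (fun i p => c * b i p).
Proof. intros summable_b i. apply summable_scal; auto. Qed.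

Lemma field_summable_abs b : field_summable b -> field_summable (field_abs b).
Proof. intros summable_b i. now apply (summable_abs (b i)). Qed.

Lemma field_summable_le a b :
  (forall i p, Rabs (a i p) <= b i p) -> field_summable b -> field_summable a.
Proof. intros a_le_b summable_b i. apply (summable_le _ (b i)); auto. Qed.

Lemma field_summable_ext a b : (forall i p, a i p = b i p) -> field_summable a -> field_summable b.
Proof. intros a_eq_b summable_a i. apply (summable_ext (a i)); auto. Qed.

Lemma field_sum_ext a b : (forall i p, a i p = b i p) -> field_sum a = field_sum b.
Proof. intros a_eq_b. apply tsum_ext. intros p. now apply cell_sum_ext. Qed.

Lemma field_sum_plus a b : field_summable a -> field_summable b ->
  field_sum (fun i p => a i p + b i p) = field_sum a + field_sum b.
Proof.
  intros. unfold field_sum. rewrite <- tsum_plus; auto using summable_cell_sum.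
  apply tsum_ext. intros; unfold cell_sum; ring.
Qed.

Lemma field_sum_scal c b :
  field_summable b -> field_sum (fun i p => c * b i p) = c * field_sum b.
Proof.
  intros. unfold field_sum. rewrite <- tsum_scal; auto using summable_cell_sum.
  apply tsum_ext. intros; unfold cell_sum; ring.
Qed.

Lemma field_sum_minus a b : field_summable a -> field_summable b ->
  field_sum (fun i p => a i p - b i p) = field_sum a - field_sum b.
Proof.
  intros. unfold field_sum. rewrite <- tsum_minus; auto using summable_cell_sum.
  apply tsum_ext. intros; unfold cell_sum; ring.
Qed.

Lemma field_sum_le a b : field_summable a -> field_summable b ->
  (forall i p, a i p <= b i p) -> field_sum a <= field_sum b.
Proof.
  intros. apply tsum_le; auto using summable_cell_sum. intros p. now apply cell_sum_le.
Qed.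

Lemma field_sum_nonneg b : field_summable b -> (forall i p, 0 <= b i p) -> 0 <= field_sum b.
Proof.
  intros. apply tsum_nonneg; auto using summable_cell_sum. intros p. now apply cell_sum_nonneg.
Qed.

Lemma Rabs_field_sum_le b : field_summable b -> Rabs (field_sum b) <= field_sum (field_abs b).
Proof.
  intros summable_b. apply Rabs_tsum_le_bound; [now apply summable_cell_sum|]. intros l nodup_l.
  eapply Rle_trans; [apply Rabs_lsum_le|].
  eapply Rle_trans; [apply (lsum_le _ (cell_sum (field_abs b))); intros; apply Rabs_cell_sum_le|].
  apply lsum_le_tsum; auto using summable_cell_sum, field_summable_abs.
  intros p. apply cell_sum_nonneg. intros. apply Rabs_pos.
Qed.

Lemma field_supported_out b l i p : field_supported b l -> ~ In p l -> b i p = 0.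
Proof. intros supp_b p_out. apply NNPP. intros b_neq_0. now apply p_out, (supp_b i). Qed.

Lemma face_supported_out h l f : face_supported h l -> ~ In (fst f) l -> h f = 0.
Proof. intros supp_h f_out. apply NNPP. intros h_neq_0. now apply f_out, supp_h. Qed.

Lemma field_supported_sub a b l :
  (forall i p, a i p = 0 -> b i p = 0) -> field_supported a l -> field_supported b l.
Proof. intros zeros supp_a i p b_neq_0. apply (supp_a i). auto. Qed.

Lemma field_supported_incl b l l' : incl l l' -> field_supported b l -> field_supported b l'.
Proof. intros l_in_l' supp_b i p b_neq_0. now apply l_in_l', (supp_b i). Qed.

Lemma cell_sum_support b l p : field_supported b l -> cell_sum b p <> 0 -> In p l.
Proof.
  intros supp_b sum_neq_0. apply NNPP. intros p_out. apply sum_neq_0, cell_sum_0.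
  intros i. now apply (field_supported_out b l).
Qed.

Lemma field_summable_of_support b l : field_supported b l -> field_summable b.
Proof. intros supp_b i. apply (summable_of_support _ l). apply supp_b. Qed.

Lemma field_sum_finite b l : NoDup l -> field_supported b l -> field_sum b = lsum (cell_sum b) l.
Proof. intros nodup_l supp_b. apply tsum_finite; auto. intros p. now apply cell_sum_support. Qed.

Lemma rot_supported h N : face_supported h (box N) -> field_supported (rot h) (box (S N)).
Proof.
  intros supp_h i p rot_neq_0. apply NNPP. intros p_out. apply rot_neq_0. unfold rot.
  rewrite (face_supported_out h (box N) (left_face i p)), (face_supported_out h (box N) (right_face i p));
    auto; [ring|..]; intros f_in; apply p_out.
  - now apply in_box_of_right_face in f_in.
  - now apply in_box_of_left_face in f_in.
Qed.

(* a is paired with X on the left of a bond and with Y on its right. *)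
Lemma field_sum_by_faces (a : face -> R) (X Y : field) :
  field_summable (fun i p => a (left_face i p) * X i p) ->
  field_summable (fun i p => a (right_face i p) * Y i p) ->
  field_sum (fun i p => a (left_face i p) * X i p + a (right_face i p) * Y i p) =
  face_sum (fun f => a f *
    (if snd f
     then X NorthEast (shift 1 0 (fst f)) + Y East (shift 0 1 (fst f)) + Y NorthWest (fst f)
     else X East (fst f) + X NorthWest (fst f) + Y NorthEast (fst f))).
Proof.
  intros summable_X summable_Y. rewrite field_sum_plus by auto. unfold field_sum, cell_sum, face_sum, face_cell_sum.
  pose proof (summable_X NorthEast) as summable_X_NE. pose proof (summable_Y East) as summable_Y_E.
  repeat rewrite tsum_plus by auto using summable_plus.
  rewrite <- (tsum_shift 1 0 (fun p => a (left_face NorthEast p) * X NorthEast p)) by auto.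
  rewrite <- (tsum_shift 0 1 (fun p => a (right_face East p) * Y East p)) by auto.
  apply (summable_shift 1 0) in summable_X_NE. apply (summable_shift 0 1) in summable_Y_E.
  repeat rewrite <- tsum_plus by auto using summable_plus.
  apply tsum_ext. intros p. simpl. rewrite !shift_shift; simpl; rewrite !shift_0. ring.
Qed.

Lemma summation_by_parts (h : face -> R) (b : field) :
  field_summable (fun i p => h (left_face i p) * b i p) ->
  field_summable (fun i p => h (right_face i p) * b i p) ->
  field_sum (fun i p => rot h i p * b i p) = face_sum (fun f => h f * curl b f).
Proof.
  intros summable_left summable_right.
  rewrite (field_sum_ext _ (fun i p => h (left_face i p) * b i p + h (right_face i p) * (- b i p)))
    by (intros; unfold rot; ring).
  apply (field_sum_by_faces h b (fun i p => - b i p)); auto.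
  apply (field_summable_ext (fun i p => -1 * (h (right_face i p) * b i p))); [intros; ring|].
  now apply field_summable_scal.
Qed.

Lemma summation_by_parts_field_supported h b l : field_supported b l ->
  field_sum (fun i p => rot h i p * b i p) = face_sum (fun f => h f * curl b f).
Proof.
  intros supp_b. apply summation_by_parts; apply (field_summable_of_support _ l);
    apply (field_supported_sub b); auto; intros i p ->; ring.
Qed.

Lemma summation_by_parts_face_supported h b N : face_supported h (box N) ->
  field_sum (fun i p => rot h i p * b i p) = face_sum (fun f => h f * curl b f).
Proof.
  intros supp_h. apply summation_by_parts; apply (field_summable_of_support _ (box (S N))); intros i p neq_0.
  - apply (in_box_of_left_face N i), supp_h. intros h_0. apply neq_0. rewrite h_0. ring.
  - apply (in_box_of_right_face N i), supp_h. intros h_0. apply neq_0. rewrite h_0. ring.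
Qed.

Definition faces_over (l : list site) : list face := flat_map (fun p => [up_face p; down_face p]) l.

Lemma in_faces_over l f : In f (faces_over l) <-> In (fst f) l.
Proof.
  destruct f as [p s]. unfold faces_over. rewrite in_flat_map. split.
  - intros (q & q_in & [[= -> _]|[[= -> _]|[]]]); auto.
  - intros p_in. exists p. split; auto. destruct s; [right; left|left]; reflexivity.
Qed.

Lemma NoDup_faces_over l : NoDup l -> NoDup (faces_over l).
Proof.
  induction 1 as [|p l p_notin _ IH]; [constructor|].
  assert (faces_notin : forall s, ~ In (p, s) (faces_over l)) by (intros s; now rewrite in_faces_over).
  simpl. repeat constructor; auto.
  - intros [|]; [discriminate|]. now apply (faces_notin false).
  - apply faces_notin.
Qed.

Lemma lsum_face_cell_sum (h : face -> R) l : lsum (face_cell_sum h) l = lsum h (faces_over l).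
Proof.
  unfold faces_over. rewrite lsum_flat_map. apply lsum_ext. intros p _. unfold face_cell_sum; simpl; ring.
Qed.

Lemma face_sum_finite (h : face -> R) L : NoDup L -> (forall f, h f <> 0 -> In f L) -> face_sum h = lsum h L.
Proof.
  intros nodup_L supp_h. destruct (incl_some_box (map fst L)) as (N & L_in_box).
  assert (supp_box : face_supported h (box N)) by (intros f h_neq_0; apply L_in_box, in_map; auto).
  unfold face_sum. rewrite (tsum_finite _ (box N) (NoDup_box N)), lsum_face_cell_sum.
  - apply lsum_support_eq; auto using NoDup_faces_over, NoDup_box.
    intros f h_neq_0. now apply in_faces_over, supp_box.
  - intros p sum_neq_0. apply NNPP. intros p_out. apply sum_neq_0. unfold face_cell_sum.
    rewrite !(face_supported_out h (box N)) by auto. ring.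
Qed.

Lemma curl_grad u f : curl (grad u) f = 0.
Proof. destruct f as [p []]; unfold curl, grad; simpl; rewrite ?shift_shift; simpl; ring. Qed.

Lemma curl_ext a b f : (forall i p, a i p = b i p) -> curl a f = curl b f.
Proof. intros a_eq_b. unfold curl. now rewrite !a_eq_b. Qed.

Lemma curl_plus a b f : curl (fun i p => a i p + b i p) f = curl a f + curl b f.
Proof. unfold curl; destruct (snd f); ring. Qed.

Lemma curl_minus a b f : curl (fun i p => a i p - b i p) f = curl a f - curl b f.
Proof. unfold curl; destruct (snd f); ring. Qed.

Lemma curl_scal c b f : curl (fun i p => c * b i p) f = c * curl b f.
Proof. unfold curl; destruct (snd f); ring. Qed.

Lemma curl_0 f : curl (fun _ _ => 0) f = 0.
Proof. unfold curl; destruct (snd f); ring. Qed.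

Lemma Rabs_curl_le b C f :
  (forall i a c, (-1 <= a <= 1)%Z -> (-1 <= c <= 1)%Z -> Rabs (b i (shift a c (fst f))) <= C) ->
  Rabs (curl b f) <= 3 * C.
Proof.
  intros b_le.
  assert (b_le_here : forall i, Rabs (b i (fst f)) <= C).
  { intros i. rewrite <- (shift_0 (fst f)). apply b_le; lia. }
  assert (triangle : forall x y z, Rabs x <= C -> Rabs y <= C -> Rabs z <= C -> Rabs (x - y - z) <= 3 * C).
  { intros x y z. rewrite !Rabs_le_between. lra. }
  unfold curl. destruct (snd f).
  - apply triangle; auto; apply b_le; lia.
  - replace (_ + _ - _) with (b East (fst f) - b NorthEast (fst f) - - b NorthWest (fst f)) by ring.
    apply triangle; auto. now rewrite Rabs_Ropp.
Qed.

Lemma field_sqr_summable b C : l2_bounded b C -> field_summable (field_sqr b).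
Proof.
  intros bounded i. exists C. intros l nodup_l. eapply Rle_trans; [|apply (bounded l nodup_l)].
  apply lsum_le. intros p _. rewrite Rabs_pos_eq by apply field_sqr_nonneg.
  apply le_cell_sum. intros; apply field_sqr_nonneg.
Qed.

Lemma l2_bounded_field_sum b : field_summable (field_sqr b) -> l2_bounded b (field_sum (field_sqr b)).
Proof.
  intros summable_b l nodup_l. apply lsum_le_tsum; auto using summable_cell_sum.
  intros p. apply cell_sum_nonneg. intros; apply field_sqr_nonneg.
Qed.

Lemma field_sum_sqr_le b C : l2_bounded b C -> field_sum (field_sqr b) <= C.
Proof.
  intros bounded. apply tsum_le_bound; auto. eapply summable_cell_sum, field_sqr_summable; eauto.
Qed.

Lemma l2_bounded_weaken b C C' : C <= C' -> l2_bounded b C -> l2_bounded b C'.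
Proof. intros C_le_C' bounded l nodup_l. eapply Rle_trans; [apply bounded|]; auto. Qed.

Lemma l2_bounded_ext a b C : (forall i p, a i p = b i p) -> l2_bounded a C -> l2_bounded b C.
Proof.
  intros a_eq_b bounded l nodup_l. rewrite (lsum_cell_sum_ext _ (field_sqr a)); auto.
  intros i p _. unfold field_sqr. now rewrite a_eq_b.
Qed.

Lemma l2_bounded_supported b l : field_supported b l -> exists C, l2_bounded b C.
Proof.
  intros supp_b. exists (field_sum (field_sqr b)). apply l2_bounded_field_sum, (field_summable_of_support _ l).
  apply (field_supported_sub b); auto. intros i p b_0. unfold field_sqr. rewrite b_0. ring.
Qed.

Lemma l2_bounded_minus a b A B :
  l2_bounded a A -> l2_bounded b B -> l2_bounded (fun i p => a i p - b i p) (2 * A + 2 * B).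
Proof.
  intros a_bounded b_bounded l nodup_l.
  apply Rle_trans with (lsum (cell_sum (fun i p => 2 * field_sqr a i p + 2 * field_sqr b i p)) l).
  - apply lsum_cell_sum_le. intros i p _. unfold field_sqr. pose proof (pow2_ge_0 (a i p + b i p)). nra.
  - rewrite (lsum_cell_sum_plus (fun i p => 2 * field_sqr a i p)), !lsum_cell_sum_scal.
    specialize (a_bounded l nodup_l). specialize (b_bounded l nodup_l). lra.
Qed.

Lemma field_sqr_summable_minus a b :
  field_summable (field_sqr a) -> field_summable (field_sqr b) ->
  field_summable (field_sqr (fun i p => a i p - b i p)).
Proof. intros. eapply field_sqr_summable, l2_bounded_minus; now apply l2_bounded_field_sum. Qed.

Lemma field_mul_summable a b : field_summable (field_sqr a) -> field_summable (field_sqr b) ->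
  field_summable (fun i p => a i p * b i p).
Proof. intros summable_a summable_b i. apply summable_mul; [apply summable_a|apply summable_b]. Qed.

Lemma l2_bounded_sqr_le b C i p : l2_bounded b C -> b i p ^ 2 <= C.
Proof.
  intros bounded. specialize (bounded [p] ltac:(repeat constructor; tauto)). simpl in bounded.
  eapply Rle_trans; [apply (le_cell_sum (field_sqr b) p i); intros; apply field_sqr_nonneg|]. lra.
Qed.

Lemma l2_bounded_Rabs_le b C i p : l2_bounded b C -> Rabs (b i p) <= 1 + C.
Proof.
  intros bounded. apply (l2_bounded_sqr_le b C i p) in bounded.
  rewrite <- pow2_abs in bounded. nra.
Qed.

Lemma field_summable_inv_weight4 : field_summable (fun _ p => / weight p ^ 4).
Proof. intros i. apply summable_inv_weight4. Qed.

Lemma field_sum_inv_weight4_le c : 0 <= c -> field_sum (fun _ p => c * / weight p ^ 4) <= 27 * c.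
Proof.
  intros c_nonneg. rewrite field_sum_scal by apply field_summable_inv_weight4.
  rewrite (Rmult_comm 27). apply Rmult_le_compat_l; auto.
  apply tsum_le_bound; [apply summable_cell_sum, field_summable_inv_weight4|]. intros l nodup_l.
  unfold cell_sum. rewrite !lsum_plus. pose proof (lsum_inv_weight4 l nodup_l). lra.
Qed.

Lemma decays_of_far (k K : nat) (b : field) C :
  (forall i p, INR K <= weight p -> Rabs (b i p) <= C / weight p ^ k) -> decays k b.
Proof.
  intros far_bound.
  set (near_sum := lsum (cell_sum (fun i p => Rabs (b i p) * weight p ^ k)) (box K)).
  assert (terms_nonneg : forall i p, 0 <= Rabs (b i p) * weight p ^ k).
  { intros. apply Rmult_le_pos; [apply Rabs_pos|apply pow_le, Rlt_le, weight_pos]. }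
  assert (near_sum_nonneg : 0 <= near_sum) by (apply lsum_nonneg; intros; apply cell_sum_nonneg; auto).
  exists (near_sum + Rabs C + 1). pose proof (Rabs_pos C) as abs_C. split; [lra|].
  intros i p. pose proof (pow_lt (weight p) k (weight_pos p)) as wk_pos.
  apply Rle_div_r; auto.
  destruct (classic (In p (box K))) as [p_in|p_out].
  - apply Rle_trans with near_sum; [|lra].
    eapply Rle_trans; [apply (le_cell_sum (fun i p => Rabs (b i p) * weight p ^ k)); auto|].
    set (s := cell_sum _) in *. replace (s p) with (lsum s [p]) by (simpl; ring).
    apply lsum_incl_le; [repeat constructor; tauto|apply NoDup_box|now intros q [<-|[]]|].
    intros. now apply cell_sum_nonneg.
  - apply lt_weight_out_box in p_out. specialize (far_bound i p (Rlt_le _ _ p_out)).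
    apply Rle_div_r in far_bound; auto. pose proof (Rle_abs C). lra.
Qed.

Lemma decays_weaken k k' b : (k <= k')%nat -> decays k' b -> decays k b.
Proof.
  intros k_le_k' (C & C_pos & bound_C). exists C. split; auto. intros i p.
  eapply Rle_trans; [apply bound_C|]. apply Rmult_le_compat_l; [lra|].
  apply Rinv_le_contravar; [apply pow_lt, weight_pos|]. apply Rle_pow; auto using weight_ge_1.
Qed.

Lemma decays_plus k a b : decays k a -> decays k b -> decays k (fun i p => a i p + b i p).
Proof.
  intros (C & C_pos & bound_C) (C' & C'_pos & bound_C'). exists (C + C'). split; [lra|]. intros i p.
  eapply Rle_trans; [apply Rabs_triang|]. rewrite Rdiv_plus_distr. now apply Rplus_le_compat.
Qed.

Lemma decays_ext k a b : (forall i p, a i p = b i p) -> decays k a -> decays k b.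
Proof. intros a_eq_b (C & C_pos & bound_C). exists C. split; auto. intros. now rewrite <- a_eq_b. Qed.

Lemma decays_mul j k a b : decays j a -> decays k b -> decays (j + k) (fun i p => a i p * b i p).
Proof.
  intros (C & C_pos & bound_C) (C' & C'_pos & bound_C'). exists (C * C'). split; [now apply Rmult_lt_0_compat|].
  intros i p. rewrite Rabs_mult, pow_add. pose proof (weight_pos p).
  replace (C * C' / (weight p ^ j * weight p ^ k)) with (C / weight p ^ j * (C' / weight p ^ k))
    by (field; split; apply pow_nonzero; lra).
  apply Rmult_le_compat; auto using Rabs_pos.
Qed.

Lemma pow2_le_of_Rabs_le a b : Rabs a <= b -> a ^ 2 <= b ^ 2.
Proof. intros a_le_b. rewrite <- pow2_abs. apply pow_incr. auto using Rabs_pos. Qed.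

Lemma field_sqr_summable_of_decays b : decays 2 b -> field_summable (field_sqr b).
Proof.
  intros (C & _ & bound_C).
  apply (field_summable_le _ (fun i p => C ^ 2 * / weight p ^ 4));
    [|apply field_summable_scal, field_summable_inv_weight4].
  intros i p. rewrite Rabs_pos_eq by apply field_sqr_nonneg. unfold field_sqr.
  specialize (bound_C i p). apply pow2_le_of_Rabs_le in bound_C.
  replace (C ^ 2 * / weight p ^ 4) with ((C / weight p ^ 2) ^ 2); auto.
  pose proof (weight_pos p). field. lra.
Qed.

(** * Curl-free fields are gradients *)

Lemma Z_antiderivative (f : Z -> R) :
  exists F : Z -> R, F 0%Z = 0 /\ forall k, F (k + 1)%Z - F k = f k.
Proof.
  exists (fun k => if Z_le_dec 0 k then lsum (fun j => f (Z.of_nat j)) (seq 0 (Z.to_nat k))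
                   else - lsum (fun j => f (- Z.of_nat j - 1)%Z) (seq 0 (Z.to_nat (- k)))).
  split; [destruct Z_le_dec; [reflexivity|lia]|].
  intros k. destruct (Z_le_dec 0 (k + 1)), (Z_le_dec 0 k); try lia.
  - replace (Z.to_nat (k + 1)) with (S (Z.to_nat k)) by lia.
    rewrite seq_S, lsum_app. simpl. replace (Z.of_nat (Z.to_nat k)) with k by lia. ring.
  - assert (k = -1)%Z as -> by lia. simpl. ring.
  - replace (Z.to_nat (- k)) with (S (Z.to_nat (- (k + 1)))) by lia.
    rewrite seq_S, lsum_app. simpl.
    replace (- Z.of_nat (Z.to_nat (- (k + 1))) - 1)%Z with k by lia. ring.
Qed.

Lemma Z_iff_ind (P : Z -> Prop) : P 0%Z -> (forall k, P k <-> P (k + 1)%Z) -> forall k, P k.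
Proof. intros P_0 P_iff. apply Z.bi_induction; auto. intros x y ->; reflexivity. Qed.

Lemma curl_free_is_grad (b : field) : (forall f, curl b f = 0) ->
  exists u, u xi0 = 0 /\ forall i p, grad u i p = b i p.
Proof.
  intros curl_free.
  destruct (Z_antiderivative (fun k => b East (k, 0%Z))) as (F & _ & F_step).
  destruct (choice _ (fun m => Z_antiderivative (fun n => b NorthEast (m, n)))) as (G & G_spec).
  set (u := fun p : site => F (fst p) + G (fst p) (snd p)).
  assert (step_NorthEast : forall m n, u (m, n + 1)%Z - u (m, n) = b NorthEast (m, n)).
  { intros m n. unfold u; simpl. destruct (G_spec m) as (_ & <-). ring. }
  assert (step_East : forall m n, u (m + 1, n)%Z - u (m, n) = b East (m, n)).
  { intros m. apply Z_iff_ind.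
    - unfold u; simpl. destruct (G_spec m) as (-> & _), (G_spec (m + 1)%Z) as (-> & _).
      rewrite <- F_step. ring.
    - intros n. pose proof (step_NorthEast m n). pose proof (step_NorthEast (m + 1)%Z n).
      pose proof (curl_free (up_face (m, n))) as curl_up. pose proof (curl_free (down_face (m, n))) as curl_down.
      unfold curl, shift in curl_up, curl_down; simpl in curl_up, curl_down.
      rewrite !Z.add_0_r in curl_down. split; lra. }
  exists (fun p => u p - u xi0). split; [ring|].
  intros i [m n]. pose proof (step_East m n). pose proof (step_NorthEast m n).
  pose proof (curl_free (up_face (m, n))) as curl_up. unfold curl in curl_up; simpl in curl_up.
  unfold grad. destruct i; unfold target, source, shift; simpl; rewrite ?Z.add_0_r; lra.
Qed.

(** * Neutral boxes around a charge *)

Lemma lsum_Zrange_telescope (g : Z -> R) N :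
  lsum (fun n => g n - g (n + 1)%Z) (Zrange N) = g (- Z.of_nat N)%Z - g (Z.of_nat N + 1)%Z.
Proof.
  induction N as [|N IH]; [simpl; ring|].
  rewrite lsum_Zrange_S, IH. rewrite Nat2Z.inj_succ.
  replace (Z.succ (Z.of_nat N)) with (Z.of_nat N + 1)%Z by lia.
  replace (- (Z.of_nat N + 1) + 1)%Z with (- Z.of_nat N)%Z by lia. ring.
Qed.

Lemma lsum_curl_box (b : field) N :
  lsum (face_cell_sum (curl b)) (box N) =
    lsum (fun m => b East (m, - Z.of_nat N)%Z) (Zrange N)
    - lsum (fun m => b East (m, Z.of_nat N + 1)%Z) (Zrange N)
    + lsum (fun n => b NorthEast (Z.of_nat N + 1, n)%Z) (Zrange N)
    - lsum (fun n => b NorthEast (- Z.of_nat N, n)%Z) (Zrange N).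
Proof.
  unfold box, site. rewrite lsum_list_prod.
  rewrite (lsum_ext _ (fun m => lsum (fun n => b East (m, n) - b East (m, n + 1)%Z) (Zrange N)
      + lsum (fun n => -1 * (b NorthEast (m, n) - b NorthEast (m + 1, n)%Z)) (Zrange N))).
  2:{ intros m _. rewrite <- lsum_plus. apply lsum_ext. intros n _.
      unfold face_cell_sum, curl, shift; simpl. rewrite !Z.add_0_r. ring. }
  rewrite lsum_plus, (lsum_swap (fun m n => -1 * (b NorthEast (m, n) - b NorthEast (m + 1, n)%Z))).
  rewrite (lsum_ext _ (fun m => b East (m, - Z.of_nat N)%Z - b East (m, Z.of_nat N + 1)%Z)).
  2:{ intros m _. apply (lsum_Zrange_telescope (fun n => b East (m, n))). }
  rewrite (lsum_ext (fun n => lsum _ _)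
    (fun n => b NorthEast (Z.of_nat N + 1, n)%Z - b NorthEast (- Z.of_nat N, n)%Z)).
  2:{ intros n _. rewrite lsum_scal, (lsum_Zrange_telescope (fun m => b NorthEast (m, n))). ring. }
  rewrite !lsum_minus. ring.
Qed.

Lemma lsum_two_box_sides_le (g : site -> R) (line : Z -> Z -> site) j : (forall p, 0 <= g p) ->
  (forall t t' m m', line t m = line t' m' -> t = t' /\ m = m') ->
  (forall t m n, In (line t m) (box n) <-> (Z.abs t <= Z.of_nat n /\ Z.abs m <= Z.of_nat n)%Z) ->
  lsum (fun m => g (line (- Z.of_nat (S j))%Z m)) (Zrange (S j))
    + lsum (fun m => g (line (Z.of_nat (S j) + 1)%Z m)) (Zrange (S j))
    + lsum g (box j) <= lsum g (box (S (S j))).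
Proof.
  intros g_nonneg line_inj line_in_box. set (k := S j).
  rewrite <- (lsum_map (line (- Z.of_nat k)%Z) g), <- (lsum_map (line (Z.of_nat k + 1)%Z) g), <- !lsum_app.
  assert (nodup_line : forall t, NoDup (map (line t) (Zrange k))).
  { intros t. apply FinFun.Injective_map_NoDup; [intros x y; apply line_inj|apply NoDup_Zrange]. }
  assert (in_line : forall p t, In p (map (line t) (Zrange k)) -> exists m, p = line t m /\ (Z.abs m <= Z.of_nat k)%Z).
  { intros p t p_in. apply in_map_iff in p_in. destruct p_in as (m & <- & m_in). apply in_Zrange in m_in. eauto. }
  apply lsum_incl_le; auto using NoDup_box.
  - apply NoDup_app; [apply NoDup_app; auto|apply NoDup_box|].
    + intros p p_in p_in'. apply in_line in p_in, p_in'.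
      destruct p_in as (m & -> & _), p_in' as (m' & same & _). apply line_inj in same. lia.
    + intros p p_in p_in_box. apply in_app_iff in p_in.
      destruct p_in as [p_in|p_in]; apply in_line in p_in; destruct p_in as (m & -> & _);
        apply line_in_box in p_in_box; lia.
  - apply incl_app; [apply incl_app|apply incl_box; lia];
      intros p p_in; apply in_line in p_in; destruct p_in as (m & -> & m_le); apply line_in_box; lia.
Qed.

Lemma circulation_sqr_le (b : field) j :
  (lsum (face_cell_sum (curl b)) (box (S j))) ^ 2 <=
  (8 * INR j + 12) * (lsum (cell_sum (field_sqr b)) (box (S (S j))) - lsum (cell_sum (field_sqr b)) (box j)).
Proof.
  rewrite lsum_curl_box. set (k := S j).
  assert (side_sqr_le : forall side : Z -> R,
    lsum side (Zrange k) ^ 2 <= (2 * INR j + 3) * lsum (fun m => side m ^ 2) (Zrange k)).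
  { intros side. pose proof (sqr_lsum_le side (Zrange k)) as cauchy_schwarz.
    rewrite length_Zrange in cauchy_schwarz. unfold k at 2 in cauchy_schwarz. rewrite S_INR in cauchy_schwarz.
    replace (2 * INR j + 3) with (2 * (INR j + 1) + 1) by ring. exact cauchy_schwarz. }
  pose proof (side_sqr_le (fun m => b East (m, - Z.of_nat k)%Z)) as bottom_le.
  pose proof (side_sqr_le (fun m => b East (m, Z.of_nat k + 1)%Z)) as top_le.
  pose proof (side_sqr_le (fun n => b NorthEast (Z.of_nat k + 1, n)%Z)) as right_le.
  pose proof (side_sqr_le (fun n => b NorthEast (- Z.of_nat k, n)%Z)) as left_le.
  assert (East_sides : lsum (fun m => b East (m, - Z.of_nat k)%Z ^ 2) (Zrange k)
      + lsum (fun m => b East (m, Z.of_nat k + 1)%Z ^ 2) (Zrange k)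
      + lsum (field_sqr b East) (box j) <= lsum (field_sqr b East) (box (S k))).
  { apply (lsum_two_box_sides_le (field_sqr b East) (fun t m => (m, t)) j); auto using field_sqr_nonneg.
    - intros t t' m m' [=]; auto.
    - intros t m n. rewrite in_box. simpl. tauto. }
  assert (NorthEast_sides : lsum (fun n => b NorthEast (- Z.of_nat k, n)%Z ^ 2) (Zrange k)
      + lsum (fun n => b NorthEast (Z.of_nat k + 1, n)%Z ^ 2) (Zrange k)
      + lsum (field_sqr b NorthEast) (box j) <= lsum (field_sqr b NorthEast) (box (S k))).
  { apply (lsum_two_box_sides_le (field_sqr b NorthEast) (fun t m => (t, m)) j); auto using field_sqr_nonneg.
    - intros t t' m m' [=]; auto.
    - intros t m n. rewrite in_box. simpl. tauto. }
  assert (NorthWest_mono : lsum (field_sqr b NorthWest) (box j) <= lsum (field_sqr b NorthWest) (box (S k))).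
  { apply lsum_incl_le; auto using NoDup_box, field_sqr_nonneg. apply incl_box. unfold k. lia. }
  unfold cell_sum. rewrite !lsum_plus. pose proof (pos_INR j).
  set (bottom := lsum _ _) in bottom_le at 1 |- * at 1. set (top := lsum _ _) in top_le at 1 |- * at 1.
  set (right := lsum _ _) in right_le at 1 |- * at 1. set (left := lsum _ _) in left_le at 1 |- * at 1.
  apply Rle_trans with (4 * (bottom ^ 2 + top ^ 2 + right ^ 2 + left ^ 2)).
  { pose proof (pow2_ge_0 (bottom + left)). pose proof (pow2_ge_0 (top + right)).
    pose proof (pow2_ge_0 (top - left)). pose proof (pow2_ge_0 (right + left)). nra. }
  nra.
Qed.

Lemma ln_succ_le x : -1 < x -> ln (1 + x) <= x.
Proof.
  intros x_gt. destruct (Req_dec x 0) as [->|x_neq_0]; [rewrite Rplus_0_r, ln_1; lra|].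
  rewrite <- (ln_exp x) at 2. left. apply ln_increasing; [lra|]. now apply exp_ineq1.
Qed.

Lemma harmonic_lower K : ln (INR K + 1) <= 12 * lsum (fun j => / (8 * INR j + 12)) (seq 0 K).
Proof.
  induction K as [|K IH]; [simpl; rewrite Rplus_0_l, ln_1; lra|].
  rewrite seq_S, lsum_app, S_INR. cbn [lsum Nat.add]. pose proof (pos_INR K).
  assert (step : ln (INR K + 1 + 1) - ln (INR K + 1) <= / (INR K + 1)).
  { rewrite <- ln_div by lra. replace ((INR K + 1 + 1) / (INR K + 1)) with (1 + / (INR K + 1)) by (field; lra).
    apply ln_succ_le. apply Rlt_trans with 0; [lra|]. apply Rinv_0_lt_compat; lra. }
  assert (/ (INR K + 1) <= 12 * / (8 * INR K + 12)); [|lra].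
  replace (/ (INR K + 1)) with (12 * / (12 * INR K + 12)) by (field; lra).
  apply Rmult_le_compat_l; [lra|]. apply Rinv_le_contravar; lra.
Qed.

Lemma lsum_telescope_two (s : nat -> R) K :
  lsum (fun j => s (S (S j)) - s j) (seq 0 K) = s K + s (S K) - s 0%nat - s 1%nat.
Proof.
  induction K as [|K IH]; [simpl; ring|]. rewrite seq_S, lsum_app, IH. simpl. ring.
Qed.

Definition int_valued {A : Type} (h : A -> R) : Prop := forall a, exists k : Z, h a = IZR k.

Lemma lsum_int_valued {A} (h : A -> R) l : int_valued h -> exists k : Z, lsum h l = IZR k.
Proof.
  intros int_h. induction l as [|a l (k & IH)]; [now exists 0%Z|].
  destruct (int_h a) as (k' & ha_eq). exists (k' + k)%Z. simpl. now rewrite IH, ha_eq, plus_IZR.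
Qed.

Lemma one_le_sqr_IZR z : z <> 0%Z -> 1 <= IZR z ^ 2.
Proof. intros z_neq_0. rewrite pow_IZR. apply IZR_le. simpl Z.of_nat. nia. Qed.

(* If all boxes up to size K had nonzero charge, the energy would exceed a multiple of ln K. *)
Lemma neutral_box_exists C : exists K : nat, forall b : field,
  int_valued (curl b) -> l2_bounded b C ->
  exists k, (k <= K)%nat /\ lsum (face_cell_sum (curl b)) (box k) = 0.
Proof.
  destruct (INR_unbounded (exp (24 * C))) as (K & K_large). exists K. intros b int_curl bounded.
  apply NNPP. intros no_neutral_box.
  set (E := fun k => lsum (cell_sum (field_sqr b)) (box k)).
  assert (ring_energy : forall j, (j < K)%nat -> / (8 * INR j + 12) <= E (S (S j)) - E j).
  { intros j j_lt_K. pose proof (circulation_sqr_le b j) as circ_le. fold (E (S (S j))) (E j) in circ_le.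
    rewrite lsum_face_cell_sum in circ_le.
    destruct (lsum_int_valued (curl b) (faces_over (box (S j))) int_curl) as (z & circ_eq).
    assert (1 <= IZR z ^ 2).
    { apply one_le_sqr_IZR. intros ->. apply no_neutral_box. exists (S j). split; [lia|].
      now rewrite lsum_face_cell_sum. }
    rewrite circ_eq in circ_le. pose proof (pos_INR j).
    apply (Rmult_le_reg_l (8 * INR j + 12)); [lra|]. rewrite Rinv_r; lra. }
  assert (harmonic_le : lsum (fun j => / (8 * INR j + 12)) (seq 0 K) <= E K + E (S K) - E 0%nat - E 1%nat).
  { rewrite <- lsum_telescope_two. apply lsum_le. intros j j_in. apply in_seq in j_in. apply ring_energy. lia. }
  assert (E_bounds : forall k, 0 <= E k <= C).
  { intros k. split; [|apply bounded, NoDup_box].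
    apply lsum_nonneg. intros; apply cell_sum_nonneg; intros; apply field_sqr_nonneg. }
  pose proof (E_bounds 0%nat). pose proof (E_bounds 1%nat). pose proof (E_bounds K). pose proof (E_bounds (S K)).
  pose proof (harmonic_lower K).
  assert (24 * C < ln (INR K + 1)); [|lra].
  rewrite <- (ln_exp (24 * C)). apply ln_increasing; [apply exp_pos|lra].
Qed.

(** * Cancelling the integer circulations of a field of bounded energy *)

Definition indicator (g f : face) : R := if classic_eq_dec g f then 1 else 0.

Lemma indicator_same f : indicator f f = 1.
Proof. unfold indicator. destruct classic_eq_dec; congruence. Qed.

Lemma indicator_neq f g : f <> g -> indicator f g = 0.
Proof. intros f_neq_g. unfold indicator. destruct classic_eq_dec; congruence. Qed.

Lemma indicator_int f g : exists k : Z, indicator f g = IZR k.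
Proof. unfold indicator. destruct classic_eq_dec; [now exists 1%Z|now exists 0%Z]. Qed.

Lemma lsum_mul_indicator (h : face -> R) L f : NoDup L ->
  lsum (fun g => h g * indicator g f) L = if excluded_middle_informative (In f L) then h f else 0.
Proof.
  intros nodup_L. destruct excluded_middle_informative as [f_in|f_out].
  - rewrite <- (lsum_incl_eq _ [f]); [cbn [lsum]; rewrite indicator_same; ring|repeat constructor; tauto|auto|..].
    + now intros g [<-|[]].
    + intros g _ g_out. rewrite indicator_neq; [ring|]. intros ->. apply g_out. now left.
  - apply lsum_0. intros g g_in. rewrite indicator_neq; [ring|]. congruence.
Qed.

Definition integer_flow (K : R) (N : field) : Prop :=
  (exists l, field_supported N l) /\ (forall i, int_valued (N i)) /\ l1_bounded N K.

Lemma integer_flow_0 K : 0 <= K -> integer_flow K (fun _ _ => 0).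
Proof.
  intros K_nonneg. repeat split.
  - exists nil. intros i p neq_0. lra.
  - intros i p. now exists 0%Z.
  - intros l _. rewrite lsum_0; auto. intros p _. apply cell_sum_0. intros. apply Rabs_R0.
Qed.

Lemma integer_flow_weaken K K' N : K <= K' -> integer_flow K N -> integer_flow K' N.
Proof.
  intros K_le_K' (supp_N & int_N & bounded). repeat split; auto.
  intros l nodup_l. eapply Rle_trans; [apply bounded|]; auto.
Qed.

Lemma integer_flow_plus K K' N N' :
  integer_flow K N -> integer_flow K' N' -> integer_flow (K + K') (fun i p => N i p + N' i p).
Proof.
  intros ((l & supp_N) & int_N & bounded) ((l' & supp_N') & int_N' & bounded'). repeat split.
  - exists (l ++ l'). intros i p neq_0. apply in_app_iff.
    destruct (Req_dec (N i p) 0); [right; apply (supp_N' i); lra|left; now apply (supp_N i)].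
  - intros i p. destruct (int_N i p) as (k & ->), (int_N' i p) as (k' & ->).
    exists (k + k')%Z. now rewrite plus_IZR.
  - intros k nodup_k. specialize (bounded k nodup_k). specialize (bounded' k nodup_k).
    apply Rle_trans with (lsum (cell_sum (fun i p => field_abs N i p + field_abs N' i p)) k).
    + apply lsum_cell_sum_le. intros i p _. apply Rabs_triang.
    + rewrite lsum_cell_sum_plus. lra.
Qed.

Lemma integer_flow_scal K N z : integer_flow K N -> integer_flow (Rabs (IZR z) * K) (fun i p => IZR z * N i p).
Proof.
  intros ((l & supp_N) & int_N & bounded). repeat split.
  - exists l. apply (field_supported_sub N); auto. intros i p ->. ring.
  - intros i p. destruct (int_N i p) as (k & ->). exists (z * k)%Z. now rewrite mult_IZR.
  - intros k nodup_k. rewrite (lsum_cell_sum_ext _ (fun i p => Rabs (IZR z) * field_abs N i p))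
      by (intros; apply Rabs_mult).
    rewrite lsum_cell_sum_scal. apply Rmult_le_compat_l; auto using Rabs_pos.
Qed.

Definition unit_field (i : dir) (p : site) : field :=
  fun j q => if classic_eq_dec (i, p) (j, q) then 1 else 0.

Lemma curl_unit_field i p f :
  curl (unit_field i p) f = indicator (left_face i p) f - indicator (right_face i p) f.
Proof.
  destruct f as [q s], p as [a b], q as [c d]. unfold curl, unit_field, indicator, shift.
  destruct i, s; cbn [snd fst left_face right_face up_face down_face];
    repeat destruct classic_eq_dec; try ring; exfalso;
    unfold up_face, down_face, shift in *; cbn [fst snd] in *;
    repeat match goal with
    | eq : (_, _) = (_, _) |- _ => discriminate eq
    | eq : (_, _) = (_, _) |- _ => injection eq; clear eq; intros
    | neq : _ <> _ |- _ => apply neq; repeat f_equal; lia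
    end; lia.
Qed.

Lemma integer_flow_unit_field i p : integer_flow 1 (unit_field i p).
Proof.
  assert (supp : field_supported (unit_field i p) [p]).
  { intros j q. unfold unit_field. destruct classic_eq_dec as [[= _ <-]|]; [now left|lra]. }
  repeat split; [now exists [p]| |].
  - intros j q. unfold unit_field. destruct classic_eq_dec; [now exists 1%Z|now exists 0%Z].
  - intros l nodup_l. apply Rle_trans with (lsum (cell_sum (field_abs (unit_field i p))) [p]).
    + apply lsum_le_of_support; [auto|repeat constructor; tauto|..].
      * intros. apply cell_sum_nonneg. intros. apply Rabs_pos.
      * intros q. apply cell_sum_support, (field_supported_sub (unit_field i p)); auto.
        unfold field_abs. intros j r ->. apply Rabs_R0.
    + simpl. unfold cell_sum, field_abs, unit_field.
      destruct i; repeat destruct classic_eq_dec; try congruence; rewrite ?Rabs_R0, ?Rabs_R1; lra.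
Qed.

Definition flow_connected (K : R) (f g : face) : Prop :=
  exists N, integer_flow K N /\ forall h, curl N h = indicator f h - indicator g h.

Lemma flow_connected_refl K f : 0 <= K -> flow_connected K f f.
Proof.
  intros K_nonneg. exists (fun _ _ => 0). split; [now apply integer_flow_0|].
  intros h. rewrite curl_0. ring.
Qed.

Lemma flow_connected_sym K f g : flow_connected K f g -> flow_connected K g f.
Proof.
  intros (N & flow_N & curl_N). exists (fun i p => IZR (-1) * N i p). split.
  - replace K with (Rabs (IZR (-1)) * K) by (rewrite Rabs_left; lra). now apply integer_flow_scal.
  - intros h. rewrite curl_scal, curl_N. ring.
Qed.

Lemma flow_connected_trans K K' f g h :
  flow_connected K f g -> flow_connected K' g h -> flow_connected (K + K') f h.
Proof.
  intros (N & flow_N & curl_N) (N' & flow_N' & curl_N'). exists (fun i p => N i p + N' i p). split.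
  - now apply integer_flow_plus.
  - intros x. rewrite curl_plus, curl_N, curl_N'. ring.
Qed.

Lemma flow_connected_weaken K K' f g : K <= K' -> flow_connected K f g -> flow_connected K' f g.
Proof. intros K_le_K' (N & flow_N & curl_N). exists N. split; auto. now apply (integer_flow_weaken K). Qed.

Lemma flow_connected_across i p : flow_connected 1 (left_face i p) (right_face i p).
Proof. exists (unit_field i p). split; [apply integer_flow_unit_field|apply curl_unit_field]. Qed.

Lemma flow_connected_East p : flow_connected 2 (up_face p) (up_face (shift 1 0 p)).
Proof.
  replace 2 with (1 + 1) by ring. apply flow_connected_trans with (down_face p).
  - apply (flow_connected_across NorthWest p).
  - pose proof (flow_connected_across NorthEast (shift 1 0 p)) as across.
    cbn [left_face right_face] in across. now rewrite shift_shift, shift_0 in across.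
Qed.

Lemma flow_connected_NorthEast p : flow_connected 2 (up_face p) (up_face (shift 0 1 p)).
Proof.
  replace 2 with (1 + 1) by ring. apply flow_connected_trans with (down_face p).
  - apply (flow_connected_across NorthWest p).
  - pose proof (flow_connected_across East (shift 0 1 p)) as across. apply flow_connected_sym in across.
    cbn [left_face right_face] in across. now rewrite shift_shift, shift_0 in across.
Qed.

Section StraightPaths.

Variables a b : Z.
Hypothesis flow_step : forall p, flow_connected 2 (up_face p) (up_face (shift a b p)).

Lemma flow_connected_steps (n : nat) p :
  flow_connected (2 * INR n) (up_face p) (up_face (shift (Z.of_nat n * a) (Z.of_nat n * b) p)).
Proof.
  induction n as [|n IH].
  - simpl. rewrite shift_0. apply flow_connected_refl. lra.
  - rewrite S_INR. replace (2 * (INR n + 1)) with (2 * INR n + 2) by ring.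
    eapply flow_connected_trans; [apply IH|].
    replace (Z.of_nat (S n) * a)%Z with (Z.of_nat n * a + a)%Z by lia.
    replace (Z.of_nat (S n) * b)%Z with (Z.of_nat n * b + b)%Z by lia.
    rewrite <- shift_shift. apply flow_step.
Qed.

Lemma flow_connected_line (m : Z) p :
  flow_connected (2 * IZR (Z.abs m)) (up_face p) (up_face (shift (m * a) (m * b) p)).
Proof.
  rewrite <- (Z2Nat.id (Z.abs m)), <- INR_IZR_INZ by lia. destruct (Z_le_dec 0 m) as [m_nonneg|m_neg].
  - replace m with (Z.of_nat (Z.to_nat (Z.abs m))) at 2 3 by lia. apply flow_connected_steps.
  - apply flow_connected_sym. set (n := Z.to_nat (Z.abs m)).
    rewrite <- (shift_shift_opp (Z.of_nat n * a) (Z.of_nat n * b) p) at 2.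
    replace (- (Z.of_nat n * a))%Z with (m * a)%Z by lia.
    replace (- (Z.of_nat n * b))%Z with (m * b)%Z by lia. apply flow_connected_steps.
Qed.

End StraightPaths.

Definition cells_within (k : nat) (g f : face) : Prop :=
  (Z.abs (fst (fst f) - fst (fst g)) <= Z.of_nat k /\ Z.abs (snd (fst f) - snd (fst g)) <= Z.of_nat k)%Z.

Lemma flow_connected_within k f g : cells_within k g f -> flow_connected (4 * INR k + 2) f g.
Proof.
  destruct f as [p s], g as [q t]. unfold cells_within. cbn [fst snd].
  set (m := (fst p - fst q)%Z). set (n := (snd p - snd q)%Z). intros (m_le & n_le).
  apply IZR_le in m_le, n_le. rewrite <- INR_IZR_INZ in m_le, n_le.
  assert (to_up : forall x c, flow_connected 1 (x, c) (up_face x)).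
  { intros x []; [apply flow_connected_sym, (flow_connected_across NorthWest x)|].
    apply flow_connected_refl. lra. }
  assert (up_up : flow_connected (4 * INR k) (up_face q) (up_face p)).
  { replace p with (shift 0 n (shift m 0 q))
      by (rewrite shift_shift; unfold m, n, shift; destruct p, q; simpl; f_equal; lia).
    apply flow_connected_weaken with (2 * IZR (Z.abs m) + 2 * IZR (Z.abs n)); [lra|].
    apply flow_connected_trans with (up_face (shift m 0 q)).
    - pose proof (flow_connected_line 1 0 flow_connected_East m q) as line.
      now rewrite Z.mul_1_r, Z.mul_0_r in line.
    - pose proof (flow_connected_line 0 1 flow_connected_NorthEast n (shift m 0 q)) as line.
      now rewrite Z.mul_1_r, Z.mul_0_r in line. }
  replace (4 * INR k + 2) with (1 + (4 * INR k + 1)) by ring.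
  apply flow_connected_trans with (up_face p); auto.
  apply flow_connected_trans with (up_face q); auto using flow_connected_sym.
Qed.

Lemma integer_flow_combination (g : face) (L : list face) (z : face -> Z) K Z0 :
  (forall f, In f L -> flow_connected K f g) -> (forall f, In f L -> Rabs (IZR (z f)) <= Z0) -> 0 <= K ->
  exists N, integer_flow (INR (length L) * (Z0 * K)) N /\
    forall h, curl N h = lsum (fun f => IZR (z f) * (indicator f h - indicator g h)) L.
Proof.
  intros connected z_le K_nonneg. induction L as [|f L IH].
  - exists (fun _ _ => 0). split; [apply integer_flow_0; simpl; lra|]. intros h. apply curl_0.
  - destruct IH as (N & flow_N & curl_N); [intros; apply connected; now right|intros; apply z_le; now right|].
    destruct (connected f (or_introl eq_refl)) as (N' & flow_N' & curl_N').
    exists (fun i p => IZR (z f) * N' i p + N i p). split.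
    + cbn [length]. rewrite S_INR, Rmult_plus_distr_r, Rmult_1_l, Rplus_comm.
      apply integer_flow_plus; auto. apply integer_flow_weaken with (Rabs (IZR (z f)) * K).
      * apply Rmult_le_compat_r; auto. apply z_le. now left.
      * now apply integer_flow_scal.
    + intros h. rewrite curl_plus, curl_scal, curl_N, curl_N'. reflexivity.
Qed.

Lemma l2_bounded_of_l1_bounded b K : l1_bounded b K -> l2_bounded b (K * K).
Proof.
  intros bounded.
  assert (b_le : forall i p, Rabs (b i p) <= K).
  { intros i p. specialize (bounded [p] ltac:(repeat constructor; tauto)). simpl in bounded.
    eapply Rle_trans; [apply (le_cell_sum (field_abs b) p i)|lra]. intros; apply Rabs_pos. }
  assert (K_nonneg : 0 <= K) by (eapply Rle_trans; [apply Rabs_pos|apply (b_le East xi0)]).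
  intros l nodup_l. apply Rle_trans with (lsum (cell_sum (fun i p => K * field_abs b i p)) l).
  - apply lsum_cell_sum_le. intros i p _. unfold field_sqr, field_abs. rewrite <- pow2_abs.
    specialize (b_le i p). pose proof (Rabs_pos (b i p)). nra.
  - rewrite lsum_cell_sum_scal. apply Rmult_le_compat_l; auto.
Qed.

Lemma l2_bounded_minus_flow b N C K :
  l2_bounded b C -> l1_bounded N K -> l2_bounded (fun i p => b i p - N i p) (2 * C + 2 * (K * K)).
Proof. intros. apply l2_bounded_minus; auto using l2_bounded_of_l1_bounded. Qed.

Definition charges_in (b : field) (L : list face) : Prop := forall f, curl b f <> 0 -> In f L.

Lemma neutral_cluster_exists C : exists K : nat, forall (b : field) (L : list face) (g : face),
  int_valued (curl b) -> l2_bounded b C -> NoDup L -> charges_in b L ->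
  exists k, (k <= K)%nat /\ lsum (curl b) (select (cells_within k g) L) = 0.
Proof.
  destruct (neutral_box_exists C) as (K & neutral). exists K. intros b L g int_curl bounded nodup_L in_L.
  set (T := shift (fst (fst g)) (snd (fst g))).
  assert (curl_T : forall f, curl (fun i p => b i (T p)) f = curl b (T (fst f), snd f)).
  { intros [p s]. unfold curl, T; simpl. rewrite !shift_shift, !(Z.add_comm 1), !(Z.add_comm 0). reflexivity. }
  destruct (neutral (fun i p => b i (T p))) as (k & k_le & neutral_k).
  - intros f. rewrite curl_T. apply int_curl.
  - intros l nodup_l. rewrite <- (lsum_map T (cell_sum (field_sqr b))).
    apply bounded, (NoDup_map_retract T (shift (- fst (fst g)) (- snd (fst g)))); auto.
    intros p. apply shift_opp_shift.
  - exists k. split; auto. rewrite <- neutral_k, lsum_face_cell_sum, (lsum_ext _ _ _ (fun f _ => curl_T f)).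
    rewrite <- (lsum_map (fun f : face => (T (fst f), snd f)) (curl b)).
    assert (in_cluster : forall f,
      cells_within k g f <-> In f (map (fun f : face => (T (fst f), snd f)) (faces_over (box k)))).
    { intros [p s]. unfold cells_within. rewrite in_map_iff. cbn [fst snd]. split.
      - intros near. exists (shift (- fst (fst g)) (- snd (fst g)) p, s). cbn [fst snd]. unfold T.
        rewrite shift_shift_opp.
        split; auto. rewrite in_faces_over, in_box. simpl. lia.
      - intros ([q r] & [= <- <-] & q_in). rewrite in_faces_over, in_box in q_in. unfold T. simpl in *. lia. }
    apply lsum_incl_eq.
    + now apply NoDup_select.
    + apply (NoDup_map_retract _ (fun f : face => (shift (- fst (fst g)) (- snd (fst g)) (fst f), snd f))).
      * intros [p s]. unfold T. cbn [fst snd]. now rewrite shift_opp_shift.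
      * apply NoDup_faces_over, NoDup_box.
    + intros f f_in. apply in_select in f_in. now apply in_cluster.
    + intros f f_in f_out. apply NNPP. intros neq_0. apply f_out, in_select.
      split; [now apply in_L|now apply in_cluster].
Qed.

Lemma neutral_cluster_flow b g L K Z0 : NoDup L -> (forall f, In f L -> flow_connected K f g) -> 0 <= K ->
  int_valued (curl b) -> (forall f, Rabs (curl b f) <= Z0) -> lsum (curl b) L = 0 ->
  exists N, integer_flow (INR (length L) * (Z0 * K)) N /\
    forall f, curl N f = if excluded_middle_informative (In f L) then curl b f else 0.
Proof.
  intros nodup_L connected K_nonneg int_curl curl_le neutral.
  destruct (choice _ int_curl) as (z & curl_eq).
  destruct (integer_flow_combination g L z K Z0) as (N & flow_N & curl_N); auto.
  { intros f _. rewrite <- curl_eq. apply curl_le. }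
  exists N. split; auto. intros f. rewrite curl_N, <- lsum_mul_indicator by auto.
  rewrite (lsum_ext _ (fun h => curl b h * indicator h f - indicator g f * curl b h)).
  - rewrite lsum_minus, lsum_scal, neutral. ring.
  - intros h _. rewrite curl_eq. ring.
Qed.

Lemma discharge_cluster (m : nat) C : exists K, forall (b : field) (L : list face) (g : face),
  (length L <= m)%nat -> NoDup L -> charges_in b L -> int_valued (curl b) -> l2_bounded b C -> In g L ->
  exists N, integer_flow K N /\ curl N g = curl b g /\ forall f, curl N f = 0 \/ curl N f = curl b f.
Proof.
  destruct (neutral_cluster_exists C) as (K0 & neutral).
  set (K := 4 * INR K0 + 2). set (Z0 := 3 * (1 + Rabs C)).
  assert (K_nonneg : 0 <= K) by (unfold K; pose proof (pos_INR K0); lra).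
  assert (Z0_nonneg : 0 <= Z0) by (unfold Z0; pose proof (Rabs_pos C); lra).
  exists (INR m * (Z0 * K)). intros b L g length_L nodup_L in_L int_curl bounded g_in.
  destruct (neutral b L g) as (k & k_le & neutral_k); auto. apply le_INR in k_le.
  set (cluster := select (cells_within k g) L) in *.
  destruct (neutral_cluster_flow b g cluster K Z0) as (N & flow_N & curl_N); auto.
  - now apply NoDup_select.
  - intros f f_in. apply in_select in f_in. apply flow_connected_weaken with (4 * INR k + 2); [unfold K; lra|].
    now apply flow_connected_within.
  - intros f. apply Rabs_curl_le. intros i c d _ _.
    eapply Rle_trans; [apply (l2_bounded_Rabs_le b C); auto|]. pose proof (Rle_abs C). lra.
  - exists N. split; [|split].
    + apply (integer_flow_weaken (INR (length cluster) * (Z0 * K))); auto.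
      apply Rmult_le_compat_r; [nra|]. apply le_INR.
      pose proof (length_select_split (cells_within k g) L). fold cluster in H. lia.
    + rewrite curl_N. destruct excluded_middle_informative as [|g_out]; auto.
      exfalso. apply g_out, in_select. split; auto. unfold cells_within. lia.
    + intros f. rewrite curl_N. destruct excluded_middle_informative; auto.
Qed.

Lemma integer_correction (m : nat) : forall C, exists K, forall (b : field) (L : list face),
  (length L <= m)%nat -> NoDup L -> charges_in b L -> int_valued (curl b) -> l2_bounded b C ->
  exists N, integer_flow K N /\ forall f, curl N f = curl b f.
Proof.
  assert (no_charge : forall K b, 0 <= K -> charges_in b nil ->
    exists N, integer_flow K N /\ forall f, curl N f = curl b f).
  { intros K b K_nonneg in_nil. exists (fun _ _ => 0). split; [now apply integer_flow_0|].
    intros f. rewrite curl_0. symmetry. apply NNPP. intros neq_0. now apply in_nil in neq_0. }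
  induction m as [|m IH]; intros C.
  - exists 0. intros b [|f L] length_L _ in_L _ _; [|simpl in length_L; lia]. apply no_charge; auto. lra.
  - destruct (discharge_cluster (S m) C) as (K1 & discharge).
    destruct (IH (2 * C + 2 * (K1 * K1))) as (K2 & correction).
    exists (Rabs (K1 + K2)). intros b [|g L] length_L nodup_L in_L int_curl bounded.
    { apply no_charge; auto using Rabs_pos. }
    destruct (discharge b (g :: L) g) as (N1 & flow_N1 & curl_g & curl_N1); auto; [now left|].
    inversion_clear nodup_L as [|? ? g_notin nodup_L'].
    destruct (correction (fun i p => b i p - N1 i p) L) as (N2 & flow_N2 & curl_N2); auto.
    + simpl in length_L. lia.
    + intros f. rewrite curl_minus. intros neq_0. destruct (curl_N1 f) as [curl_0|curl_same]; [|lra].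
      destruct (in_L f) as [<-|f_in]; auto; lra.
    + intros f. rewrite curl_minus. destruct (curl_N1 f) as [-> | ->].
      * destruct (int_curl f) as (k & ->). exists k. ring.
      * exists 0%Z. ring.
    + apply l2_bounded_minus_flow; auto. apply flow_N1.
    + exists (fun i p => N1 i p + N2 i p). split.
      * apply (integer_flow_weaken (K1 + K2)); [apply Rle_abs|]. now apply integer_flow_plus.
      * intros f. rewrite curl_plus, curl_N2, curl_minus. ring.
Qed.

(** * Distances between triangles *)

(* Coordinates of the centre of a triangle in the basis (a1, a2), multiplied by 3 to be integers. *)
Definition face_x (f : face) : Z := (3 * fst (fst f) + if snd f then 3 else 2)%Z.
Definition face_y (f : face) : Z := (3 * snd (fst f) + if snd f then 3 else 2)%Z.

(* |x a1 + y a2|^2 *)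
Definition hexnorm (x y : R) : R := x * x + x * y + y * y.
Definition hexnormZ (x y : Z) : Z := (x * x + x * y + y * y)%Z.

(* Nine times the squared distance of the centres. *)
Definition face_sqdist (f g : face) : Z := hexnormZ (face_x f - face_x g) (face_y f - face_y g).
Definition face_dist (f g : face) : R := sqrt (IZR (face_sqdist f g)) / 3.

Lemma hexnorm_nonneg x y : 0 <= hexnorm x y.
Proof. unfold hexnorm. nra. Qed.

Lemma hexnormZ_nonneg x y : (0 <= hexnormZ x y)%Z.
Proof. unfold hexnormZ. nia. Qed.

Lemma IZR_hexnormZ x y : IZR (hexnormZ x y) = hexnorm (IZR x) (IZR y).
Proof. unfold hexnormZ, hexnorm. now rewrite !plus_IZR, !mult_IZR. Qed.

Lemma hexnorm_pos_or_0 x y : 0 < hexnorm x y \/ x = 0 /\ y = 0.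
Proof.
  destruct (Rle_lt_dec (hexnorm x y) 0) as [norm_le|]; [right|auto]. unfold hexnorm in norm_le.
  split; apply Rsqr_0_uniq; unfold Rsqr; nra.
Qed.

Lemma Rabs_le_sqrt_hexnorm s x y :
  3 * s ^ 2 <= 4 * hexnorm x y -> Rabs s <= 1.2 * sqrt (hexnorm x y).
Proof.
  intros sqr_le. pose proof (sqrt_pos (hexnorm x y)). pose proof (sqrt_sqrt _ (hexnorm_nonneg x y)) as sqrt_sqr.
  rewrite <- pow2_abs in sqr_le. nra.
Qed.

Lemma Rabs_coord_le x y : Rabs x <= 1.2 * sqrt (hexnorm x y) /\ Rabs y <= 1.2 * sqrt (hexnorm x y).
Proof.
  split; apply Rabs_le_sqrt_hexnorm; unfold hexnorm.
  - pose proof (pow2_ge_0 (x + 2 * y)). nra.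
  - pose proof (pow2_ge_0 (2 * x + y)). nra.
Qed.

Lemma sqrt_hexnorm_triangle x y x' y' :
  sqrt (hexnorm (x + x') (y + y')) <= sqrt (hexnorm x y) + sqrt (hexnorm x' y').
Proof.
  pose proof (sqrt_pos (hexnorm x y)). pose proof (sqrt_pos (hexnorm x' y')).
  rewrite <- (sqrt_Rsqr (sqrt (hexnorm x y) + sqrt (hexnorm x' y'))) by lra.
  apply sqrt_le_1_alt. unfold Rsqr.
  pose proof (sqrt_sqrt _ (hexnorm_nonneg x y)) as sqr_a. pose proof (sqrt_sqrt _ (hexnorm_nonneg x' y')) as sqr_b.
  set (a := sqrt (hexnorm x y)) in *. set (b := sqrt (hexnorm x' y')) in *.
  set (inner := 2 * x * x' + x * y' + x' * y + 2 * y * y').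
  assert (cauchy_schwarz : inner <= 2 * (a * b)).
  { apply Rsqr_incr_0_var; [|nra]. unfold Rsqr.
    replace (2 * (a * b) * (2 * (a * b))) with (4 * (a * a) * (b * b)) by ring. rewrite sqr_a, sqr_b.
    pose proof (pow2_ge_0 (x * y' - x' * y)).
    replace (4 * hexnorm x y * hexnorm x' y') with (inner * inner + 3 * (x * y' - x' * y) ^ 2)
      by (unfold hexnorm, inner; ring). lra. }
  replace ((a + b) * (a + b)) with (a * a + b * b + 2 * (a * b)) by ring. rewrite sqr_a, sqr_b.
  replace (hexnorm (x + x') (y + y')) with (hexnorm x y + hexnorm x' y' + inner) by (unfold hexnorm, inner; ring).
  lra.
Qed.

Lemma face_sqdist_sym f g : face_sqdist f g = face_sqdist g f.
Proof. unfold face_sqdist, hexnormZ. ring. Qed.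

Lemma face_sqdist_refl f : face_sqdist f f = 0%Z.
Proof. unfold face_sqdist. now rewrite !Z.sub_diag. Qed.

Lemma face_dist_refl f : face_dist f f = 0.
Proof. unfold face_dist. rewrite face_sqdist_refl, sqrt_0. lra. Qed.

Lemma face_dist_triangle f g h : face_dist f h <= face_dist f g + face_dist g h.
Proof.
  unfold face_dist, face_sqdist. rewrite !IZR_hexnormZ.
  replace (face_x f - face_x h)%Z with ((face_x f - face_x g) + (face_x g - face_x h))%Z by ring.
  replace (face_y f - face_y h)%Z with ((face_y f - face_y g) + (face_y g - face_y h))%Z by ring.
  rewrite !(plus_IZR (_ - _)).
  pose proof (sqrt_hexnorm_triangle (IZR (face_x f - face_x g)) (IZR (face_y f - face_y g))
    (IZR (face_x g - face_x h)) (IZR (face_y g - face_y h))). lra.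
Qed.

Lemma face_sqdist_across i p : face_sqdist (left_face i p) (right_face i p) = 3%Z.
Proof.
  destruct p as [a b]. unfold face_sqdist, hexnormZ, face_x, face_y.
  destruct i; unfold left_face, right_face, up_face, down_face, shift; simpl fst; simpl snd; cbv iota; ring.
Qed.

Definition link_length (K : Z) : R := sqrt (IZR K) / 3.

Lemma link_length_nonneg K : 0 <= link_length K.
Proof. unfold link_length. pose proof (sqrt_pos (IZR K)). lra. Qed.

Lemma link_length_mono K K' : (K <= K')%Z -> link_length K <= link_length K'.
Proof.
  intros K_le_K'. unfold link_length. apply Rmult_le_compat_r; [lra|]. now apply sqrt_le_1_alt, IZR_le.
Qed.

Lemma link_length_9 : link_length 9 = 1.
Proof. unfold link_length. replace (IZR 9) with (3 * 3) by lra. rewrite sqrt_square; lra. Qed.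

(** * Logarithmic constants *)

(* Energy per unit logarithm of the radius of a field of unit circulation. *)
Definition log_rate : R := sqrt 3 / (2 * PI).

Lemma sqrt3_bounds : 1.73 < sqrt 3 < 1.7321.
Proof.
  split.
  - rewrite <- (sqrt_square 1.73) by lra. apply sqrt_lt_1; lra.
  - rewrite <- (sqrt_square 1.7321) by lra. apply sqrt_lt_1; lra.
Qed.

Lemma PI_gt_3 : 3 < PI.
Proof. pose proof PI2_3_2. lra. Qed.

Lemma log_rate_bounds : 0 < log_rate < 0.28869.
Proof.
  unfold log_rate. pose proof sqrt3_bounds. pose proof PI_gt_3. split.
  - apply Rdiv_lt_0_compat; lra.
  - apply Rlt_div_l; lra.
Qed.

Lemma exp_1_gt : 2.7 < exp 1.
Proof.
  pose proof (exp_ge_taylor 1 4 ltac:(lra)) as taylor. simpl in taylor. lra.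
Qed.

Lemma ln_le_div_exp_1 x : 0 < x -> ln x <= x / exp 1.
Proof.
  intros x_pos. pose proof (exp_pos 1) as e_pos.
  assert (quot_pos : 0 < x / exp 1) by (apply Rdiv_lt_0_compat; auto).
  pose proof (ln_succ_le (x / exp 1 - 1)) as ln_quot_le.
  replace (1 + (x / exp 1 - 1)) with (x / exp 1) in ln_quot_le by ring.
  rewrite ln_div, ln_exp in ln_quot_le by auto. lra.
Qed.

Lemma log_rate_ln_le x : 0 < x -> log_rate * ln x <= 0.10813 * x.
Proof.
  intros x_pos. pose proof log_rate_bounds. pose proof exp_1_gt.
  assert (ln_le : ln x <= x / 2.7).
  { eapply Rle_trans; [now apply ln_le_div_exp_1|]. unfold Rdiv.
    apply Rmult_le_compat_l; [lra|]. apply Rinv_le_contravar; lra. }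
  apply Rle_trans with (log_rate * (x / 2.7)); [apply Rmult_le_compat_l; lra|].
  apply Rle_trans with (0.28869 * (x / 2.7)); [apply Rmult_le_compat_r; lra|]. lra.
Qed.

(** * Single-linkage clusters *)

Definition link_closed (K : Z) (B P : list face) : Prop :=
  forall f g, In f B -> In g P -> (face_sqdist f g <= K)%Z -> In g B.

Definition linked (K : Z) (B : list face) : Prop :=
  forall S, incl S B -> S <> nil -> link_closed K S B -> incl B S.

Lemma length_pos_of_in {A} (a : A) l : In a l -> (0 < length l)%nat.
Proof. destruct l; simpl; [tauto|lia]. Qed.

Lemma link_closed_trans K B B' P :
  incl B B' -> link_closed K B B' -> link_closed K B' P -> link_closed K B P.
Proof. intros B_in_B' closed closed' f g f_in g_in near. eauto. Qed.

Lemma link_closed_complement K S B : link_closed K S B ->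
  link_closed K (select (fun f => ~ In f S) B) B.
Proof.
  intros closed f g f_in g_in near. apply in_select in f_in. apply in_select. split; auto.
  intros g_in_S. apply (proj2 f_in), (closed g f); [auto|tauto|]. now rewrite face_sqdist_sym.
Qed.

Lemma charged_half_exists (q : face -> R) K B : int_valued q -> NoDup B -> 1 <= lsum q B -> ~ linked K B ->
  exists B', NoDup B' /\ incl B' B /\ (length B' < length B)%nat /\ link_closed K B' B /\ 1 <= lsum q B'.
Proof.
  intros int_q nodup_B charged not_linked.
  assert (exists S, incl S B /\ S <> nil /\ link_closed K S B /\ ~ incl B S)
    as (S & S_in_B & S_nonempty & closed & B_larger).
  { apply NNPP. intros none. apply not_linked. intros S S_in_B S_nonempty closed. apply NNPP.
    intros B_larger. eauto 6. }
  set (S1 := select (fun f => In f S) B). set (S2 := select (fun f => ~ In f S) B).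
  assert (lengths : length B = (length S1 + length S2)%nat) by apply length_select_split.
  assert (charges : lsum q B = lsum q S1 + lsum q S2) by apply lsum_select_split.
  assert (S1_nonempty : (0 < length S1)%nat).
  { destruct S as [|s S]; [congruence|]. apply (length_pos_of_in s), in_select.
    split; [apply S_in_B|]; now left. }
  assert (S2_nonempty : (0 < length S2)%nat).
  { assert (exists f, In f B /\ ~ In f S) as (f & f_in).
    { apply NNPP. intros none. apply B_larger. intros f f_in. apply NNPP. eauto. }
    now apply (length_pos_of_in f), in_select. }
  assert (select_incl : forall P, incl (select P B) B) by (intros P f f_in; apply in_select in f_in; tauto).
  destruct (lsum_int_valued q S1 int_q) as (n1 & charge1), (lsum_int_valued q S2 int_q) as (n2 & charge2).
  rewrite charges, charge1, charge2, <- plus_IZR in charged. apply le_IZR in charged.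
  destruct (Z_le_dec 1 n1).
  - exists S1. do 2 (split; [now apply NoDup_select || apply select_incl|]). split; [lia|].
    split; [|rewrite charge1; now apply IZR_le].
    intros f g f_in g_in near. apply in_select in f_in. apply in_select. split; auto. apply (closed f); tauto.
  - exists S2. do 2 (split; [now apply NoDup_select || apply select_incl|]). split; [lia|].
    split; [|rewrite charge2; apply IZR_le; lia].
    now apply link_closed_complement.
Qed.

Lemma charged_component_exists (q : face -> R) K n : int_valued q ->
  forall B, (length B <= n)%nat -> NoDup B -> 1 <= lsum q B ->
  exists B', NoDup B' /\ incl B' B /\ linked K B' /\ link_closed K B' B /\ 1 <= lsum q B'.
Proof.
  intros int_q. induction n as [|n IH]; intros B length_B nodup_B charged.
  - destruct B; [simpl in charged; lra|simpl in length_B; lia].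
  - destruct (classic (linked K B)) as [is_linked|not_linked].
    { exists B. repeat split; auto; [apply incl_refl|]. intros f g _ g_in _; auto. }
    destruct (charged_half_exists q K B) as (S & nodup_S & S_in_B & shorter & closed_S & charged_S); auto.
    destruct (IH S) as (B' & nodup_B' & B'_in_S & linked_B' & closed_B' & charged_B'); auto; [lia|].
    exists B'. repeat split; auto; [now apply incl_tran with S|]. now apply (link_closed_trans K B' S).
Qed.

(* Starting from the disc of radius x around z, each further link adds at least one face. *)
Lemma linked_radius K B z n : NoDup B -> linked K B -> In z B -> forall x, 0 <= x ->
  (length (select (fun f => (x < face_dist f z)%R) B) <= n)%nat ->
  forall f, In f B -> face_dist f z <= x + INR n * link_length K.
Proof.
  intros nodup_B is_linked z_in. pose proof (link_length_nonneg K) as link_nonneg.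
  induction n as [|n IH]; intros x x_nonneg few_beyond f f_in.
  - simpl. rewrite Rmult_0_l, Rplus_0_r. apply Rnot_lt_le. intros beyond.
    assert (f_beyond : In f (select (fun f => x < face_dist f z) B)) by now apply in_select.
    apply length_pos_of_in in f_beyond. lia.
  - set (disc := select (fun f => face_dist f z <= x) B).
    assert (disc_nonempty : disc <> nil).
    { assert (In z disc) by (apply in_select; rewrite face_dist_refl; auto). intros E. rewrite E in *. tauto. }
    destruct (classic (link_closed K disc B)) as [closed|not_closed].
    { assert (f_in_disc : In f disc).
      { apply (is_linked disc); auto. intros g g_in. apply in_select in g_in. tauto. }
      apply in_select in f_in_disc. pose proof (pos_INR (S n)). nra. }
    assert (exists g h, In g disc /\ In h B /\ (face_sqdist g h <= K)%Z /\ ~ In h disc)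
      as (g & h & g_in & h_in & near & h_out).
    { apply NNPP. intros none. apply not_closed. intros g h g_in h_in near. apply NNPP. intros h_out. eauto 8. }
    apply in_select in g_in.
    assert (h_beyond : x < face_dist h z) by (apply Rnot_le_lt; intros h_le; now apply h_out, in_select).
    assert (h_within : face_dist h z <= x + link_length K).
    { pose proof (face_dist_triangle h g z).
      assert (face_dist h g <= link_length K); [|lra]. unfold face_dist, link_length.
      rewrite face_sqdist_sym. apply Rmult_le_compat_r; [lra|]. now apply sqrt_le_1_alt, IZR_le. }
    rewrite S_INR. replace (x + (INR n + 1) * link_length K) with ((x + link_length K) + INR n * link_length K) by ring.
    apply IH; auto; [lra|].
    assert (fewer : (length (h :: select (fun f => (x + link_length K < face_dist f z)%R) B)
      <= length (select (fun f => (x < face_dist f z)%R) B))%nat); [|simpl in fewer; lia].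
    apply NoDup_incl_length.
    + constructor; [|now apply NoDup_select]. intros h_in'. apply in_select in h_in'. lra.
    + apply incl_cons; [now apply in_select|]. intros e e_in. apply in_select in e_in. apply in_select.
      split; [tauto|lra].
Qed.

(** * Choice of the centre of the dislocation *)

Definition log_growth (m : R -> R) : Prop :=
  (forall r, r <= 1 -> m r = 0) /\
  (forall r r', 1 <= r -> r <= r' -> 0 <= m r' - m r <= ln r' - ln r).

Record log_profile (m : R -> R) (Lam R0 : R) : Prop := {
  profile_radius : 1 <= R0;
  profile_growth : log_growth m;
  profile_far : forall r, R0 <= r -> m r = ln r - Lam
}.

(* m r is the logarithmic measure of the good radii below r, those for which the disc of that radius
   around z has charge at least 1. *)
Record good_centre (q : face -> R) (B : list face) (K : Z) (z : face) (m : R -> R) (Lam R0 : R) : Prop := {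
  centre_profile : log_profile m Lam R0;
  centre_radius : forall f, In f B -> face_dist f z <= R0;
  centre_charge : forall x, 1 <= x ->
    lsum (fun f => q f * m (Rmin (face_dist f z) x)) B <= (lsum q B - 1) * m x;
  centre_flat : forall r, link_length K <= r <= R0 -> m r = m R0
}.

Definition profile_extend (m : R -> R) (l R0 r : R) : R :=
  if Rle_dec r R0 then m (Rmin r l) else m l + ln (r / R0).

Lemma log_growth_nonneg m x : log_growth m -> 0 <= m x.
Proof.
  intros (m_0 & m_mono). destruct (Rle_dec x 1) as [x_le|x_gt]; [rewrite m_0; lra|].
  specialize (m_mono 1 x (Rle_refl 1) ltac:(lra)). rewrite (m_0 1) in m_mono; lra.
Qed.

Lemma profile_extend_below m l R0 r : r <= R0 -> profile_extend m l R0 r = m (Rmin r l).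
Proof. intros r_le. unfold profile_extend. now destruct Rle_dec. Qed.

Lemma profile_extend_above m l R0 r : 0 < R0 -> l <= R0 -> R0 <= r ->
  profile_extend m l R0 r = ln r - (ln R0 - m l).
Proof.
  intros R0_pos l_le r_ge. unfold profile_extend. destruct Rle_dec.
  - replace r with R0 by lra. rewrite Rmin_right by auto. ring.
  - rewrite ln_div by lra. ring.
Qed.

Lemma log_growth_extend m l R0 : log_growth m -> 1 <= l <= R0 -> log_growth (profile_extend m l R0).
Proof.
  intros (m_0 & m_mono) l_bounds. split.
  - intros r r_le. rewrite profile_extend_below, Rmin_left by lra. now apply m_0.
  - assert (below : forall r r', 1 <= r -> r <= r' -> r' <= R0 ->
      0 <= profile_extend m l R0 r' - profile_extend m l R0 r <= ln r' - ln r).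
    { intros r r' r_ge r_le r'_le. rewrite !profile_extend_below by lra.
      assert (1 <= Rmin r l) by (apply Rmin_glb; lra).
      assert (Rmin r l <= Rmin r' l) by (apply Rle_min_compat_r; auto).
      specialize (m_mono (Rmin r l) (Rmin r' l)).
      assert (ln (Rmin r' l) - ln (Rmin r l) <= ln r' - ln r); [|lra].
      unfold Rmin; destruct (Rle_dec r' l), (Rle_dec r l); try lra.
      - pose proof (ln_le l r'). lra.
      - pose proof (ln_le r r'). lra. }
    assert (above : forall r r', R0 <= r -> r <= r' ->
      0 <= profile_extend m l R0 r' - profile_extend m l R0 r <= ln r' - ln r).
    { intros r r' r_ge r_le. rewrite !profile_extend_above by lra. pose proof (ln_le r r'). lra. }
    intros r r' r_ge r_le. destruct (Rle_dec r' R0); [apply below; lra|].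
    destruct (Rle_dec r R0); [|apply above; lra].
    pose proof (below r R0 r_ge ltac:(lra) ltac:(lra)). pose proof (above R0 r' ltac:(lra) ltac:(lra)). lra.
Qed.

Lemma log_profile_extend m l R0 : log_growth m -> 1 <= l <= R0 ->
  log_profile (profile_extend m l R0) (ln R0 - m l) R0.
Proof.
  intros growth l_bounds. constructor; [lra|now apply log_growth_extend|].
  intros r r_ge. apply profile_extend_above; lra.
Qed.

Lemma good_centre_of_linked q B z : NoDup B -> linked 8 B -> In z B -> 1 <= lsum q B ->
  exists m R0, good_centre q B 8 z m (ln (1 + INR (length B))) R0.
Proof.
  intros nodup_B is_linked z_in charged. set (R0 := 1 + INR (length B)).
  pose proof (pos_INR (length B)) as length_nonneg. assert (R0_ge : 1 <= R0) by (unfold R0; lra).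
  assert (radius : forall f, In f B -> face_dist f z <= R0).
  { intros f f_in.
    pose proof (linked_radius 8 B z (length B) nodup_B is_linked z_in 0 (Rle_refl 0) (filter_length_le _ _) f f_in).
    assert (link_length 8 <= 1) by (rewrite <- link_length_9; now apply link_length_mono).
    unfold R0. nra. }
  assert (growth_0 : log_growth (fun _ => 0)).
  { split; auto. intros r r' r_ge r_le. pose proof (ln_le r r'). lra. }
  pose proof (log_profile_extend (fun _ => 0) 1 R0 growth_0 ltac:(lra)) as profile. rewrite Rminus_0_r in profile.
  assert (below : forall r, r <= R0 -> profile_extend (fun _ => 0) 1 R0 r = 0)
    by (intros; now apply profile_extend_below).
  exists (profile_extend (fun _ => 0) 1 R0), R0. constructor; auto.
  - intros x x_ge. rewrite lsum_0.
    + apply Rmult_le_pos; [lra|]. apply log_growth_nonneg, profile.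
    + intros f f_in. rewrite below; [ring|]. eapply Rle_trans; [apply Rmin_l|auto].
  - intros r r_bounds. rewrite !below; lra.
Qed.

Lemma link_closed_far K B P f g :
  link_closed K B P -> In g B -> In f P /\ ~ In f B -> link_length (K + 1) <= face_dist f g.
Proof.
  intros closed g_in (f_in & f_out). unfold link_length, face_dist. apply Rmult_le_compat_r; [lra|].
  apply sqrt_le_1_alt, IZR_le. destruct (Z_le_gt_dec (K + 1) (face_sqdist f g)) as [|near]; auto.
  exfalso. apply f_out, (closed g); auto. rewrite face_sqdist_sym. lia.
Qed.

Lemma good_centre_extend q B B' K z m Lam R0 : (8 <= K)%Z -> NoDup B -> NoDup B' -> incl B' B ->
  linked (K + 1) B -> link_closed K B' B -> In z B' -> 1 <= lsum q B -> good_centre q B' K z m Lam R0 ->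
  exists m' R1, good_centre q B (K + 1) z m' (Lam + ln (1 + INR (length (select (fun f => ~ In f B') B)))) R1.
Proof.
  intros K_ge nodup_B nodup_B' B'_in_B is_linked closed z_in charged [[R0_ge growth far] radius charge flat].
  set (D := select (fun f => ~ In f B') B). set (d := INR (length D)). pose proof (pos_INR (length D) : 0 <= d).
  set (l := link_length (K + 1)).
  assert (l_ge : 1 <= l) by (rewrite <- link_length_9; apply link_length_mono; lia).
  assert (split_B : forall h, lsum h B = lsum h B' + lsum h D) by (intros; now apply lsum_incl_split).
  set (M := Rmax R0 l). pose proof (Rmax_l R0 l : R0 <= M). pose proof (Rmax_r R0 l : l <= M).
  set (R1 := (1 + d) * M). assert (M_le : M <= R1) by (unfold R1; nra).
  assert (D_far : forall f, In f D -> l <= face_dist f z).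
  { intros f f_in. apply in_select in f_in. now apply (link_closed_far K B' B). }
  assert (radius' : forall f, In f B -> face_dist f z <= R1).
  { intros f f_in. eapply Rle_trans.
    - apply (linked_radius (K + 1) B z (length D) nodup_B is_linked (B'_in_B z z_in) M); auto; [lra|].
      apply NoDup_incl_length; [now apply NoDup_select|]. intros g g_in. apply in_select in g_in. apply in_select.
      split; [tauto|]. intros g_in'. specialize (radius g g_in'). lra.
    - fold l d. unfold R1. assert (d * l <= d * M) by (apply Rmult_le_compat_l; lra). lra. }
  assert (loss : ln R1 - m l = Lam + ln (1 + d)).
  { unfold R1. rewrite ln_mult by lra. destruct (Rle_dec R0 l).
    - rewrite (far l) by lra. unfold M. rewrite Rmax_right by lra. ring.
    - rewrite (flat l), (far R0) by (split; [apply link_length_mono; lia|lra] || lra).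
      unfold M. rewrite Rmax_left by lra. ring. }
  pose proof (log_profile_extend m l R1 growth ltac:(lra)) as profile. rewrite loss in profile.
  exists (profile_extend m l R1), R1. constructor; auto.
  - intros x x_ge. assert (min_ge : 1 <= Rmin x l) by (apply Rmin_glb; lra).
    rewrite (lsum_ext _ (fun f => q f * m (Rmin (face_dist f z) (Rmin x l)))).
    2:{ intros f f_in. rewrite profile_extend_below by (eapply Rle_trans; [apply Rmin_l|auto]).
        now rewrite Rmin_assoc. }
    apply Rle_trans with ((lsum q B - 1) * m (Rmin x l)).
    + rewrite !split_B. specialize (charge _ min_ge).
      rewrite (lsum_ext _ (fun f => m (Rmin x l) * q f) D).
      2:{ intros f f_in. rewrite (Rmin_right (face_dist f z)); [ring|]. specialize (D_far f f_in).
          pose proof (Rmin_r x l). lra. }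
      rewrite lsum_scal. lra.
    + apply Rmult_le_compat_l; [lra|]. destruct (Rle_dec x R1).
      * rewrite profile_extend_below by auto. lra.
      * rewrite profile_extend_above, Rmin_right by lra. pose proof (ln_le R1 x). lra.
  - fold l. intros r r_bounds. rewrite !profile_extend_below, !Rmin_right by lra. reflexivity.
Qed.

Section CentreSelection.

Variables (q a : face -> R) (P : list face).
Hypothesis int_q : int_valued q.
Hypothesis a_ge_half : forall f, In f P -> / 2 <= a f.
Hypothesis a_isolated : forall f, In f P ->
  (forall g, In g P -> g <> f -> (8 < face_sqdist f g)%Z) -> a f = 1.

Lemma half_length_le_lsum L : incl L P -> INR (length L) / 2 <= lsum a L.
Proof.
  intros L_in_P. unfold Rdiv. rewrite Rmult_comm, <- lsum_const. apply lsum_le. auto.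
Qed.

(* The faces of B outside the component B' pay for the additional loss; a single one does because
   it is then isolated. *)
Lemma component_loss_le B B' K : (8 <= K)%Z -> incl B P -> link_closed (K + 1) B P -> link_closed K B' B -> incl B' B ->
  let D := select (fun f => ~ In f B') B in
  log_rate * ln (1 + INR (length D)) <= 49 / 50 * (lsum a D / 3).
Proof.
  intros K_ge B_in_P closed_B closed_B' B'_in_B D.
  assert (D_in_P : incl D P) by (intros f f_in; apply in_select in f_in; apply B_in_P; tauto).
  pose proof (half_length_le_lsum D D_in_P) as half. pose proof (pos_INR (length D)).
  pose proof (log_rate_ln_le (1 + INR (length D)) ltac:(lra)) as cost.
  destruct D as [|f [|g D']] eqn:D_eq.
  - simpl. rewrite Rplus_0_r, ln_1. lra.
  - simpl lsum. simpl INR in cost |- *.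
    assert (f_in : In f D) by (rewrite D_eq; now left). apply in_select in f_in.
    rewrite a_isolated; [lra|apply B_in_P; tauto|]. intros g g_in g_neq_f.
    apply Z.nle_gt. intros near.
    assert (g_in_B : In g B) by (apply (closed_B f); auto; [tauto|lia]).
    assert (g_in_B' : In g B').
    { apply NNPP. intros g_out. assert (g_in_D : In g D) by now apply in_select.
      rewrite D_eq in g_in_D. destruct g_in_D as [|[]]; congruence. }
    apply (proj2 f_in), (closed_B' g); [auto|tauto|]. rewrite face_sqdist_sym. lia.
  - cbn [length] in *. rewrite !S_INR in *. pose proof (pos_INR (length D')). lra.
Qed.

Lemma good_centre_exists (j : nat) : forall B, NoDup B -> incl B P ->
  link_closed (8 + Z.of_nat j) B P -> linked (8 + Z.of_nat j) B -> 1 <= lsum q B ->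
  exists z m Lam R0, In z B /\ good_centre q B (8 + Z.of_nat j) z m Lam R0 /\
    log_rate * Lam <= 1 + 49 / 50 * (lsum a B / 3).
Proof.
  induction j as [|j IH]; intros B nodup_B B_in_P closed_B linked_B charged.
  - assert (exists z, In z B) as (z & z_in) by (destruct B as [|z B]; [simpl in charged; lra|exists z; now left]).
    destruct (good_centre_of_linked q B z) as (m & R0 & centre); auto.
    exists z, m, (ln (1 + INR (length B))), R0. split; [auto|]. split; [exact centre|].
    pose proof (half_length_le_lsum B B_in_P). pose proof (pos_INR (length B)).
    pose proof (log_rate_ln_le (1 + INR (length B)) ltac:(lra)). lra.
  - set (K := (8 + Z.of_nat j)%Z) in *.
    assert (8 + Z.of_nat (S j) = K + 1)%Z as level by lia. rewrite level in *.
    destruct (charged_component_exists q K (length B) int_q B (le_n _) nodup_B charged)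
      as (B' & nodup_B' & B'_in_B & linked_B' & closed_B' & charged_B').
    destruct (IH B') as (z & m & Lam & R0 & z_in & centre & loss); auto.
    { now apply incl_tran with B. }
    { apply (link_closed_trans K B' B); auto. intros f g f_in g_in near. apply (closed_B f); auto. lia. }
    destruct (good_centre_extend q B B' K z m Lam R0) as (m' & R1 & centre'); auto; [lia|].
    exists z, m', (Lam + ln (1 + INR (length (select (fun f => ~ In f B') B)))), R1. split; [auto|]. split; [auto|].
    rewrite (lsum_incl_split a B' B) by auto.
    pose proof (component_loss_le B B' K ltac:(lia) B_in_P closed_B closed_B' B'_in_B). cbv zeta in *. lra.
Qed.

Lemma face_sqdist_bounded : exists j : nat, forall f g, In f P -> In g P -> (face_sqdist f g <= 8 + Z.of_nat j)%Z.
Proof.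
  assert (bounded : forall l : list (face * face),
    exists j : nat, forall x, In x l -> (face_sqdist (fst x) (snd x) <= 8 + Z.of_nat j)%Z).
  { induction l as [|x l (j & le_j)]; [exists 0%nat; intros x []|].
    exists (j + Z.to_nat (face_sqdist (fst x) (snd x)))%nat. intros y [<-|y_in]; [lia|].
    specialize (le_j y y_in). lia. }
  destruct (bounded (list_prod P P)) as (j & le_j). exists j. intros f g f_in g_in.
  apply (le_j (f, g)). now apply in_prod.
Qed.

Lemma low_loss_centre_exists : NoDup P -> lsum q P = 1 ->
  exists z m Lam R0, In z P /\ log_profile m Lam R0 /\
    lsum (fun f => q f * m (face_dist f z)) P <= 0 /\ log_rate * Lam <= 1 + 49 / 50 * (lsum a P / 3).
Proof.
  intros nodup_P charge_1. destruct face_sqdist_bounded as (j & all_near).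
  destruct (good_centre_exists j P) as (z & m & Lam & R0 & z_in & [profile radius charge _] & loss); auto.
  - apply incl_refl.
  - intros f g _ g_in _; auto.
  - intros S S_in_P S_nonempty closed f f_in. destruct S as [|s S]; [congruence|].
    apply (closed s); [now left|auto|]. apply all_near; auto. apply S_in_P. now left.
  - lra.
  - exists z, m, Lam, R0. do 2 (split; [auto|]). split; [|auto].
    specialize (charge R0 (profile_radius _ _ _ profile)). rewrite charge_1 in charge.
    rewrite (lsum_ext _ (fun f => q f * m (Rmin (face_dist f z) R0))); [lra|].
    intros f f_in. rewrite Rmin_left; auto.
Qed.

End CentreSelection.

(** * Reduction modulo 1 and the potential *)

(* Representative of x modulo 1 in [-1/2, 1/2]; odd in x, hence not periodic at half-integers. *)
Definition wrap (x : R) : R :=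
  if Rle_dec 0 x then x - IZR (Int_part (x + / 2)) else - (- x - IZR (Int_part (- x + / 2))).

Lemma Rabs_wrap_le x : Rabs (wrap x) <= / 2.
Proof.
  unfold wrap. destruct (base_Int_part (x + / 2)), (base_Int_part (- x + / 2)).
  apply Rabs_le. destruct Rle_dec; lra.
Qed.

Lemma wrap_mod x : exists k : Z, wrap x = x - IZR k.
Proof.
  unfold wrap. destruct Rle_dec.
  - eexists; reflexivity.
  - exists (- Int_part (- x + / 2))%Z. rewrite opp_IZR. ring.
Qed.

Lemma wrap_opp x : wrap (- x) = - wrap x.
Proof.
  unfold wrap. destruct (Rle_dec 0 x), (Rle_dec 0 (- x)); rewrite ?Ropp_involutive; try lra.
  assert (x = 0) as -> by lra. rewrite Ropp_0, Rplus_0_l.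
  replace (Int_part (/ 2)) with 0%Z; [simpl; ring|]. apply Int_part_spec. lra.
Qed.

Lemma IZR_Rabs_lt_1 k : Rabs (IZR k) < 1 -> k = 0%Z.
Proof. rewrite <- abs_IZR. intros abs_lt. apply lt_IZR in abs_lt. lia. Qed.

Lemma wrap_unique x a (k : Z) : x = a + IZR k -> Rabs a < / 2 -> wrap x = a.
Proof.
  intros -> a_small. destruct (wrap_mod (a + IZR k)) as (j & wrap_eq).
  pose proof (Rabs_wrap_le (a + IZR k)) as wrap_le.
  assert (k - j = 0)%Z.
  { apply IZR_Rabs_lt_1. rewrite minus_IZR.
    replace (IZR k - IZR j) with (wrap (a + IZR k) - a) by (rewrite wrap_eq; ring).
    eapply Rle_lt_trans; [apply Rabs_triang|]. rewrite Rabs_Ropp. lra. }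
  rewrite wrap_eq. replace k with j by lia. ring.
Qed.

Lemma not_half_integer_small x : Rabs x <= / 4 -> ~ half_integer x.
Proof.
  rewrite Rabs_le_between. intros x_small (k & ->).
  assert (-1 < k < 0)%Z; [|lia]. split; apply lt_IZR; lra.
Qed.

Lemma Rabs_bounded_of_continuous (f : R -> R) a b : a <= b -> (forall x, a <= x <= b -> continuous f x) ->
  exists M, 0 < M /\ forall x, a <= x <= b -> Rabs (f x) <= M.
Proof.
  intros a_le_b f_cont.
  assert (abs_cont : forall x, a <= x <= b -> continuity_pt (fun x => Rabs (f x)) x).
  { intros x x_in. apply continuity_pt_filterlim. apply (continuous_comp f Rabs); [auto|apply continuous_Rabs]. }
  destruct (continuity_ab_maj (fun x => Rabs (f x)) a b a_le_b abs_cont) as (x_max & maximal & _).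
  exists (Rabs (f x_max) + 1). split; [pose proof (Rabs_pos (f x_max)); lra|].
  intros x x_in. specialize (maximal x x_in). simpl in maximal. lra.
Qed.

Section Potential.

Variable psi : R -> R.
Hypothesis psi_ok : psi_hyp psi.
Local Notation mu := (Derive_n psi 2 0).

Lemma psi_continuous x : continuous psi x.
Proof. apply psi_ok. Qed.

Lemma psi_even x : psi (- x) = psi x.
Proof. apply psi_ok. Qed.

Lemma mu_pos : 0 < mu.
Proof. apply psi_ok. Qed.

Lemma psi_smooth x k : ~ half_integer x -> (k <= 4)%nat -> ex_derive_n psi k x.
Proof. intros x_ok k_le. destruct psi_ok as (_ & smooth & _). now apply smooth. Qed.

Lemma psi_add_IZR x (k : Z) : psi (x + IZR k) = psi x.
Proof.
  destruct psi_ok as (_ & _ & periodic & _). revert k. apply Z_iff_ind.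
  - now rewrite Rplus_0_r.
  - intros k. rewrite plus_IZR, <- Rplus_assoc, periodic. reflexivity.
Qed.

Lemma psi_wrap x : psi (wrap x) = psi x.
Proof. destruct (wrap_mod x) as (k & ->). rewrite <- (psi_add_IZR (x - IZR k) k). f_equal. ring. Qed.

Lemma psi_ge_quadratic x : Rabs x <= / 2 -> / 2 * mu * x ^ 2 <= psi x.
Proof.
  rewrite Rabs_le_between. intros x_small. destruct psi_ok as (_ & _ & _ & _ & _ & _ & _ & lower).
  specialize (lower x ltac:(lra)). lra.
Qed.

Lemma psi_nonneg x : 0 <= psi x.
Proof.
  rewrite <- psi_wrap. eapply Rle_trans; [|apply psi_ge_quadratic, Rabs_wrap_le].
  pose proof mu_pos. nra.
Qed.

Lemma psi_bounded : exists M, 0 < M /\ forall x, psi x <= M.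
Proof.
  destruct (Rabs_bounded_of_continuous psi (- / 2) (/ 2)) as (M & M_pos & psi_le);
    [lra|intros; apply psi_continuous|].
  exists M. split; auto. intros x. rewrite <- psi_wrap. eapply Rle_trans; [apply Rle_abs|].
  apply psi_le, Rabs_le_between, Rabs_wrap_le.
Qed.

Lemma psi_odd_derivative_0 n : Nat.odd n = true -> (n <= 4)%nat -> Derive_n psi n 0 = 0.
Proof.
  intros n_odd n_le.
  assert (reflected : Derive_n (fun x => psi (- x)) n 0 = (-1) ^ n * Derive_n psi n (- 0)).
  { apply Derive_n_comp_opp. rewrite Ropp_0. exists (mkposreal (/ 4) ltac:(lra)). intros y y_near k k_le.
    apply psi_smooth; [|lia]. apply not_half_integer_small.
    change (Rabs (y - 0) < / 4) in y_near. rewrite Rminus_0_r in y_near. lra. }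
  rewrite (Derive_n_ext (fun x => psi (- x)) psi) in reflected by apply psi_even.
  rewrite Ropp_0 in reflected. replace ((-1) ^ n) with (-1) in reflected; [lra|].
  apply Nat.odd_spec in n_odd. destruct n_odd as (k & ->).
  rewrite pow_add, pow_mult. replace ((-1) ^ 2) with 1 by ring. rewrite pow1. ring.
Qed.

Lemma psi_0 : psi 0 = 0.
Proof. apply psi_ok. now exists 0%Z. Qed.

Lemma psi_quartic_small : exists C, 0 < C /\
  forall x, 0 < x <= / 4 -> Rabs (psi x - / 2 * mu * x ^ 2) <= C * x ^ 4.
Proof.
  destruct (Rabs_bounded_of_continuous (Derive_n psi 4) (- / 4) (/ 4)) as (C & C_pos & derivative_le).
  { lra. } { intros x x_small. apply psi_ok, not_half_integer_small. now apply Rabs_le_between. }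
  exists C. split; auto. intros x x_bounds.
  destruct (Taylor_Lagrange psi 3 0 x) as (z & z_bounds & taylor); [lra| |].
  { intros t t_bounds k k_le. apply psi_smooth; auto. apply not_half_integer_small, Rabs_le. lra. }
  rewrite Rminus_0_r in taylor. cbn [sum_f_R0] in taylor.
  rewrite (psi_odd_derivative_0 1), (psi_odd_derivative_0 3) in taylor by (auto; lia).
  simpl (Derive_n psi 0 0) in taylor. rewrite psi_0 in taylor.
  replace (psi x - / 2 * mu * x ^ 2) with (x ^ 4 / 24 * Derive_n psi 4 z).
  2:{ rewrite taylor. replace (INR (fact 4)) with 24 by (simpl; lra).
      replace (INR (fact 2)) with 2 by (simpl; lra). lra. }
  assert (0 <= x ^ 4) by (apply pow_le; lra).
  rewrite Rabs_mult, (Rabs_pos_eq (x ^ 4 / 24)) by lra.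
  specialize (derivative_le z ltac:(lra)). nra.
Qed.

Lemma psi_quartic : exists C, 0 < C /\ forall x, Rabs (psi x - / 2 * mu * x ^ 2) <= C * x ^ 4.
Proof.
  destruct psi_quartic_small as (C & C_pos & small). destruct psi_bounded as (M & M_pos & psi_le).
  pose proof mu_pos as mu_pos. exists (C + 256 * M + 8 * mu). split; [lra|]. intros x.
  assert (x4_nonneg : 0 <= x ^ 4) by (replace (x ^ 4) with ((x ^ 2) ^ 2) by ring; apply pow2_ge_0).
  destruct (Rle_dec (Rabs x) (/ 4)) as [x_small|x_large].
  - apply Rle_trans with (C * x ^ 4); [|nra].
    destruct (Rtotal_order x 0) as [x_neg|[->|x_pos]].
    + rewrite <- psi_even. replace (x ^ 2) with ((- x) ^ 2) by ring. replace (x ^ 4) with ((- x) ^ 4) by ring.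
      apply small. rewrite Rabs_left in x_small by auto. lra.
    + rewrite psi_0. replace (0 - / 2 * mu * 0 ^ 2) with 0 by ring. rewrite Rabs_R0. simpl; lra.
    + apply small. rewrite Rabs_pos_eq in x_small by lra. lra.
  - assert (x2_ge : / 16 <= x ^ 2) by (rewrite <- pow2_abs; nra).
    assert (x ^ 2 <= 16 * x ^ 4) by (replace (x ^ 4) with (x ^ 2 * x ^ 2) by ring; nra).
    pose proof (psi_le x). pose proof (psi_nonneg x). apply Rabs_le. nra.
Qed.

Lemma psi_le_quadratic : exists C, 0 < C /\ forall x, Rabs x <= 1 -> psi x <= C * x ^ 2.
Proof.
  destruct psi_quartic as (C & C_pos & quartic). pose proof mu_pos as mu_pos.
  exists (mu + C). split; [lra|]. intros x x_le. specialize (quartic x). apply Rabs_le_between in quartic.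
  apply pow2_le_of_Rabs_le in x_le.
  assert (x ^ 4 <= x ^ 2) by (replace (x ^ 4) with (x ^ 2 * x ^ 2) by ring; nra). nra.
Qed.

End Potential.

(** * The reference strain *)

Definition hexvec (x y : R) : vec := (x + y / 2, sqrt 3 / 2 * y).
Definition site_x (p : site) : R := IZR (fst p) + / 3.
Definition site_y (p : site) : R := IZR (snd p) + / 3.

Lemma pos_hexvec p : pos p = hexvec (site_x p) (site_y p).
Proof.
  unfold pos, hexvec, site_x, site_y, vadd, vscal, a2, a1, R6. rewrite cos_PI3, sin_PI3. simpl. f_equal; field.
Qed.

Lemma sqrt3_sqr : sqrt 3 * sqrt 3 = 3.
Proof. apply sqrt_sqrt. lra. Qed.

Lemma vnorm_hexvec x y : vnorm (hexvec x y) = sqrt (hexnorm x y).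
Proof. unfold vnorm, hexvec, hexnorm. simpl. f_equal. pose proof sqrt3_sqr. nra. Qed.

Definition vdot (v v' : vec) : R := fst v * fst v' + snd v * snd v'.
Definition vcross (v v' : vec) : R := fst v * snd v' - snd v * fst v'.

Lemma vdot_hexvec x y x' y' : vdot (hexvec x y) (hexvec x' y') = x * x' + y * y' + (x * y' + x' * y) / 2.
Proof.
  unfold vdot, hexvec; simpl.
  replace (sqrt 3 / 2 * y * (sqrt 3 / 2 * y')) with (sqrt 3 * sqrt 3 * y * y' / 4) by field.
  rewrite sqrt3_sqr. field.
Qed.

Lemma vcross_hexvec x y x' y' : vcross (hexvec x y) (hexvec x' y') = sqrt 3 / 2 * (x * y' - x' * y).
Proof. unfold vcross, hexvec; simpl. field. Qed.

Lemma polar v : 0 < vnorm v -> fst v = vnorm v * cos (arg v) /\ snd v = vnorm v * sin (arg v).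
Proof.
  destruct v as [a b]. unfold arg. cbn [fst snd]. set (r := vnorm (a, b)). intros r_pos.
  assert (r_sqr : r * r = a ^ 2 + b ^ 2) by (apply sqrt_sqrt; simpl; nra).
  assert (cos_bounds : -1 <= a / r <= 1).
  { split; [apply Rle_div_r|apply Rle_div_l]; auto; nra. }
  assert (sin_eq : sqrt (1 - (a / r)²) = Rabs b / r).
  { rewrite <- (sqrt_Rsqr (Rabs b / r)) by (apply Rdiv_le_0_compat; [apply Rabs_pos|auto]). f_equal. unfold Rsqr.
    replace (Rabs b / r * (Rabs b / r)) with (Rabs b ^ 2 / (r * r)) by (field; lra).
    rewrite pow2_abs. replace (a / r * (a / r)) with (a ^ 2 / (r * r)) by (field; lra).
    replace (b ^ 2) with (r * r - a ^ 2) by (rewrite r_sqr; ring). field. lra. }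
  destruct Rle_dec.
  - rewrite cos_acos, sin_acos, sin_eq, Rabs_pos_eq by auto. split; field; lra.
  - rewrite cos_minus, sin_minus, cos_2PI, sin_2PI, cos_acos, sin_acos, sin_eq, Rabs_left by lra.
    split; field; lra.
Qed.

Lemma vdot_polar v v' : 0 < vnorm v -> 0 < vnorm v' ->
  vdot v v' = vnorm v * vnorm v' * cos (arg v' - arg v).
Proof.
  intros v_pos v'_pos. unfold vdot. destruct (polar v v_pos) as (-> & ->), (polar v' v'_pos) as (-> & ->).
  rewrite cos_minus. ring.
Qed.

Lemma vcross_polar v v' : 0 < vnorm v -> 0 < vnorm v' ->
  vcross v v' = vnorm v * vnorm v' * sin (arg v' - arg v).
Proof.
  intros v_pos v'_pos. unfold vcross. destruct (polar v v_pos) as (-> & ->), (polar v' v'_pos) as (-> & ->).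
  rewrite sin_minus. ring.
Qed.

Lemma angle_unique a b s t : 0 < a -> 0 < b ->
  a * cos s = b * cos t -> a * sin s = b * sin t -> exists k : Z, t = s + 2 * PI * IZR k.
Proof.
  intros a_pos b_pos cos_eq sin_eq.
  pose proof (sin2_cos2 s) as unit_s. pose proof (sin2_cos2 t) as unit_t. unfold Rsqr in unit_s, unit_t.
  assert (b_eq : b = a).
  { apply Rsqr_inj; [lra|lra|]. unfold Rsqr.
    transitivity ((b * sin t) * (b * sin t) + (b * cos t) * (b * cos t)).
    - transitivity (b * b * 1); [ring|]. rewrite <- unit_t. ring.
    - rewrite <- sin_eq, <- cos_eq. transitivity (a * a * 1); [rewrite <- unit_s|]; ring. }
  subst b. apply Rmult_eq_reg_l in cos_eq, sin_eq; try lra.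
  assert (half_sin_0 : sin ((t - s) / 2) = 0).
  { pose proof (cos_2a_sin ((t - s) / 2)) as double. replace (2 * ((t - s) / 2)) with (t - s) in double by field.
    rewrite cos_minus, cos_eq, sin_eq, Rplus_comm, unit_t in double. apply Rsqr_0_uniq. unfold Rsqr. lra. }
  destruct (sin_eq_0_0 _ half_sin_0) as (k & half_eq). exists k. lra.
Qed.

Lemma arg_diff_mod v v' c t : 0 < vnorm v -> 0 < vnorm v' -> 0 < c ->
  c * cos t = vdot v v' -> c * sin t = vcross v v' -> exists k : Z, arg v' - arg v = t + 2 * PI * IZR k.
Proof.
  intros v_pos v'_pos c_pos cos_eq sin_eq. rewrite vdot_polar in cos_eq by auto. rewrite vcross_polar in sin_eq by auto.
  apply (angle_unique c (vnorm v * vnorm v')); auto. now apply Rmult_lt_0_compat.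
Qed.

Lemma arg_diff_atan v v' : 0 < vnorm v -> 0 < vnorm v' -> 0 < vdot v v' ->
  exists k : Z, arg v' - arg v = atan (vcross v v' / vdot v v') + 2 * PI * IZR k.
Proof.
  intros v_pos v'_pos dot_pos. set (t := vcross v v' / vdot v v').
  assert (sqrt_pos : 0 < sqrt (1 + t²)) by (apply sqrt_lt_R0; pose proof (Rle_0_sqr t); lra).
  apply (arg_diff_mod v v' (vdot v v' * sqrt (1 + t²))); auto.
  - now apply Rmult_lt_0_compat.
  - rewrite cos_atan. field. lra.
  - rewrite sin_atan. replace (vcross v v') with (t * vdot v v') by (unfold t; field; lra). field. lra.
Qed.

(* Midpoint and direction of a bond in the basis (a1, a2). *)
Definition mid_x (i : dir) (p : site) : R := IZR (fst p) + match i with NorthEast => / 3 | _ => 5 / 6 end.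
Definition mid_y (i : dir) (p : site) : R := IZR (snd p) + match i with East => / 3 | _ => 5 / 6 end.
Definition dir_x (i : dir) : R := match i with East => 1 | NorthEast => 0 | NorthWest => -1 end.
Definition dir_y (i : dir) : R := match i with East => 0 | NorthEast => 1 | NorthWest => 1 end.

Definition dir_cross (i : dir) (x y : R) : R := x * dir_y i - y * dir_x i.

(* The angle, as a fraction of a turn, under which the bond of direction i and midpoint (x, y) is seen
   from the origin. *)
Definition bond_angle (i : dir) (x y : R) : R :=
  atan (sqrt 3 / 2 * dir_cross i x y / (hexnorm x y - / 4)) / (2 * PI).

Lemma site_x_source i p : site_x (source i p) = mid_x i p - dir_x i / 2.
Proof. unfold site_x, mid_x. destruct i; unfold source, shift; simpl; rewrite ?plus_IZR; field. Qed.

Lemma site_y_source i p : site_y (source i p) = mid_y i p - dir_y i / 2.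
Proof. unfold site_y, mid_y. destruct i; unfold source, shift; simpl; rewrite ?plus_IZR; field. Qed.

Lemma site_x_target i p : site_x (target i p) = mid_x i p + dir_x i / 2.
Proof. unfold site_x, mid_x. destruct i; unfold target, shift; simpl; rewrite ?plus_IZR; field. Qed.

Lemma site_y_target i p : site_y (target i p) = mid_y i p + dir_y i / 2.
Proof. unfold site_y, mid_y. destruct i; unfold target, shift; simpl; rewrite ?plus_IZR; field. Qed.

Lemma Rabs_bond_angle_lt i x y : Rabs (bond_angle i x y) < / 4.
Proof.
  unfold bond_angle. set (t := _ / (hexnorm x y - _)). pose proof (atan_bound t).
  apply Rabs_def1; apply (Rmult_lt_reg_r (2 * PI)); try lra;
    replace (atan t / (2 * PI) * (2 * PI)) with (atan t) by (field; lra); lra.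
Qed.

(* T acts on positions as the translation x -> x - s or the point reflection x -> s - x. *)
Definition acts_rigidly (T : site -> site) (sg sx sy : R) : Prop :=
  (sg = 1 \/ sg = -1) /\
  forall p, site_x (T p) = sg * (site_x p - sx) /\ site_y (T p) = sg * (site_y p - sy).

Lemma grad_yhat_angle T sg sx sy i p : acts_rigidly T sg sx sy ->
  / 4 < hexnorm (mid_x i p - sx) (mid_y i p - sy) ->
  exists k : Z, grad (fun p => yhat (T p)) i p = bond_angle i (mid_x i p - sx) (mid_y i p - sy) + IZR k.
Proof.
  intros (sg_sign & T_coords) off_centre.
  destruct (T_coords (source i p)) as (source_x & source_y). destruct (T_coords (target i p)) as (target_x & target_y).
  rewrite site_x_source in source_x. rewrite site_y_source in source_y.
  rewrite site_x_target in target_x. rewrite site_y_target in target_y.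
  set (x := mid_x i p - sx) in *. set (y := mid_y i p - sy) in *.
  assert (sg_sqr : sg * sg = 1) by (destruct sg_sign as [-> | ->]; ring).
  assert (dot_eq : vdot (pos (T (source i p))) (pos (T (target i p))) = hexnorm x y - / 4).
  { rewrite !pos_hexvec, vdot_hexvec, source_x, source_y, target_x, target_y.
    transitivity (sg * sg * (hexnorm x y - (dir_x i * dir_x i + dir_x i * dir_y i + dir_y i * dir_y i) / 4)).
    - unfold x, y, hexnorm. field.
    - rewrite sg_sqr. destruct i; simpl; field. }
  assert (cross_eq : vcross (pos (T (source i p))) (pos (T (target i p))) = sqrt 3 / 2 * dir_cross i x y).
  { rewrite !pos_hexvec, vcross_hexvec, source_x, source_y, target_x, target_y.
    transitivity (sg * sg * (sqrt 3 / 2 * dir_cross i x y)); [unfold x, y, dir_cross; field|]. rewrite sg_sqr. ring. }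
  assert (norm_pos : forall q, vdot (pos q) (pos (T (target i p))) <> 0 \/ vdot (pos (T (source i p))) (pos q) <> 0 ->
    0 < vnorm (pos q)).
  { intros q dot_neq_0. rewrite pos_hexvec, vnorm_hexvec in *.
    destruct (hexnorm_pos_or_0 (site_x q) (site_y q)) as [pos|(x_0 & y_0)]; [now apply sqrt_lt_R0|].
    rewrite !pos_hexvec, !vdot_hexvec, x_0, y_0 in dot_neq_0. lra. }
  destruct (arg_diff_atan (pos (T (source i p))) (pos (T (target i p)))) as (k & arg_diff);
    [apply norm_pos; lra..|lra|].
  exists k. unfold grad, yhat, bond_angle. rewrite dot_eq, cross_eq in arg_diff. pose proof PI_gt_3.
  transitivity ((arg (pos (T (target i p))) - arg (pos (T (source i p)))) / (2 * PI)); [field; lra|].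
  rewrite arg_diff. field. lra.
Qed.

Definition strain (y : site -> R) : field := fun i p => wrap (grad y i p).
Definition ref_strain : field := strain yhat.

Lemma strain_rigid T sg sx sy i p : acts_rigidly T sg sx sy ->
  / 4 < hexnorm (mid_x i p - sx) (mid_y i p - sy) ->
  strain (fun p => yhat (T p)) i p = bond_angle i (mid_x i p - sx) (mid_y i p - sy).
Proof.
  intros rigid off_centre. destruct (grad_yhat_angle T sg sx sy i p rigid off_centre) as (k & grad_eq).
  apply (wrap_unique _ _ k); auto. pose proof (Rabs_bond_angle_lt i (mid_x i p - sx) (mid_y i p - sy)). lra.
Qed.

(* The cell whose bond of direction i is a side of the triangle containing the origin. *)
Definition core_cell (i : dir) : site :=
  match i with East => (-1, 0)%Z | NorthEast => (0, -1)%Z | NorthWest => (-1, -1)%Z end.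

Lemma hexnorm_mid_noncore i p : p <> core_cell i -> / 4 < hexnorm (mid_x i p) (mid_y i p).
Proof.
  intros noncore.
  set (a := (6 * fst p + match i with NorthEast => 2 | _ => 5 end)%Z).
  set (b := (6 * snd p + match i with East => 2 | _ => 5 end)%Z).
  assert (mid_x_eq : mid_x i p = IZR a / 6) by (unfold mid_x, a; rewrite plus_IZR, mult_IZR; destruct i; field).
  assert (mid_y_eq : mid_y i p = IZR b / 6) by (unfold mid_y, b; rewrite plus_IZR, mult_IZR; destruct i; field).
  replace (hexnorm (mid_x i p) (mid_y i p)) with (IZR (hexnormZ a b) / 36)
    by (rewrite mid_x_eq, mid_y_eq, IZR_hexnormZ; unfold hexnorm; field).
  assert (large : (9 < hexnormZ a b)%Z); [|apply IZR_lt in large; lra].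
  apply Z.nle_gt. intros small. apply noncore. unfold hexnormZ in small.
  assert (a_small : (-4 < a < 4)%Z).
  { clear - small. pose proof (Z.square_nonneg (a + 2 * b)). nia. }
  assert (b_small : (-4 < b < 4)%Z).
  { clear - small. pose proof (Z.square_nonneg (2 * a + b)). nia. }
  unfold a, b in *. clear - a_small b_small. destruct p as [m n].
  destruct i; cbn [fst snd core_cell] in *; f_equal; lia.
Qed.

Lemma acts_rigidly_id : acts_rigidly (fun p => p) 1 0 0.
Proof. split; [now left|]. intros p. split; ring. Qed.

Lemma ref_strain_noncore i p : p <> core_cell i -> ref_strain i p = bond_angle i (mid_x i p) (mid_y i p).
Proof.
  intros noncore. pose proof (strain_rigid _ _ _ _ i p acts_rigidly_id) as strain_eq. rewrite !Rminus_0_r in strain_eq.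
  now apply strain_eq, hexnorm_mid_noncore.
Qed.

Definition core_strain (i : dir) : R := match i with NorthEast => / 3 | _ => - / 3 end.

Lemma ref_strain_core i : ref_strain i (core_cell i) = core_strain i.
Proof.
  set (p := core_cell i). set (v := pos (source i p)). set (v' := pos (target i p)).
  assert (trig : cos (2 * PI * core_strain i) = - / 2 /\
    sin (2 * PI * core_strain i) = match i with NorthEast => sqrt 3 / 2 | _ => - (sqrt 3 / 2) end).
  { assert (cos_third : cos (2 * PI * / 3) = - / 2).
    { replace (2 * PI * / 3) with (2 * (PI / 3)) by field. rewrite cos_2PI3. lra. }
    assert (sin_third : sin (2 * PI * / 3) = sqrt 3 / 2).
    { replace (2 * PI * / 3) with (2 * (PI / 3)) by field. apply sin_2PI3. }
    destruct i; cbn [core_strain]; rewrite <- ?Ropp_mult_distr_r, ?cos_neg, ?sin_neg, cos_third, sin_third;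
      split; ring. }
  destruct trig as (cos_eq & sin_eq).
  assert (exists k : Z, arg v' - arg v = 2 * PI * core_strain i + 2 * PI * IZR k) as (k & arg_diff).
  { apply (arg_diff_mod v v' (/ 3)); unfold v, v';
      rewrite ?cos_eq, ?sin_eq, ?pos_hexvec, ?vnorm_hexvec, ?vdot_hexvec, ?vcross_hexvec,
        ?site_x_source, ?site_y_source, ?site_x_target, ?site_y_target;
      unfold hexnorm, mid_x, mid_y, p, core_cell, dir_x, dir_y;
      try apply sqrt_lt_R0; destruct i; simpl; lra. }
  apply (wrap_unique _ _ k).
  - unfold grad, yhat. fold v v'. pose proof PI_gt_3.
    transitivity ((arg v' - arg v) / (2 * PI)); [field; lra|]. rewrite arg_diff. field. lra.
  - unfold core_strain. apply Rabs_def1; destruct i; lra.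
Qed.

Lemma Rabs_ref_strain_le i p : Rabs (ref_strain i p) <= / 3.
Proof.
  destruct (classic (p = core_cell i)) as [->|noncore].
  - rewrite ref_strain_core. apply Rabs_le. unfold core_strain; destruct i; lra.
  - rewrite ref_strain_noncore by auto. pose proof (Rabs_bond_angle_lt i (mid_x i p) (mid_y i p)). lra.
Qed.

Lemma curl_strain_int (y : site -> R) : int_valued (curl (strain y)).
Proof.
  intros f. pose proof (curl_grad y f) as curl_0.
  assert (strain_mod : forall i p, exists k : Z, strain y i p = grad y i p - IZR k) by (intros; apply wrap_mod).
  unfold curl in *. destruct (snd f).
  - destruct (strain_mod NorthEast (shift 1 0 (fst f))) as (a & ->), (strain_mod East (shift 0 1 (fst f))) as (b & ->),
      (strain_mod NorthWest (fst f)) as (c & ->).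
    exists (- a + b + c)%Z. rewrite !plus_IZR, opp_IZR. lra.
  - destruct (strain_mod East (fst f)) as (a & ->), (strain_mod NorthWest (fst f)) as (b & ->),
      (strain_mod NorthEast (fst f)) as (c & ->).
    exists (- a - b + c)%Z. rewrite plus_IZR, minus_IZR, opp_IZR. lra.
Qed.

Lemma Rabs_curl_ref_strain_lt f : f <> origin_face -> Rabs (curl ref_strain f) < 1.
Proof.
  intros off_origin.
  assert (noncore_small : forall i p, p <> core_cell i -> - / 4 < ref_strain i p < / 4).
  { intros i p noncore. apply Rabs_lt_between. rewrite ref_strain_noncore by auto. apply Rabs_bond_angle_lt. }
  assert (small : forall i p, - / 3 <= ref_strain i p <= / 3) by (intros; apply Rabs_le_between, Rabs_ref_strain_le).
  destruct f as [p []]; unfold curl; cbn [fst snd].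
  - assert (p_neq : p <> (-1, -1)%Z) by (intros ->; now apply off_origin).
    assert (noncore_NE : shift 1 0 p <> core_cell NorthEast).
    { intros [= x_eq y_eq]. apply p_neq. destruct p; simpl in *; f_equal; lia. }
    assert (noncore_E : shift 0 1 p <> core_cell East).
    { intros [= x_eq y_eq]. apply p_neq. destruct p; simpl in *; f_equal; lia. }
    pose proof (noncore_small NorthEast _ noncore_NE). pose proof (noncore_small East _ noncore_E).
    pose proof (noncore_small NorthWest p p_neq). apply Rabs_def1; lra.
  - pose proof (small East p). pose proof (small NorthEast p). pose proof (small NorthWest p).
    pose proof (noncore_small East p). pose proof (noncore_small NorthEast p). pose proof (noncore_small NorthWest p).
    destruct (classic (p = core_cell East)) as [E_core|]; [|destruct (classic (p = core_cell NorthEast)) as [NE_core|]];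
      [assert (p <> core_cell NorthEast) by (rewrite E_core; discriminate);
       assert (p <> core_cell NorthWest) by (rewrite E_core; discriminate)
      |assert (p <> core_cell NorthWest) by (rewrite NE_core; discriminate)|];
      apply Rabs_def1; intuition lra.
Qed.

Lemma curl_ref_strain f : curl ref_strain f = indicator origin_face f.
Proof.
  destruct (classic (f = origin_face)) as [->|off_origin].
  - rewrite indicator_same. unfold curl, origin_face, down_face, shift; simpl.
    change (0%Z, (-1)%Z) with (core_cell NorthEast). change ((-1)%Z, 0%Z) with (core_cell East).
    change ((-1)%Z, (-1)%Z) with (core_cell NorthWest). rewrite !ref_strain_core. simpl. field.
  - rewrite indicator_neq by auto. destruct (curl_strain_int yhat f) as (k & curl_eq).
    pose proof (Rabs_curl_ref_strain_lt f off_origin) as small. unfold ref_strain in *. rewrite curl_eq in *.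
    apply IZR_Rabs_lt_1 in small. now rewrite small.
Qed.

(** * Comparison with the rotated gradient of a logarithm *)

Definition log_potential (f : face) : R := - log_rate * ln (Rmax 1 (face_dist f origin_face)).
Definition log_field : field := rot log_potential.

(* Common leading term of ref_strain and log_field far from the origin. *)
Definition far_field (i : dir) (x y : R) : R := log_rate * dir_cross i x y / (2 * hexnorm x y).

Definition mid_radius (i : dir) (p : site) : R := sqrt (hexnorm (mid_x i p) (mid_y i p)).

Lemma mid_radius_sqr i p : mid_radius i p * mid_radius i p = hexnorm (mid_x i p) (mid_y i p).
Proof. apply sqrt_sqrt, hexnorm_nonneg. Qed.

Lemma Rabs_div_le a b A B : Rabs a <= A -> 0 < B <= b -> Rabs (a / b) <= A / B.
Proof.
  intros a_le B_le. unfold Rdiv. rewrite Rabs_mult, (Rabs_pos_eq (/ b)) by (left; apply Rinv_0_lt_compat; lra).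
  apply Rmult_le_compat; auto using Rabs_pos; [left; apply Rinv_0_lt_compat; lra|apply Rinv_le_contravar; lra].
Qed.

Lemma atan_cubic t : Rabs (atan t - t) <= Rabs t ^ 3.
Proof.
  pose proof (bounded_variation (fun t => atan t - t) (fun x => / (1 + x²) - 1) (t ^ 2) 0 t) as variation.
  cbv beta in variation. rewrite atan_0, !Rminus_0_r in variation.
  replace (Rabs t ^ 3) with (t ^ 2 * Rabs t) by (rewrite <- pow2_abs; ring).
  apply variation. intros x. rewrite Rminus_0_r. intros x_le. split; [auto_derive; auto; unfold Rsqr; field; nra|].
  apply pow2_le_of_Rabs_le in x_le. rewrite pow2_abs in x_le. unfold Rsqr.
  replace (/ (1 + x * x) - 1) with (- (x ^ 2 / (1 + x * x))) by (field; nra).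
  rewrite Rabs_Ropp, Rabs_pos_eq by (apply Rdiv_le_0_compat; nra).
  apply Rle_div_l; nra.
Qed.

Lemma log_ratio_cubic s : Rabs s <= / 2 -> Rabs (ln (1 + s) - ln (1 - s) - 2 * s) <= 3 * Rabs s ^ 3.
Proof.
  intros s_le.
  pose proof (bounded_variation (fun s => ln (1 + s) - ln (1 - s) - 2 * s) (fun x => / (1 + x) + / (1 - x) - 2)
    (3 * s ^ 2) 0 s) as variation.
  cbv beta in variation.
  replace (ln (1 + 0) - ln (1 - 0) - 2 * 0) with 0 in variation by (rewrite Rplus_0_r, Rminus_0_r; ring).
  rewrite !Rminus_0_r in variation.
  replace (3 * Rabs s ^ 3) with (3 * s ^ 2 * Rabs s) by (rewrite <- pow2_abs; ring).
  apply variation. intros x. rewrite Rminus_0_r. intros x_le.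
  assert (x_bounds : - / 2 <= x <= / 2) by (apply Rabs_le_between; lra).
  assert (x_sqr : 0 <= x ^ 2 <= / 4) by (clear - x_bounds; split; [apply pow2_ge_0|nra]).
  apply pow2_le_of_Rabs_le in x_le. rewrite pow2_abs in x_le.
  split; [auto_derive; [lra|field; lra]|].
  replace (/ (1 + x) + / (1 - x) - 2) with (2 * x ^ 2 / (1 - x ^ 2)) by (field; repeat split; lra).
  rewrite Rabs_pos_eq by (apply Rdiv_le_0_compat; lra). apply Rle_div_l; nra.
Qed.

Lemma Rabs_dir_cross_le i x y : Rabs (dir_cross i x y) <= 1.2 * sqrt (hexnorm x y).
Proof.
  apply Rabs_le_sqrt_hexnorm. unfold dir_cross, hexnorm.
  pose proof (pow2_ge_0 (2 * x + y)). pose proof (pow2_ge_0 (2 * y + x)). pose proof (pow2_ge_0 (x - y)).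
  destruct i; simpl; nra.
Qed.

Lemma face_dist_origin f : face_dist f origin_face = sqrt (hexnorm (IZR (face_x f) / 3) (IZR (face_y f) / 3)).
Proof.
  unfold face_dist, face_sqdist. change (face_x origin_face) with 0%Z. change (face_y origin_face) with 0%Z.
  rewrite !Z.sub_0_r, IZR_hexnormZ.
  replace (hexnorm (IZR (face_x f) / 3) (IZR (face_y f) / 3)) with (hexnorm (IZR (face_x f)) (IZR (face_y f)) / (3 * 3))
    by (unfold hexnorm; field).
  rewrite sqrt_div_alt, sqrt_square; lra.
Qed.

Lemma hexnorm_left_face i p :
  hexnorm (IZR (face_x (left_face i p)) / 3) (IZR (face_y (left_face i p)) / 3) =
  hexnorm (mid_x i p) (mid_y i p) + / 12 - dir_cross i (mid_x i p) (mid_y i p) / 2.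
Proof.
  unfold face_x, face_y, mid_x, mid_y, dir_cross.
  destruct i; unfold left_face, up_face, down_face, shift, dir_x, dir_y; simpl fst; simpl snd; cbv iota;
    rewrite ?plus_IZR, ?mult_IZR, ?plus_IZR; unfold hexnorm; field.
Qed.

Lemma hexnorm_right_face i p :
  hexnorm (IZR (face_x (right_face i p)) / 3) (IZR (face_y (right_face i p)) / 3) =
  hexnorm (mid_x i p) (mid_y i p) + / 12 + dir_cross i (mid_x i p) (mid_y i p) / 2.
Proof.
  unfold face_x, face_y, mid_x, mid_y, dir_cross.
  destruct i; unfold right_face, up_face, down_face, shift, dir_x, dir_y; simpl fst; simpl snd; cbv iota;
    rewrite ?plus_IZR, ?mult_IZR, ?plus_IZR; unfold hexnorm; field.
Qed.

Lemma bond_angle_far i x y : 1 <= hexnorm x y ->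
  Rabs (bond_angle i x y - far_field i x y) <= 1 / sqrt (hexnorm x y) ^ 3.
Proof.
  intros N_ge. pose proof (Rabs_dir_cross_le i x y) as cross_le. unfold bond_angle, far_field, log_rate.
  set (s := dir_cross i x y) in *. set (N := hexnorm x y) in *. set (r := sqrt N) in *.
  assert (r_sqr : r * r = N) by (apply sqrt_sqrt; lra).
  assert (r_ge : 1 <= r) by (unfold r; rewrite <- sqrt_1; apply sqrt_le_1_alt; auto).
  assert (r3_pos : 0 < / r ^ 3) by (apply Rinv_0_lt_compat, pow_lt; lra).
  pose proof sqrt3_bounds. pose proof PI_gt_3.
  set (u := sqrt 3 / 2 * s). set (t := u / (N - / 4)).
  assert (u_le : Rabs u <= 1.04 * r).
  { unfold u. rewrite Rabs_mult, (Rabs_pos_eq (sqrt 3 / 2)) by lra.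
    apply Rle_trans with (0.86605 * (1.2 * r)); [apply Rmult_le_compat; auto using Rabs_pos; lra|lra]. }
  assert (t_le : Rabs t <= 1.4 / r).
  { apply Rle_trans with (1.04 * r / (3 / 4 * N)); [apply Rabs_div_le; lra|].
    rewrite <- r_sqr. apply (Rle_div_r _ _ r); [lra|].
    replace (1.04 * r / (3 / 4 * (r * r)) * r) with (1.04 * 4 / 3) by (field; lra). lra. }
  assert (atan_err : Rabs (atan t - t) <= 2.8 / r ^ 3).
  { apply Rle_trans with ((1.4 / r) ^ 3).
    - eapply Rle_trans; [apply atan_cubic|]. apply pow_incr. auto using Rabs_pos.
    - replace ((1.4 / r) ^ 3) with (1.4 ^ 3 * / r ^ 3) by (field; lra). unfold Rdiv. apply Rmult_le_compat_r; lra. }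
  assert (denominator_err : Rabs (t - u / N) <= 0.4 / r ^ 3).
  { replace (t - u / N) with (u / (4 * N * (N - / 4))) by (unfold t; field; lra).
    apply Rle_trans with (1.04 * r / (4 * N * (3 / 4 * N))); [apply Rabs_div_le; [auto|split; nra]|].
    rewrite <- r_sqr. replace (1.04 * r / (4 * (r * r) * (3 / 4 * (r * r)))) with (1.04 / 3 * / r ^ 3) by (field; lra).
    unfold Rdiv. apply Rmult_le_compat_r; lra. }
  replace (atan t / (2 * PI) - sqrt 3 / (2 * PI) * s / (2 * N)) with ((atan t - t + (t - u / N)) / (2 * PI))
    by (unfold u; field; lra).
  apply Rle_trans with (3.2 / r ^ 3 / 6); [|unfold Rdiv in *; lra].
  apply Rabs_div_le; [|lra]. eapply Rle_trans; [apply Rabs_triang|]. unfold Rdiv in *. lra.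
Qed.

Lemma ln_max_sqrt a : 1 <= a -> ln (Rmax 1 (sqrt a)) = / 2 * ln a.
Proof.
  intros a_ge. rewrite Rmax_right by (rewrite <- sqrt_1; apply sqrt_le_1_alt; auto).
  pose proof (sqrt_lt_R0 a ltac:(lra)). rewrite <- (sqrt_sqrt a) at 2 by lra. rewrite ln_mult by auto. field.
Qed.

Lemma log_field_log_ratio i p : 4 <= hexnorm (mid_x i p) (mid_y i p) ->
  let e := dir_cross i (mid_x i p) (mid_y i p) / (2 * (hexnorm (mid_x i p) (mid_y i p) + / 12)) in
  Rabs e <= 0.6 / mid_radius i p /\ log_field i p = log_rate / 2 * (ln (1 + e) - ln (1 - e)).
Proof.
  intros N_ge e. pose proof (Rabs_dir_cross_le i (mid_x i p) (mid_y i p)) as cross_le.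
  fold (mid_radius i p) in cross_le. pose proof (mid_radius_sqr i p) as r_sqr.
  unfold log_field, rot, log_potential. rewrite !face_dist_origin, hexnorm_left_face, hexnorm_right_face.
  unfold e. clear e. set (s := dir_cross i _ _) in *. set (N := hexnorm _ _) in *. set (r := mid_radius i p) in *.
  assert (r_ge : 2 <= r) by (unfold r, mid_radius; rewrite <- (sqrt_square 2) by lra; apply sqrt_le_1_alt; fold N; lra).
  set (M := N + / 12). set (e := s / (2 * M)).
  assert (e_le : Rabs e <= 0.6 / r).
  { apply Rle_trans with (1.2 * r / (2 * N)); [apply Rabs_div_le; unfold M; lra|].
    rewrite <- r_sqr. replace (1.2 * r / (2 * (r * r))) with (1.2 / 2 * / r) by (field; lra). lra. }
  assert (e_small : - / 2 < e < / 2).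
  { apply Rabs_lt_between. eapply Rle_lt_trans; [exact e_le|]. apply Rlt_div_l; lra. }
  split; auto. apply Rabs_le_between in cross_le.
  rewrite !ln_max_sqrt by (unfold M; nra).
  replace (M - s / 2) with (M * (1 - e)) by (unfold e, M; field; lra).
  replace (M + s / 2) with (M * (1 + e)) by (unfold e, M; field; lra).
  rewrite !ln_mult by (unfold M; lra). field.
Qed.

Lemma log_field_far i p : 4 <= hexnorm (mid_x i p) (mid_y i p) ->
  Rabs (log_field i p - far_field i (mid_x i p) (mid_y i p)) <= 1 / mid_radius i p ^ 3.
Proof.
  intros N_ge. destruct (log_field_log_ratio i p N_ge) as (e_le & ->).
  pose proof (Rabs_dir_cross_le i (mid_x i p) (mid_y i p)) as cross_le. fold (mid_radius i p) in cross_le.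
  pose proof (mid_radius_sqr i p) as r_sqr. unfold far_field.
  set (s := dir_cross i _ _) in *. set (N := hexnorm _ _) in *. set (r := mid_radius i p) in *. set (e := s / _) in *.
  assert (r_ge : 2 <= r) by (unfold r, mid_radius; rewrite <- (sqrt_square 2) by lra; apply sqrt_le_1_alt; fold N; lra).
  assert (r3_pos : 0 < / r ^ 3) by (apply Rinv_0_lt_compat, pow_lt; lra).
  assert (log_err : Rabs (ln (1 + e) - ln (1 - e) - 2 * e) <= 0.7 / r ^ 3).
  { apply Rle_trans with (3 * (0.6 / r) ^ 3).
    - eapply Rle_trans; [apply log_ratio_cubic|].
      + eapply Rle_trans; [exact e_le|]. apply Rle_div_l; lra.
      + apply Rmult_le_compat_l; [lra|]. apply pow_incr. auto using Rabs_pos.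
    - replace (3 * (0.6 / r) ^ 3) with (3 * 0.6 ^ 3 * / r ^ 3) by (field; lra). unfold Rdiv.
      apply Rmult_le_compat_r; lra. }
  assert (denominator_err : Rabs (e - s / (2 * N)) <= 0.1 / r ^ 3).
  { replace (e - s / (2 * N)) with (- s / (24 * ((N + / 12) * N))) by (unfold e; field; lra).
    apply Rle_trans with (1.2 * r / (24 * (N * N))); [apply Rabs_div_le; [now rewrite Rabs_Ropp|split; nra]|].
    rewrite <- r_sqr. replace (1.2 * r / (24 * (r * r * (r * r)))) with (1.2 / 24 * / r ^ 3) by (field; lra).
    unfold Rdiv. apply Rmult_le_compat_r; lra. }
  replace (log_rate / 2 * (ln (1 + e) - ln (1 - e)) - log_rate * s / (2 * N))
    with (log_rate * (/ 2 * (ln (1 + e) - ln (1 - e) - 2 * e) + (e - s / (2 * N)))) by (field; lra).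
  pose proof log_rate_bounds. rewrite Rabs_mult, (Rabs_pos_eq log_rate) by lra.
  pose proof (Rabs_triang (/ 2 * (ln (1 + e) - ln (1 - e) - 2 * e)) (e - s / (2 * N))) as triangle.
  rewrite Rabs_mult, (Rabs_pos_eq (/ 2)) in triangle by lra.
  rewrite <- (Rmult_1_l (1 / r ^ 3)). apply Rmult_le_compat; [lra|apply Rabs_pos|lra|unfold Rdiv in *; lra].
Qed.

Lemma weight_le_mid_radius i p : weight p <= 3 + 2.4 * mid_radius i p.
Proof.
  unfold weight. destruct (Rabs_coord_le (mid_x i p) (mid_y i p)) as (mid_x_le & mid_y_le).
  fold (mid_radius i p) in *.
  assert (Rabs (IZR (fst p)) <= Rabs (mid_x i p) + 5 / 6).
  { unfold mid_x, Rabs; repeat destruct Rcase_abs; destruct i; lra. }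
  assert (Rabs (IZR (snd p)) <= Rabs (mid_y i p) + 5 / 6).
  { unfold mid_y, Rabs; repeat destruct Rcase_abs; destruct i; lra. }
  lra.
Qed.

Lemma mid_radius_far i p : 8 <= weight p ->
  2 <= mid_radius i p /\ weight p <= 4 * mid_radius i p /\ 4 <= hexnorm (mid_x i p) (mid_y i p).
Proof.
  intros far. pose proof (weight_le_mid_radius i p). rewrite <- mid_radius_sqr. repeat split; nra.
Qed.

Lemma noncore_far i p : 8 <= weight p -> p <> core_cell i.
Proof.
  rewrite weight_IZR. intros far ->. apply le_IZR in far. destruct i; simpl in far; lia.
Qed.

Lemma inv_mid_radius_pow_le i p k : 8 <= weight p -> / mid_radius i p ^ k <= 4 ^ k / weight p ^ k.
Proof.
  intros far. destruct (mid_radius_far i p far) as (r_ge & weight_le & _).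
  assert (inv_le : / mid_radius i p <= 4 * / weight p).
  { replace (4 * / weight p) with (/ (weight p / 4)) by (field; lra). apply Rinv_le_contravar; lra. }
  rewrite <- pow_inv. unfold Rdiv. rewrite <- pow_inv, <- Rpow_mult_distr. apply pow_incr. split; auto.
  left. apply Rinv_0_lt_compat. lra.
Qed.

Lemma Rabs_far_field_le i x y : 1 <= hexnorm x y -> Rabs (far_field i x y) <= 1 / sqrt (hexnorm x y).
Proof.
  intros N_ge. pose proof (Rabs_dir_cross_le i x y) as cross_le. unfold far_field.
  set (s := dir_cross i x y) in *. set (N := hexnorm x y) in *. set (r := sqrt N) in *.
  assert (r_sqr : r * r = N) by (apply sqrt_sqrt; lra).
  assert (r_ge : 1 <= r) by (unfold r; rewrite <- sqrt_1; apply sqrt_le_1_alt; auto).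
  pose proof log_rate_bounds. apply Rle_trans with (r / (2 * (r * r))).
  - apply Rabs_div_le; [|split; nra]. rewrite Rabs_mult, (Rabs_pos_eq log_rate) by lra. nra.
  - replace (r / (2 * (r * r))) with (/ 2 * (1 / r)) by (field; lra).
    assert (0 < 1 / r) by (apply Rdiv_lt_0_compat; lra). lra.
Qed.

Lemma ref_strain_minus_log_field_decays : decays 3 (fun i p => ref_strain i p - log_field i p).
Proof.
  apply (decays_of_far 3 8 _ 128). intros i p far. replace (INR 8) with 8 in far by (simpl; lra).
  destruct (mid_radius_far i p far) as (_ & _ & N_ge).
  rewrite ref_strain_noncore by now apply noncore_far.
  pose proof (bond_angle_far i (mid_x i p) (mid_y i p) ltac:(lra)) as angle_err. fold (mid_radius i p) in angle_err.
  pose proof (log_field_far i p N_ge) as log_err. pose proof (inv_mid_radius_pow_le i p 3 far).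
  set (far_value := far_field i (mid_x i p) (mid_y i p)) in *. unfold Rdiv in *.
  replace (bond_angle i (mid_x i p) (mid_y i p) - log_field i p)
    with ((bond_angle i (mid_x i p) (mid_y i p) - far_value) + - (log_field i p - far_value)) by ring.
  eapply Rle_trans; [apply Rabs_triang|]. rewrite Rabs_Ropp. lra.
Qed.

Lemma log_field_decays : decays 1 log_field.
Proof.
  apply (decays_of_far 1 8 _ 68). intros i p far. replace (INR 8) with 8 in far by (simpl; lra).
  destruct (mid_radius_far i p far) as (r_ge & _ & N_ge).
  pose proof (log_field_far i p N_ge) as log_err.
  pose proof (Rabs_far_field_le i (mid_x i p) (mid_y i p) ltac:(lra)) as far_le. fold (mid_radius i p) in far_le.
  pose proof (inv_mid_radius_pow_le i p 1 far) as inv_le. rewrite pow_1 in inv_le.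
  assert (/ mid_radius i p ^ 3 <= / mid_radius i p) by (apply Rinv_le_contravar; [lra|simpl; nra]).
  set (far_value := far_field i (mid_x i p) (mid_y i p)) in *. unfold Rdiv in *.
  replace (log_field i p) with ((log_field i p - far_value) + far_value) by ring.
  pose proof (inv_weight_pow_pos p 1). eapply Rle_trans; [apply Rabs_triang|]. lra.
Qed.

Lemma ref_strain_decays : decays 1 ref_strain.
Proof.
  apply (decays_ext 1 (fun i p => (ref_strain i p - log_field i p) + log_field i p)); [intros; ring|].
  apply (decays_plus 1 (fun i p => ref_strain i p - log_field i p)); [|apply log_field_decays].
  apply (decays_weaken 1 3); [lia|apply ref_strain_minus_log_field_decays].
Qed.

Lemma far_field_shift i x y sx sy : let s := sqrt (hexnorm sx sy) in let r := sqrt (hexnorm x y) in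
  4 * s + 4 <= r -> Rabs (far_field i (x - sx) (y - sy) - far_field i x y) <= 10 * s / r ^ 2.
Proof.
  intros s r r_ge.
  pose proof (Rabs_dir_cross_le i (x - sx) (y - sy)) as cross'_le. pose proof (Rabs_dir_cross_le i sx sy) as cross_s_le.
  assert (cross_eq : dir_cross i x y = dir_cross i (x - sx) (y - sy) + dir_cross i sx sy) by (unfold dir_cross; ring).
  set (r' := sqrt (hexnorm (x - sx) (y - sy))) in *.
  assert (r'_bounds : r - s <= r' <= r + s).
  { pose proof (sqrt_hexnorm_triangle (x - sx) (y - sy) sx sy) as lower.
    pose proof (sqrt_hexnorm_triangle x y (- sx) (- sy)) as upper.
    replace (x - sx + sx) with x in lower by ring. replace (y - sy + sy) with y in lower by ring.
    replace (hexnorm (- sx) (- sy)) with (hexnorm sx sy) in upper by (unfold hexnorm; ring).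
    fold (x - sx) (y - sy) in upper. fold s r r' in lower, upper. lra. }
  unfold far_field. rewrite cross_eq.
  rewrite <- (sqrt_sqrt (hexnorm (x - sx) (y - sy))), <- (sqrt_sqrt (hexnorm x y)) by apply hexnorm_nonneg.
  fold r r' s in cross_s_le |- *. set (c' := dir_cross i (x - sx) (y - sy)) in *. set (c := dir_cross i sx sy) in *.
  assert (r2_pos : 0 < / r ^ 2) by (apply Rinv_0_lt_compat, pow_lt; lra).
  replace (log_rate * c' / (2 * (r' * r')) - log_rate * (c' + c) / (2 * (r * r)))
    with (log_rate / 2 * (- c / r ^ 2 + c' * ((r - r') * (r + r')) / (r ^ 2 * (r' * r')))) by (field; lra).
  assert (numerator_err : Rabs (- c / r ^ 2) <= 1.2 * s / r ^ 2).
  { apply Rabs_div_le; [now rewrite Rabs_Ropp|]. split; [apply pow_lt; lra|lra]. }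
  assert (denominator_err : Rabs (c' * ((r - r') * (r + r')) / (r ^ 2 * (r' * r'))) <= 6 * s / r ^ 2).
  { apply Rle_trans with (1.2 * r' * (s * (2.5 * r)) / (r ^ 2 * (r' * r'))).
    - apply Rabs_div_le; [|split; [apply Rmult_lt_0_compat; nra|lra]]. rewrite !Rabs_mult.
      apply Rmult_le_compat; auto using Rabs_pos; [apply Rmult_le_pos; apply Rabs_pos|].
      apply Rmult_le_compat; auto using Rabs_pos; [apply Rabs_le|rewrite Rabs_pos_eq]; lra.
    - replace (1.2 * r' * (s * (2.5 * r)) / (r ^ 2 * (r' * r'))) with (1.2 * 2.5 * s * (r / r') / r ^ 2)
        by (field; lra).
      unfold Rdiv at 1 3. apply Rmult_le_compat_r; [lra|].
      assert (r / r' <= 2) by (apply Rle_div_l; lra). nra. }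
  pose proof log_rate_bounds. rewrite Rabs_mult, (Rabs_pos_eq (log_rate / 2)) by lra.
  pose proof (Rabs_triang (- c / r ^ 2) (c' * ((r - r') * (r + r')) / (r ^ 2 * (r' * r')))).
  rewrite <- (Rmult_1_l (10 * s / r ^ 2)). apply Rmult_le_compat; try lra; [apply Rabs_pos|].
  unfold Rdiv in *. assert (0 <= s * / r ^ 2) by (apply Rmult_le_pos; lra). lra.
Qed.

Lemma rigid_strain_decays T sg sx sy : acts_rigidly T sg sx sy ->
  decays 2 (fun i p => strain (fun p => yhat (T p)) i p - ref_strain i p).
Proof.
  intros rigid. set (s := sqrt (hexnorm sx sy)). assert (s_nonneg : 0 <= s) by apply sqrt_pos.
  destruct (INR_unbounded (20 * s + 20)) as (K & K_large).
  apply (decays_of_far 2 K _ (16 * (10 * s + 9))). intros i p far. assert (far_8 : 8 <= weight p) by lra.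
  pose proof (weight_le_mid_radius i p). destruct (mid_radius_far i p far_8) as (_ & _ & N_ge).
  pose proof (sqrt_hexnorm_triangle (mid_x i p - sx) (mid_y i p - sy) sx sy) as triangle.
  replace (mid_x i p - sx + sx) with (mid_x i p) in triangle by ring.
  replace (mid_y i p - sy + sy) with (mid_y i p) in triangle by ring. fold s (mid_radius i p) in triangle.
  set (r := mid_radius i p) in *. set (r' := sqrt (hexnorm (mid_x i p - sx) (mid_y i p - sy))) in *.
  assert (N'_ge : 1 <= hexnorm (mid_x i p - sx) (mid_y i p - sy)).
  { rewrite <- (sqrt_sqrt (hexnorm _ _)) by apply hexnorm_nonneg. fold r'. nra. }
  rewrite (strain_rigid T sg sx sy), ref_strain_noncore by (auto using noncore_far || lra).
  pose proof (bond_angle_far i _ _ N'_ge) as angle'_err. fold r' in angle'_err.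
  pose proof (bond_angle_far i (mid_x i p) (mid_y i p) ltac:(lra)) as angle_err.
  pose proof (far_field_shift i (mid_x i p) (mid_y i p) sx sy) as far_err. cbv zeta in far_err.
  fold s (mid_radius i p) in far_err, angle_err. fold r in far_err, angle_err.
  assert (inv_r' : / r' ^ 3 <= 8 * / r ^ 2).
  { replace (8 * / r ^ 2) with (/ (r ^ 2 / 8)) by (field; lra). apply Rinv_le_contravar; [nra|].
    apply Rle_trans with ((r / 2) ^ 3); [simpl; nra|]. apply pow_incr. lra. }
  assert (inv_r : / r ^ 3 <= / r ^ 2) by (apply Rinv_le_contravar; [nra|simpl; nra]).
  pose proof (inv_mid_radius_pow_le i p 2 far_8) as inv_le. fold r in inv_le.
  set (angle' := bond_angle i (mid_x i p - sx) (mid_y i p - sy)) in *.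
  set (angle := bond_angle i (mid_x i p) (mid_y i p)) in *.
  set (value' := far_field i (mid_x i p - sx) (mid_y i p - sy)) in *.
  set (value := far_field i (mid_x i p) (mid_y i p)) in *.
  replace (angle' - angle) with ((angle' - value') + ((value' - value) + - (angle - value))) by ring.
  eapply Rle_trans; [apply Rabs_triang|]. pose proof (Rabs_triang (value' - value) (- (angle - value))) as triangle'.
  rewrite Rabs_Ropp in triangle'. apply Rle_trans with ((10 * s + 9) * / r ^ 2); [unfold Rdiv in *; lra|].
  replace (4 ^ 2) with 16 in inv_le by ring. unfold Rdiv in *. nra.
Qed.

(** * The renormalised energy *)

Lemma strain_gap_sqr_decays : decays 4 (fun i p => (ref_strain i p - log_field i p) ^ 2).
Proof.
  apply (decays_weaken 4 6); [lia|].
  apply (decays_ext 6 (fun i p => (ref_strain i p - log_field i p) * (ref_strain i p - log_field i p)));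
    [intros; ring|].
  apply (decays_mul 3 3); apply ref_strain_minus_log_field_decays.
Qed.

Lemma strain_gap_mul_log_field_decays : decays 4 (fun i p => (ref_strain i p - log_field i p) * log_field i p).
Proof.
  apply (decays_mul 3 1 (fun i p => ref_strain i p - log_field i p));
    [apply ref_strain_minus_log_field_decays|apply log_field_decays].
Qed.

Lemma ref_strain_sqr_decays : decays 2 (fun i p => ref_strain i p ^ 2).
Proof.
  apply (decays_ext 2 (fun i p => ref_strain i p * ref_strain i p)); [intros; ring|].
  apply (decays_mul 1 1); apply ref_strain_decays.
Qed.

Lemma ref_strain_pow4_decays : decays 4 (fun i p => ref_strain i p ^ 4).
Proof.
  apply (decays_ext 4 (fun i p => ref_strain i p ^ 2 * ref_strain i p ^ 2)); [intros; ring|].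
  apply (decays_mul 2 2); apply ref_strain_sqr_decays.
Qed.

(* Subtracting the term with log_field removes the part of the first variation that is not in l2; it does
   not change the sum over the bonds of a gradient, because log_field is a rotated gradient. *)
Definition energy_density (psi : R -> R) (i : dir) (p : site) (t : R) : R :=
  psi (ref_strain i p + t) - psi (ref_strain i p) - Derive_n psi 2 0 * log_field i p * t.

Definition energy (psi : R -> R) (b : field) : R :=
  field_sum (fun i p => energy_density psi i p (b i p)).

Lemma energy_ext psi a b : (forall i p, a i p = b i p) -> energy psi a = energy psi b.
Proof. intros a_eq_b. apply field_sum_ext. intros i p. now rewrite a_eq_b. Qed.

Section EnergyDensity.

Variable psi : R -> R.
Hypothesis psi_ok : psi_hyp psi.
Local Notation mu := (Derive_n psi 2 0).

Lemma energy_density_split i p t :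
  energy_density psi i p t =
    (psi (ref_strain i p + t) - / 2 * mu * (ref_strain i p + t) ^ 2)
    - (psi (ref_strain i p) - / 2 * mu * ref_strain i p ^ 2)
    + / 2 * mu * t ^ 2 + mu * (ref_strain i p - log_field i p) * t.
Proof. unfold energy_density. field. Qed.

Lemma Rabs_energy_density_le_small : exists C, 0 < C /\
  forall i p t, Rabs t <= 1 -> Rabs (energy_density psi i p t) <= C * (t ^ 2 + / weight p ^ 4).
Proof.
  pose proof (mu_pos psi psi_ok) as mu_pos. destruct (psi_quartic psi psi_ok) as (C4 & C4_pos & quartic).
  destruct ref_strain_pow4_decays as (Ca & Ca_pos & strain_le).
  destruct strain_gap_sqr_decays as (Cg & Cg_pos & gap_le).
  assert (0 < C4 * Ca) by now apply Rmult_lt_0_compat. assert (0 < mu * Cg) by now apply Rmult_lt_0_compat.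
  set (X := 9 * (C4 * Ca) + mu * Cg). set (Y := 8 * C4 + 2 * mu). exists (X + Y). split; [unfold X, Y; lra|].
  intros i p t t_le. specialize (strain_le i p). specialize (gap_le i p).
  pose proof (inv_weight_pow_pos p 4) as v_pos. unfold Rdiv in *. set (v := / weight p ^ 4) in *.
  apply Rle_trans with (X * v + Y * t ^ 2).
  2:{ assert (0 <= X * t ^ 2) by (apply Rmult_le_pos; [unfold X; lra|apply pow2_ge_0]).
      assert (0 <= Y * v) by (apply Rmult_le_pos; [unfold Y|]; lra). lra. }
  rewrite energy_density_split. set (alpha := ref_strain i p) in *. set (gap := alpha - log_field i p) in *.
  apply Rabs_le_between in strain_le, gap_le. apply pow2_le_of_Rabs_le in t_le. rewrite pow1 in t_le.
  assert (t4_le : t ^ 4 <= t ^ 2) by (pose proof (pow2_ge_0 t); replace (t ^ 4) with (t ^ 2 * t ^ 2) by ring; nra).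
  assert (sum4_le : (alpha + t) ^ 4 <= 8 * (alpha ^ 4 + t ^ 4)).
  { pose proof (pow2_ge_0 (alpha - t)). pose proof (pow2_ge_0 (alpha + t)).
    replace ((alpha + t) ^ 4) with ((alpha + t) ^ 2 * (alpha + t) ^ 2) by ring.
    apply Rle_trans with (2 * (alpha ^ 2 + t ^ 2) * (2 * (alpha ^ 2 + t ^ 2))); [apply Rmult_le_compat|]; nra. }
  assert (cross_le : - (gap ^ 2 + t ^ 2) <= gap * t <= gap ^ 2 + t ^ 2) by nra.
  pose proof (quartic (alpha + t)) as shifted_err. pose proof (quartic alpha) as ref_err.
  apply Rabs_le_between in shifted_err, ref_err.
  assert (C4 * (alpha + t) ^ 4 <= C4 * (8 * (Ca * v + t ^ 2))) by (apply Rmult_le_compat_l; lra).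
  assert (C4 * alpha ^ 4 <= C4 * (Ca * v)) by (apply Rmult_le_compat_l; lra).
  assert (cross_mu : - (mu * (Cg * v + t ^ 2)) <= mu * (gap * t) <= mu * (Cg * v + t ^ 2)) by (split; nra).
  assert (0 <= mu * t ^ 2) by (apply Rmult_le_pos; [lra|apply pow2_ge_0]).
  rewrite (Rmult_assoc mu gap t). apply Rabs_le. unfold X, Y. lra.
Qed.

Lemma Rabs_energy_density_le_large : exists C, 0 < C /\
  forall i p t, 1 <= Rabs t -> Rabs (energy_density psi i p t) <= C * t ^ 2.
Proof.
  pose proof (mu_pos psi psi_ok) as mu_pos. destruct (psi_bounded psi psi_ok) as (M & M_pos & psi_le).
  destruct log_field_decays as (Cb & Cb_pos & log_le). exists (M + mu * Cb). split; [nra|]. intros i p t t_ge.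
  assert (t_le_sqr : Rabs t <= t ^ 2) by (rewrite <- pow2_abs; nra).
  assert (psi_diff : Rabs (psi (ref_strain i p + t) - psi (ref_strain i p)) <= M).
  { pose proof (psi_le (ref_strain i p + t)). pose proof (psi_le (ref_strain i p)).
    pose proof (psi_nonneg psi psi_ok (ref_strain i p + t)). pose proof (psi_nonneg psi psi_ok (ref_strain i p)).
    apply Rabs_le; lra. }
  assert (linear_le : Rabs (mu * log_field i p * t) <= mu * Cb * t ^ 2).
  { rewrite !Rabs_mult, (Rabs_pos_eq mu), !Rmult_assoc by lra. apply Rmult_le_compat_l; [lra|].
    apply Rmult_le_compat; auto using Rabs_pos. eapply Rle_trans; [apply log_le|].
    rewrite pow_1. pose proof (inv_weight_bounds p). unfold Rdiv. nra. }
  unfold energy_density.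
  pose proof (Rabs_triang (psi (ref_strain i p + t) - psi (ref_strain i p)) (- (mu * log_field i p * t))) as triangle.
  rewrite Rabs_Ropp in triangle. unfold Rminus at 1. nra.
Qed.

Lemma Rabs_energy_density_le : exists C, 0 < C /\
  forall i p t, Rabs (energy_density psi i p t) <= C * (t ^ 2 + / weight p ^ 4).
Proof.
  destruct Rabs_energy_density_le_small as (C1 & C1_pos & small).
  destruct Rabs_energy_density_le_large as (C2 & C2_pos & large).
  exists (C1 + C2). split; [lra|]. intros i p t.
  pose proof (inv_weight_pow_pos p 4).
  destruct (Rle_dec (Rabs t) 1) as [t_le|t_gt].
  - specialize (small i p t t_le). nra.
  - specialize (large i p t ltac:(lra)). nra.
Qed.

(* On wrapped strains psi >= mu/2 (.)^2 makes the density quadratic from below. *)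
Lemma energy_density_ge_wrapped : exists C, 0 < C /\ forall i p t, Rabs (ref_strain i p + t) <= / 2 ->
  / 2 * mu * t ^ 2 + mu * (ref_strain i p - log_field i p) * t - C * / weight p ^ 4 <= energy_density psi i p t.
Proof.
  destruct (psi_quartic psi psi_ok) as (C4 & C4_pos & quartic).
  destruct ref_strain_pow4_decays as (Ca & Ca_pos & strain_le).
  exists (C4 * Ca). split; [now apply Rmult_lt_0_compat|]. intros i p t wrapped. rewrite energy_density_split.
  pose proof (psi_ge_quadratic psi psi_ok _ wrapped). pose proof (quartic (ref_strain i p)) as ref_err.
  specialize (strain_le i p). apply Rabs_le_between in ref_err, strain_le. unfold Rdiv in *. nra.
Qed.

Lemma energy_density_ge_unwrapped : exists C, 0 < C /\ forall i p t, / 2 <= Rabs (ref_strain i p + t) ->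
  - (C * / weight p * t ^ 2) <= energy_density psi i p t.
Proof.
  pose proof (mu_pos psi psi_ok) as mu_pos. destruct (psi_le_quadratic psi psi_ok) as (Cq & Cq_pos & quadratic).
  destruct ref_strain_sqr_decays as (Ca & Ca_pos & strain_le). destruct log_field_decays as (Cb & Cb_pos & log_le).
  assert (0 < Cq * Ca) by now apply Rmult_lt_0_compat. assert (0 < mu * Cb) by now apply Rmult_lt_0_compat.
  exists (36 * (Cq * Ca) + 6 * (mu * Cb)). split; [lra|]. intros i p t unwrapped.
  pose proof (Rabs_ref_strain_le i p) as strain_small. pose proof (inv_weight_bounds p) as v_bounds.
  pose proof (psi_nonneg psi psi_ok (ref_strain i p + t)). unfold energy_density.
  assert (t_ge : / 6 <= Rabs t) by (pose proof (Rabs_triang (ref_strain i p) t); lra).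
  assert (t_le_sqr : Rabs t <= 6 * t ^ 2) by (rewrite <- pow2_abs; nra).
  assert (one_le : 1 <= 36 * t ^ 2) by (rewrite <- pow2_abs; nra).
  specialize (quadratic (ref_strain i p) ltac:(lra)). specialize (strain_le i p). specialize (log_le i p).
  apply Rabs_le_between in strain_le. rewrite pow_1 in log_le. unfold Rdiv in *. rewrite <- pow_inv in strain_le.
  set (v := / weight p) in *.
  assert (psi_ref_le : psi (ref_strain i p) <= 36 * (Cq * Ca) * v * t ^ 2).
  { apply Rle_trans with (Cq * Ca * v); [|assert (0 <= Cq * Ca * v) by (apply Rmult_le_pos; lra); nra].
    eapply Rle_trans; [exact quadratic|]. rewrite Rmult_assoc. apply Rmult_le_compat_l; [lra|].
    eapply Rle_trans; [apply strain_le|]. apply Rmult_le_compat_l; [lra|]. nra. }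
  assert (linear_le : Rabs (mu * log_field i p * t) <= 6 * (mu * Cb) * v * t ^ 2).
  { rewrite !Rabs_mult, (Rabs_pos_eq mu) by lra.
    replace (6 * (mu * Cb) * v * t ^ 2) with (mu * (Cb * v) * (6 * t ^ 2)) by ring.
    apply Rmult_le_compat; auto using Rabs_pos; [apply Rmult_le_pos; [lra|apply Rabs_pos]|].
    apply Rmult_le_compat_l; lra. }
  apply Rabs_le_between in linear_le. lra.
Qed.

Lemma energy_density_ge : exists C, 0 < C /\
  forall i p t, - (C * / weight p ^ 4) - C * / weight p * t ^ 2 <= energy_density psi i p t.
Proof.
  pose proof (mu_pos psi psi_ok) as mu_pos. destruct energy_density_ge_wrapped as (C1 & C1_pos & wrapped_ge).
  destruct energy_density_ge_unwrapped as (C2 & C2_pos & unwrapped_ge).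
  destruct strain_gap_sqr_decays as (Cg & Cg_pos & gap_le). assert (0 < mu * Cg) by now apply Rmult_lt_0_compat.
  exists (C1 + mu * Cg + C2). split; [lra|]. intros i p t.
  pose proof (inv_weight_bounds p). pose proof (inv_weight_pow_pos p 4). pose proof (pow2_ge_0 t).
  assert (0 <= / weight p * t ^ 2) by (apply Rmult_le_pos; lra).
  destruct (Rle_dec (Rabs (ref_strain i p + t)) (/ 2)) as [wrapped|unwrapped].
  - specialize (wrapped_ge i p t wrapped). specialize (gap_le i p). apply Rabs_le_between in gap_le. unfold Rdiv in *.
    set (gap := ref_strain i p - log_field i p) in *.
    assert (0 <= mu * (gap + t) ^ 2) by (apply Rmult_le_pos; [lra|apply pow2_ge_0]).
    assert (mu * gap ^ 2 <= mu * (Cg * / weight p ^ 4)) by (apply Rmult_le_compat_l; lra).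
    assert (0 <= mu * gap ^ 2) by (apply Rmult_le_pos; [lra|apply pow2_ge_0]). nra.
  - specialize (unwrapped_ge i p t ltac:(lra)). nra.
Qed.

Lemma energy_density_summable b :
  field_summable (field_sqr b) -> field_summable (fun i p => energy_density psi i p (b i p)).
Proof.
  intros summable_b. destruct Rabs_energy_density_le as (C & _ & density_le).
  apply (field_summable_le _ (fun i p => C * (field_sqr b i p + / weight p ^ 4))); [intros; apply density_le|].
  apply field_summable_scal, field_summable_plus; auto using field_summable_inv_weight4.
Qed.

Lemma Rabs_energy_le : exists C, forall b K, l2_bounded b K -> Rabs (energy psi b) <= C * (K + 27).
Proof.
  destruct Rabs_energy_density_le as (C & C_pos & density_le). exists C. intros b K bounded.
  pose proof (field_sqr_summable b K bounded) as summable_b. pose proof (energy_density_summable b summable_b).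
  pose proof field_summable_inv_weight4 as summable_w.
  eapply Rle_trans; [now apply Rabs_field_sum_le|].
  eapply Rle_trans; [apply (field_sum_le _ (fun i p => C * (field_sqr b i p + / weight p ^ 4)))|].
  - now apply field_summable_abs.
  - now apply field_summable_scal, field_summable_plus.
  - intros; apply density_le.
  - rewrite field_sum_scal, field_sum_plus by (auto; now apply field_summable_plus).
    apply Rmult_le_compat_l; [lra|]. pose proof (field_sum_sqr_le b K bounded).
    pose proof (field_sum_inv_weight4_le 1 ltac:(lra)) as w_sum.
    rewrite field_sum_scal in w_sum by auto. lra.
Qed.

Lemma energy_density_continuous i p t eps : 0 < eps ->
  exists delta, 0 < delta /\ forall s, Rabs (s - t) <= delta ->
    Rabs (energy_density psi i p s - energy_density psi i p t) <= eps.
Proof.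
  intros eps_pos.
  assert (cont : continuous (energy_density psi i p) t).
  { unfold energy_density.
    apply (continuous_minus (fun t => psi (ref_strain i p + t) - psi (ref_strain i p))
      (fun t => mu * log_field i p * t)).
    - apply (continuous_minus (fun t => psi (ref_strain i p + t)) (fun _ => psi (ref_strain i p)));
        [|apply continuous_const].
      apply (continuous_comp (fun t => ref_strain i p + t) psi); [|now apply psi_continuous].
      apply (continuous_plus (fun _ => ref_strain i p) (fun t => t)); [apply continuous_const|apply continuous_id].
    - apply (continuous_mult (fun _ => mu * log_field i p) (fun t => t));
        [apply continuous_const|apply continuous_id]. }
  assert (near : locally (energy_density psi i p t) (fun y => Rabs (y - energy_density psi i p t) < eps))
    by (exists (mkposreal eps eps_pos); intros y y_near; exact y_near).
  destruct (cont _ near) as (d & close). exists (d / 2). pose proof (cond_pos d). split; [lra|].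
  intros s s_near. left. apply close. change (Rabs (s - t) < d). lra.
Qed.

Lemma cell_energy_continuous (d : field) p eps : 0 < eps ->
  exists delta, 0 < delta /\ forall b : field, (forall i, Rabs (b i p - d i p) <= delta) ->
    cell_sum (field_abs (fun i p => energy_density psi i p (b i p) - energy_density psi i p (d i p))) p <= eps.
Proof.
  intros eps_pos.
  assert (eps / 3 > 0) as third_pos by lra.
  destruct (energy_density_continuous East p (d East p) (eps / 3) third_pos) as (e1 & e1_pos & close_E).
  destruct (energy_density_continuous NorthEast p (d NorthEast p) (eps / 3) third_pos) as (e2 & e2_pos & close_NE).
  destruct (energy_density_continuous NorthWest p (d NorthWest p) (eps / 3) third_pos) as (e3 & e3_pos & close_NW).
  exists (Rmin e1 (Rmin e2 e3)). split; [repeat apply Rmin_pos; auto|]. intros b b_near.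
  assert (bonds_near : forall i,
    Rabs (b i p - d i p) <= e1 /\ Rabs (b i p - d i p) <= e2 /\ Rabs (b i p - d i p) <= e3).
  { intros i. specialize (b_near i). pose proof (Rmin_l e1 (Rmin e2 e3)). pose proof (Rmin_r e1 (Rmin e2 e3)).
    pose proof (Rmin_l e2 e3). pose proof (Rmin_r e2 e3). lra. }
  unfold cell_sum, field_abs.
  specialize (close_E (b East p) (proj1 (bonds_near East))).
  specialize (close_NE (b NorthEast p) (proj1 (proj2 (bonds_near NorthEast)))).
  specialize (close_NW (b NorthWest p) (proj2 (proj2 (bonds_near NorthWest)))). lra.
Qed.

Lemma finite_energy_continuous (d : field) l : forall eps, 0 < eps ->
  exists delta, 0 < delta /\ forall b : field, (forall i p, In p l -> Rabs (b i p - d i p) <= delta) ->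
    lsum (cell_sum (field_abs (fun i p => energy_density psi i p (b i p) - energy_density psi i p (d i p)))) l <= eps.
Proof.
  induction l as [|p l IH]; intros eps eps_pos.
  - exists 1. split; [lra|]. intros; simpl; lra.
  - destruct (IH (eps / 2)) as (e1 & e1_pos & tail_close); [lra|].
    destruct (cell_energy_continuous d p (eps / 2)) as (e2 & e2_pos & cell_close); [lra|].
    exists (Rmin e1 e2). split; [now apply Rmin_pos|]. intros b b_near. cbn [lsum].
    assert (cell_sum (field_abs (fun i p => energy_density psi i p (b i p) - energy_density psi i p (d i p))) p <=
      eps / 2).
    { apply cell_close. intros i. eapply Rle_trans; [apply b_near; now left|apply Rmin_r]. }
    assert (lsum (cell_sum (field_abs (fun i p => energy_density psi i p (b i p) - energy_density psi i p (d i p)))) l <=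
      eps / 2);
      [|lra].
    apply tail_close. intros i q q_in. eapply Rle_trans; [apply b_near; now right|apply Rmin_l].
Qed.

Lemma Rabs_energy_density_diff_le : exists C, 0 < C /\ forall i p s t,
  Rabs (energy_density psi i p s - energy_density psi i p t) <= C * ((s - t) ^ 2 + (t ^ 2 + / weight p ^ 4)).
Proof.
  destruct Rabs_energy_density_le as (C & C_pos & density_le). exists (3 * C). split; [lra|]. intros i p s t.
  pose proof (density_le i p s). pose proof (density_le i p t). pose proof (inv_weight_pow_pos p 4).
  assert (s ^ 2 <= 2 * (s - t) ^ 2 + 2 * t ^ 2) by (pose proof (pow2_ge_0 (s - 2 * t)); nra).
  pose proof (pow2_ge_0 (s - t)).
  eapply Rle_trans; [apply Rabs_triang|]. rewrite Rabs_Ropp. nra.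
Qed.

Lemma energy_continuous (d : field) eps : field_summable (field_sqr d) -> 0 < eps ->
  exists delta, 0 < delta /\ forall b, field_summable (field_sqr b) ->
    l2_bounded (fun i p => b i p - d i p) delta -> Rabs (energy psi b - energy psi d) <= eps.
Proof.
  intros summable_d eps_pos. destruct Rabs_energy_density_diff_le as (C & C_pos & diff_le).
  set (e := eps / (4 * C)). assert (e_pos : 0 < e) by (unfold e; apply Rdiv_lt_0_compat; lra).
  destruct (tsum_tail (cell_sum (fun i p => field_sqr d i p + / weight p ^ 4)) e) as (l0 & nodup_l0 & tail_le); auto.
  { apply summable_cell_sum, field_summable_plus; auto using field_summable_inv_weight4. }
  destruct (finite_energy_continuous d l0 (eps / 2)) as (r & r_pos & near_close); [lra|].
  exists (Rmin e (r ^ 2)). split; [apply Rmin_pos; auto; now apply pow_lt|]. intros b summable_b small.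
  pose proof (energy_density_summable b summable_b). pose proof (energy_density_summable d summable_d).
  unfold energy. rewrite <- field_sum_minus by auto.
  set (diff := fun i p => energy_density psi i p (b i p) - energy_density psi i p (d i p)) in *.
  apply Rabs_tsum_le_bound; [now apply summable_cell_sum, field_summable_minus|]. intros l nodup_l.
  eapply Rle_trans; [apply Rabs_lsum_le|].
  eapply Rle_trans; [apply (lsum_le _ (cell_sum (field_abs diff))); intros; apply Rabs_cell_sum_le|].
  rewrite (lsum_select_split (fun p => In p l0)).
  assert (near_part : lsum (cell_sum (field_abs diff)) (select (fun p => In p l0) l) <= eps / 2).
  { apply Rle_trans with (lsum (cell_sum (field_abs diff)) l0).
    - apply lsum_incl_le; auto using NoDup_select; [intros p p_in; apply in_select in p_in; tauto|].
      intros. apply cell_sum_nonneg. intros. apply Rabs_pos.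
    - apply near_close. intros i p _. apply Rsqr_incr_0_var; [|lra]. unfold Rsqr.
      pose proof (l2_bounded_sqr_le _ _ i p small) as sqr_le. cbv beta in sqr_le. rewrite <- pow2_abs in sqr_le.
      pose proof (Rmin_r e (r ^ 2)). simpl in *. lra. }
  assert (far_part : lsum (cell_sum (field_abs diff)) (select (fun p => ~ In p l0) l) <= C * (e + e)).
  { assert (nodup_far : NoDup (select (fun p => ~ In p l0) l)) by now apply NoDup_select.
    eapply Rle_trans; [apply (lsum_cell_sum_le _ (fun i p => C * (field_sqr (fun i p => b i p - d i p) i p
      + (field_sqr d i p + / weight p ^ 4)))); intros; apply diff_le|].
    rewrite lsum_cell_sum_scal, (lsum_cell_sum_plus (field_sqr (fun i p => b i p - d i p))).
    apply Rmult_le_compat_l; [lra|]. apply Rplus_le_compat.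
    - eapply Rle_trans; [now apply small|apply Rmin_l].
    - eapply Rle_trans; [|apply (tail_le _ nodup_far); intros p p_in; now apply in_select in p_in].
      apply lsum_le. intros; apply Rle_abs. }
  replace (C * (e + e)) with (eps / 2) in far_part by (unfold e; field; lra). lra.
Qed.

End EnergyDensity.

(** * Ordered bonds and the energy of compactly supported displacements *)

Definition ordered_bonds (p : site) : list (site * site) :=
  flat_map (fun i => [(source i p, target i p); (target i p, source i p)]) [East; NorthEast; NorthWest].

Definition ordered_bonds_over (l : list site) : list (site * site) := flat_map ordered_bonds l.

Lemma vsub_pos p q : vsub (pos p) (pos q) = hexvec (IZR (fst p - fst q)) (IZR (snd p - snd q)).
Proof. rewrite !pos_hexvec. unfold vsub, hexvec, site_x, site_y; simpl. rewrite !minus_IZR. f_equal; field. Qed.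

Lemma bond_iff_hexnormZ p q : bond p q <-> hexnormZ (fst p - fst q) (snd p - snd q) = 1%Z.
Proof.
  unfold bond. rewrite vsub_pos, vnorm_hexvec, <- IZR_hexnormZ. split.
  - intros norm_1. apply eq_IZR. rewrite <- (sqrt_sqrt (IZR _)) by (apply IZR_le, hexnormZ_nonneg).
    rewrite norm_1. lra.
  - intros ->. apply sqrt_1.
Qed.

Lemma bond_source_target i p : bond (source i p) (target i p) /\ bond (target i p) (source i p).
Proof.
  rewrite !bond_iff_hexnormZ. destruct p as [a b]. unfold hexnormZ.
  destruct i; unfold source, target, shift; simpl fst; simpl snd; split; ring_simplify; lia.
Qed.

Lemma in_ordered_bonds p q r : In (q, r) (ordered_bonds p) <->
  exists i, q = source i p /\ r = target i p \/ q = target i p /\ r = source i p.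
Proof.
  unfold ordered_bonds. rewrite in_flat_map. split.
  - intros (i & _ & [[= <- <-]|[[= <- <-]|[]]]); exists i; auto.
  - intros (i & in_cell). exists i. split; [destruct i; simpl; auto|].
    destruct in_cell as [(-> & ->)|(-> & ->)]; simpl; auto.
Qed.

Lemma in_ordered_bonds_over l q r : In (q, r) (ordered_bonds_over l) <->
  exists i p, In p l /\ (q = source i p /\ r = target i p \/ q = target i p /\ r = source i p).
Proof.
  unfold ordered_bonds_over. rewrite in_flat_map. split.
  - intros (p & p_in & in_cell). apply in_ordered_bonds in in_cell. destruct in_cell as (i & in_cell). eauto.
  - intros (i & p & p_in & in_cell). exists p. split; auto. apply in_ordered_bonds. eauto.
Qed.

Lemma hexnormZ_1_cases x y : hexnormZ x y = 1%Z ->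
  (x = 0 /\ (y = 1 \/ y = -1) \/ x = 1 /\ (y = 0 \/ y = -1) \/ x = -1 /\ (y = 0 \/ y = 1))%Z.
Proof.
  unfold hexnormZ. intros norm_1.
  assert (x_small : (-2 < x < 2)%Z).
  { pose proof (Z.square_nonneg (x + 2 * y)). nia. }
  assert (y_small : (-2 < y < 2)%Z).
  { pose proof (Z.square_nonneg (2 * x + y)). nia. }
  assert (x = -1 \/ x = 0 \/ x = 1)%Z as [->|[->| ->]] by lia;
    assert (y = -1 \/ y = 0 \/ y = 1)%Z as [->|[->| ->]] by lia; lia.
Qed.

Lemma bond_in_some_cell p q : bond p q -> exists r, In (p, q) (ordered_bonds r).
Proof.
  rewrite bond_iff_hexnormZ. intros norm_1. apply hexnormZ_1_cases in norm_1. destruct p as [a b], q as [c d].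
  cbn [fst snd] in norm_1. setoid_rewrite in_ordered_bonds. unfold source, target, shift; cbn [fst snd].
  destruct norm_1 as [(x_eq & [y_eq|y_eq])|[(x_eq & [y_eq|y_eq])|(x_eq & [y_eq|y_eq])]].
  - exists (c, d), NorthEast. right. simpl. split; f_equal; lia.
  - exists (a, b), NorthEast. left. simpl. split; f_equal; lia.
  - exists (c, d), East. right. simpl. split; f_equal; lia.
  - exists (c, b), NorthWest. left. simpl. split; f_equal; lia.
  - exists (a, b), East. left. simpl. split; f_equal; lia.
  - exists (a, d), NorthWest. right. simpl. split; f_equal; lia.
Qed.

Lemma NoDup_flat_map {A B} (f : A -> list B) l : NoDup l -> (forall a, NoDup (f a)) ->
  (forall a a' b, In b (f a) -> In b (f a') -> a = a') -> NoDup (flat_map f l).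
Proof.
  intros nodup_l nodup_f disjoint. induction nodup_l as [|a l a_notin _ IH]; simpl; [constructor|].
  apply NoDup_app; auto. intros b b_in b_in'. apply in_flat_map in b_in'. destruct b_in' as (a' & a'_in & b_in').
  rewrite (disjoint a a' b) in a_notin by auto. contradiction.
Qed.

Lemma NoDup_ordered_bonds p : NoDup (ordered_bonds p).
Proof.
  destruct p as [a b]. unfold ordered_bonds, source, target, shift; simpl.
  repeat constructor; simpl; intuition;
    repeat match goal with eq : (_, _) = (_, _) |- _ => injection eq; clear eq; intros end; lia.
Qed.

Lemma ordered_bonds_cell_unique p p' b : In b (ordered_bonds p) -> In b (ordered_bonds p') -> p = p'.
Proof.
  destruct p as [a1 b1], p' as [a2 b2], b as [q r]. rewrite !in_ordered_bonds.
  intros (i & [(-> & ->)|(-> & ->)]) (j & [(eq & eq')|(eq & eq')]); destruct i, j;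
    unfold source, target, shift in eq, eq'; simpl in eq, eq';
    injection eq; injection eq'; intros; f_equal; lia.
Qed.

Lemma bond_list_ordered_bonds_over l : NoDup l -> bond_list (ordered_bonds_over l).
Proof.
  intros nodup_l. split.
  - apply NoDup_flat_map; auto using NoDup_ordered_bonds. exact ordered_bonds_cell_unique.
  - apply Forall_forall. intros [q r] b_in. apply in_ordered_bonds_over in b_in.
    destruct b_in as (i & p & _ & [(-> & ->)|(-> & ->)]); apply bond_source_target.
Qed.

Lemma incl_ordered_bonds_over l l' : incl l l' -> incl (ordered_bonds_over l) (ordered_bonds_over l').
Proof.
  intros l_in_l' b b_in. apply in_flat_map in b_in. apply in_flat_map. destruct b_in as (p & p_in & b_in). eauto.
Qed.

Lemma bond_list_incl_box l : bond_list l -> exists N, forall M, (N <= M)%nat -> incl l (ordered_bonds_over (box M)).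
Proof.
  intros (_ & bonds). rewrite Forall_forall in bonds.
  assert (in_cells : exists L, incl l (ordered_bonds_over L)).
  { induction l as [|[p q] l IH]; [exists nil; apply incl_refl|].
    destruct IH as (L & l_in); [intros; apply bonds; now right|].
    destruct (bond_in_some_cell p q) as (r & in_r); [apply (bonds (p, q)); now left|].
    exists (r :: L). apply incl_cons; [apply in_app_iff; now left|].
    eapply incl_tran; [exact l_in|]. apply incl_ordered_bonds_over, incl_tl, incl_refl. }
  destruct in_cells as (L & l_in). destruct (incl_some_box L) as (N & L_in). exists N. intros M N_le_M.
  eapply incl_tran; [exact l_in|]. apply incl_ordered_bonds_over. eapply incl_tran; [exact L_in|]. now apply incl_box.
Qed.

Lemma sum_list_lsum f l : sum_list f l = lsum (fun b => f (fst b) (snd b)) l.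
Proof. induction l as [|b l IH]; simpl; [reflexivity|]. now rewrite IH. Qed.

Lemma sumsq_lsum g l : sumsq g l = lsum (fun b => g (fst b) (snd b) ^ 2) l.
Proof. induction l as [|b l IH]; [reflexivity|]. cbn [sumsq lsum]. now rewrite IH. Qed.

Lemma lsum_ordered_bonds_over (f : site -> site -> R) (b : field) l :
  (forall i p, f (source i p) (target i p) = b i p) -> (forall i p, f (target i p) (source i p) = b i p) ->
  lsum (fun x => f (fst x) (snd x)) (ordered_bonds_over l) = 2 * lsum (cell_sum b) l.
Proof.
  intros forward backward. unfold ordered_bonds_over. rewrite lsum_flat_map, <- lsum_scal.
  apply lsum_ext. intros p _. unfold ordered_bonds. cbn [flat_map app lsum fst snd]. rewrite !forward, !backward.
  unfold cell_sum. ring.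
Qed.

Lemma W0_supported u : W0 u -> exists N, field_supported (grad u) (box N).
Proof.
  intros (_ & r & bounded). destruct (INR_unbounded (1.2 * Rabs r + 2)) as (N & N_large). exists N.
  intros i p grad_neq_0. destruct (bounded (source i p) (target i p)) as (norm_le & _);
    [apply bond_source_target|exact grad_neq_0|].
  rewrite pos_hexvec, vnorm_hexvec, site_x_source, site_y_source in norm_le.
  destruct (Rabs_coord_le (mid_x i p - dir_x i / 2) (mid_y i p - dir_y i / 2)) as (x_le & y_le).
  pose proof (Rle_abs r).
  assert (coord_le : forall k c, -1 <= c <= 2 -> Rabs (IZR k + c) <= 1.2 * Rabs r -> (Z.abs k <= Z.of_nat N)%Z).
  { intros k c c_bounds sum_le. apply le_IZR. rewrite abs_IZR, <- INR_IZR_INZ.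
    apply Rabs_le_between in sum_le. apply Rabs_le. lra. }
  apply in_box. split.
  - apply (coord_le _ (mid_x i p - dir_x i / 2 - IZR (fst p))); [unfold mid_x, dir_x; destruct i; lra|].
    replace (IZR (fst p) + _) with (mid_x i p - dir_x i / 2) by ring. lra.
  - apply (coord_le _ (mid_y i p - dir_y i / 2 - IZR (snd p))); [unfold mid_y, dir_y; destruct i; lra|].
    replace (IZR (snd p) + _) with (mid_y i p - dir_y i / 2) by ring. lra.
Qed.

Lemma field_sum_log_field_mul_grad u l :
  field_supported (grad u) l -> field_sum (fun i p => log_field i p * grad u i p) = 0.
Proof.
  intros supp_u. unfold log_field. rewrite (summation_by_parts_field_supported log_potential (grad u) l supp_u).
  rewrite (face_sum_finite _ nil); [reflexivity|constructor|].
  intros f neq_0. exfalso. apply neq_0. rewrite curl_grad. ring.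
Qed.

Section CompactlySupported.

Variable psi : R -> R.
Hypothesis psi_ok : psi_hyp psi.
Local Notation mu := (Derive_n psi 2 0).

Definition local_energy (u : site -> R) : field :=
  fun i p => psi (ref_strain i p + grad u i p) - psi (ref_strain i p).

Lemma psi_ref_strain i p t : psi (grad yhat i p + t) = psi (ref_strain i p + t).
Proof.
  unfold ref_strain, strain. destruct (wrap_mod (grad yhat i p)) as (k & ->).
  rewrite <- (psi_add_IZR psi psi_ok (grad yhat i p - IZR k + t) k). f_equal. ring.
Qed.

Lemma bond_energy_forward u i p : bond_energy psi u (source i p) (target i p) = local_energy u i p.
Proof.
  unfold bond_energy, local_energy. change (D yhat (source i p) (target i p)) with (grad yhat i p).
  change (D u (source i p) (target i p)) with (grad u i p).
  now rewrite psi_ref_strain, <- (Rplus_0_r (grad yhat i p)), psi_ref_strain, Rplus_0_r.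
Qed.

Lemma bond_energy_backward u i p : bond_energy psi u (target i p) (source i p) = local_energy u i p.
Proof.
  rewrite <- bond_energy_forward. unfold bond_energy, D.
  rewrite <- (psi_even psi psi_ok (_ + _)), <- (psi_even psi psi_ok (_ - yhat (target i p))).
  f_equal; [|f_equal]; f_equal; ring.
Qed.

Lemma local_energy_supported u l : field_supported (grad u) l -> field_supported (local_energy u) l.
Proof. apply field_supported_sub. intros i p grad_0. unfold local_energy. rewrite grad_0, Rplus_0_r. ring. Qed.

Lemma energy_grad u l : NoDup l -> field_supported (grad u) l ->
  energy psi (grad u) = lsum (cell_sum (local_energy u)) l.
Proof.
  intros nodup_l supp_u. pose proof (local_energy_supported u l supp_u) as supp_energy.
  assert (supp_log : field_supported (fun i p => log_field i p * grad u i p) l).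
  { apply (field_supported_sub (grad u)); auto. intros i p ->. ring. }
  rewrite <- (field_sum_finite _ l nodup_l supp_energy). unfold energy.
  rewrite (field_sum_ext _ (fun i p => local_energy u i p - mu * (log_field i p * grad u i p)))
    by (intros; unfold energy_density, local_energy; ring).
  rewrite field_sum_minus, field_sum_scal, (field_sum_log_field_mul_grad u l);
    eauto using field_summable_of_support, field_summable_scal. ring.
Qed.

Lemma energy_grad_0 : energy psi (grad (fun _ => 0)) = 0.
Proof.
  rewrite (energy_grad _ nil); [reflexivity|constructor|]. intros i p neq_0. apply neq_0. unfold grad. ring.
Qed.

Lemma E0_value_energy u e : W0 u -> E0_value psi u e -> e = 2 * energy psi (grad u).
Proof.
  intros u_W0 (l & bonds & complete & ->). destruct (W0_supported u u_W0) as (N & supp_u).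
  destruct (bond_list_incl_box l bonds) as (M & l_in_box).
  set (K := (N + M)%nat). specialize (l_in_box K ltac:(lia)).
  apply (field_supported_incl _ _ (box K) (incl_box N K ltac:(lia))) in supp_u.
  rewrite (energy_grad u (box K) (NoDup_box K) supp_u), sum_list_lsum.
  rewrite <- (lsum_ordered_bonds_over (bond_energy psi u));
    [|intros; apply bond_energy_forward|intros; apply bond_energy_backward].
  destruct (bond_list_ordered_bonds_over (box K) (NoDup_box K)) as (nodup_box_bonds & all_bonds).
  apply lsum_incl_eq; auto; [apply bonds|]. intros [p q] pq_in pq_out. cbn [fst snd].
  rewrite Forall_forall in all_bonds. specialize (all_bonds _ pq_in).
  assert (D_0 : D u p q = 0) by (apply NNPP; auto). unfold bond_energy. rewrite D_0, Rplus_0_r. ring.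
Qed.

End CompactlySupported.

(* The bond field b is the restriction of the antisymmetric function g to one orientation of each bond. *)
Definition represents (g : site -> site -> R) (b : field) : Prop :=
  forall i p, g (source i p) (target i p) = b i p /\ g (target i p) (source i p) = - b i p.

Lemma represents_D u : represents (D u) (grad u).
Proof. intros i p. unfold D, grad. split; ring. Qed.

Lemma represents_minus g h a b : represents g a -> represents h b ->
  represents (fun p q => g p q - h p q) (fun i p => a i p - b i p).
Proof.
  intros g_a h_b i p. destruct (g_a i p) as (-> & ->), (h_b i p) as (-> & ->). split; ring.
Qed.

Lemma sumsq_ordered_bonds_over g b l : represents g b ->
  sumsq g (ordered_bonds_over l) = 2 * lsum (cell_sum (field_sqr b)) l.
Proof.
  intros g_b. rewrite sumsq_lsum. unfold field_sqr.
  apply (lsum_ordered_bonds_over (fun p q => g p q ^ 2)); intros i p; destruct (g_b i p) as (E1 & E2); cbv beta.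
  - now rewrite E1.
  - rewrite E2. ring.
Qed.

Lemma partial_sq_sums_le g b x : represents g b -> field_summable (field_sqr b) ->
  partial_sq_sums g x -> x <= 2 * field_sum (field_sqr b).
Proof.
  intros g_b summable_b (l & bonds & ->). destruct (bond_list_incl_box l bonds) as (N & l_in).
  apply Rle_trans with (sumsq g (ordered_bonds_over (box N))).
  - rewrite !sumsq_lsum. apply lsum_incl_le; auto; [apply bonds|apply bond_list_ordered_bonds_over, NoDup_box|].
    intros. apply pow2_ge_0.
  - rewrite (sumsq_ordered_bonds_over g b) by auto. pose proof (l2_bounded_field_sum b summable_b _ (NoDup_box N)). lra.
Qed.

Lemma l2_bounded_of_partial_sq_sums g b C : represents g b ->
  (forall x, partial_sq_sums g x -> x <= C) -> l2_bounded b (C / 2).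
Proof.
  intros g_b le_C l nodup_l. specialize (le_C (sumsq g (ordered_bonds_over l))).
  rewrite (sumsq_ordered_bonds_over g b) in le_C by auto.
  assert (2 * lsum (cell_sum (field_sqr b)) l <= C); [|lra]. apply le_C.
  exists (ordered_bonds_over l). rewrite (sumsq_ordered_bonds_over g b) by auto.
  split; auto. now apply bond_list_ordered_bonds_over.
Qed.

Lemma l2norm_field_sum g b : represents g b -> field_summable (field_sqr b) ->
  l2norm g = sqrt (2 * field_sum (field_sqr b)).
Proof.
  intros g_b summable_b. unfold l2norm. f_equal.
  rewrite (is_lub_Rbar_unique _ (2 * field_sum (field_sqr b))); [reflexivity|]. split.
  - intros x x_sum. now apply (partial_sq_sums_le g).
  - intros [C| |] ub; simpl; auto.
    + assert (bounded : l2_bounded b (C / 2)) by (apply (l2_bounded_of_partial_sq_sums g); auto).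
      apply field_sum_sqr_le in bounded. lra.
    + apply (ub 0). exists nil. split; [split; constructor|reflexivity].
Qed.

Lemma W12_iff_summable u : W12 u <-> u xi0 = 0 /\ field_summable (field_sqr (grad u)).
Proof.
  pose proof (represents_D u) as D_grad. split; intros (u_0 & l2).
  - destruct l2 as (C & le_C). split; auto.
    eapply field_sqr_summable, (l2_bounded_of_partial_sq_sums (D u)); eauto.
  - split; auto. eexists. intros x. now apply (partial_sq_sums_le (D u) (grad u)).
Qed.

Lemma W0_summable u : W0 u -> field_summable (field_sqr (grad u)).
Proof.
  intros u_W0. destruct (W0_supported u u_W0) as (N & supp_u).
  destruct (l2_bounded_supported _ _ supp_u) as (C & bounded). now apply (field_sqr_summable _ C).
Qed.

(** * Sums over boundary layers *)

Lemma div_sqrt_small C eps : 0 < eps ->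
  exists K0, (1 <= K0)%nat /\ forall K, (K0 <= K)%nat -> C / sqrt (INR K) <= eps.
Proof.
  intros eps_pos. destruct (INR_unbounded (1 + (C / eps) ^ 2)) as (K0 & K0_large). exists (S K0). split; [lia|].
  intros K K0_le. apply le_INR in K0_le. rewrite S_INR in K0_le. pose proof (pow2_ge_0 (C / eps)).
  assert (sqrt_pos : 0 < sqrt (INR K)) by (apply sqrt_lt_R0; lra).
  assert (quot_le : C / eps <= sqrt (INR K)).
  { eapply Rle_trans; [apply Rle_abs|]. rewrite <- sqrt_Rsqr_abs. apply sqrt_le_1_alt. unfold Rsqr. lra. }
  apply Rle_div_l; auto. rewrite Rmult_comm. now apply Rle_div_l.
Qed.

Lemma lsum_layer_small C s eps : 0 <= C -> 0 < eps ->
  exists K0, (1 <= K0)%nat /\ forall K (f : site -> R), (K0 <= K)%nat ->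
    (forall p, ~ In p (box K) -> f p <= C / (INR K * sqrt (INR K))) ->
    lsum f (box (K + s)) <= lsum f (box K) + eps.
Proof.
  intros C_nonneg eps_pos. set (k := INR s). assert (0 <= k) by apply pos_INR.
  destruct (div_sqrt_small (C * (12 * k + 4 * k ^ 2)) eps eps_pos) as (K0 & K0_ge & small).
  exists K0. split; auto. intros K f K0_le f_le. specialize (small K K0_le).
  assert (r_ge : 1 <= INR K) by (apply (le_INR 1); lia).
  eapply Rle_trans; [apply (lsum_box_growth f _ K s f_le)|]. rewrite plus_INR. fold k.
  apply Rplus_le_compat_l. eapply Rle_trans; [|exact small]. set (r := INR K) in *.
  assert (sqrt_pos : 0 < sqrt r) by (apply sqrt_lt_R0; lra).
  replace (C / (r * sqrt r) * ((2 * (r + k) + 1) ^ 2 - (2 * r + 1) ^ 2))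
    with (C * ((8 * r * k + 4 * k ^ 2 + 4 * k) / r) / sqrt r) by (field; lra).
  apply Rmult_le_compat_r; [left; now apply Rinv_0_lt_compat|]. apply Rmult_le_compat_l; auto.
  apply Rle_div_l; [lra|]. nra.
Qed.

Lemma Rabs_log_potential_le f : Rabs (log_potential f) <= sqrt (weight (fst f)).
Proof.
  destruct f as [p s]. unfold log_potential. rewrite face_dist_origin. cbn [fst].
  pose proof log_rate_bounds. pose proof (weight_ge_1 p) as weight_ge.
  set (x := IZR (face_x (p, s)) / 3). set (y := IZR (face_y (p, s)) / 3).
  assert (x_le : Rabs x <= weight p).
  { unfold x, face_x, weight; simpl fst; simpl snd. rewrite plus_IZR, mult_IZR.
    destruct s; unfold Rabs in *; repeat destruct Rcase_abs; lra. }
  assert (y_le : Rabs y <= weight p).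
  { unfold y, face_y, weight; simpl fst; simpl snd. rewrite plus_IZR, mult_IZR.
    destruct s; unfold Rabs in *; repeat destruct Rcase_abs; lra. }
  assert (dist_le : sqrt (hexnorm x y) <= 2 * weight p).
  { rewrite <- (sqrt_square (2 * weight p)) by lra. apply sqrt_le_1_alt.
    apply pow2_le_of_Rabs_le in x_le, y_le. unfold hexnorm. nra. }
  set (r := Rmax 1 (sqrt (hexnorm x y))).
  assert (r_bounds : 1 <= r <= 2 * weight p) by (unfold r; split; [apply Rmax_l|apply Rmax_lub; lra]).
  assert (ln_nonneg : 0 <= ln r) by (rewrite <- ln_1; apply ln_le; lra).
  rewrite Rabs_mult, Rabs_Ropp, !Rabs_pos_eq by lra.
  set (q := sqrt (weight p)). assert (q_sqr : q * q = weight p) by (apply sqrt_sqrt; lra).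
  assert (q_ge : 1 <= q) by (unfold q; rewrite <- sqrt_1; now apply sqrt_le_1_alt).
  assert (ln_le_q : ln r <= 2 * (1.5 * q)).
  { apply Rle_trans with (ln ((1.5 * q) * (1.5 * q))); [apply ln_le; nra|].
    rewrite ln_mult by lra. pose proof (ln_succ_le (1.5 * q - 1) ltac:(lra)) as ln_le_lin.
    replace (1 + (1.5 * q - 1)) with (1.5 * q) in ln_le_lin by ring. lra. }
  nra.
Qed.

Section LogFieldSummationByParts.

Variables (d : field) (N : nat).
Hypothesis d_decays : decays 2 d.
Hypothesis curl_supp : face_supported (curl d) (box N).

Let truncated_potential (K : nat) (f : face) : R :=
  if excluded_middle_informative (In (fst f) (box (S K))) then log_potential f else 0.

Lemma rot_truncated_supported K : field_supported (rot (truncated_potential K)) (box (K + 2)).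
Proof.
  replace (K + 2)%nat with (S (S K)) by lia. apply rot_supported. intros f neq_0.
  unfold truncated_potential in neq_0. destruct excluded_middle_informative; [auto|tauto].
Qed.

Lemma rot_truncated_in_box K i p : In p (box K) -> rot (truncated_potential K) i p = log_field i p.
Proof.
  intros p_in. pose proof (left_face_in_box K i p p_in). pose proof (right_face_in_box K i p p_in).
  unfold log_field, rot, truncated_potential. repeat destruct excluded_middle_informative; tauto.
Qed.

Lemma face_sum_log_potential_truncated K : (N <= K)%nat ->
  face_sum (fun f => log_potential f * curl d f) =
    lsum (cell_sum (fun i p => rot (truncated_potential K) i p * d i p)) (box (K + 2)).
Proof.
  intros N_le_K. rewrite <- (field_sum_finite _ (box (K + 2)) (NoDup_box _)).
  2:{ apply (field_supported_sub (rot (truncated_potential K))); [intros i p ->; ring|apply rot_truncated_supported]. }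
  rewrite (summation_by_parts_face_supported _ d (S K)).
  2:{ intros f neq_0. unfold truncated_potential in neq_0. destruct excluded_middle_informative; [auto|tauto]. }
  apply tsum_ext. intros p. unfold face_cell_sum.
  assert (same : forall f, log_potential f * curl d f = truncated_potential K f * curl d f).
  { intros f. unfold truncated_potential. destruct excluded_middle_informative as [|f_out]; auto.
    rewrite (face_supported_out (curl d) (box N)); auto; [ring|]. intros f_in. apply f_out.
    apply (incl_box N); auto. }
  now rewrite !same.
Qed.

Lemma Rabs_truncated_potential_le K f : (1 <= K)%nat -> Rabs (truncated_potential K f) <= 3 * sqrt (INR K).
Proof.
  intros K_ge. assert (1 <= INR K) by (apply (le_INR 1); lia). pose proof (sqrt_pos (INR K)).
  unfold truncated_potential. destruct excluded_middle_informative as [f_in|]; [|rewrite Rabs_R0; lra].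
  eapply Rle_trans; [apply Rabs_log_potential_le|]. apply weight_le_in_box in f_in. rewrite S_INR in f_in.
  rewrite <- (sqrt_square 3), <- sqrt_mult by lra. apply sqrt_le_1_alt. lra.
Qed.

Lemma log_field_summation_by_parts eps : 0 < eps -> exists K0, forall K, (K0 <= K)%nat ->
  Rabs (lsum (cell_sum (fun i p => log_field i p * d i p)) (box K) - face_sum (fun f => log_potential f * curl d f)) <=
    eps.
Proof.
  intros eps_pos. destruct d_decays as (C & C_pos & d_le).
  destruct (lsum_layer_small (18 * C) 2 eps) as (K0 & K0_ge & layer_small); [lra|auto|].
  exists (K0 + N)%nat. intros K K_ge. rewrite (face_sum_log_potential_truncated K) by lia.
  rewrite (lsum_cell_sum_ext _ (fun i p => rot (truncated_potential K) i p * d i p))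
    by (intros; now rewrite rot_truncated_in_box).
  set (g := cell_sum (fun i p => rot (truncated_potential K) i p * d i p)).
  assert (r_ge : 1 <= INR K) by (apply (le_INR 1); lia).
  assert (g_le : forall p, ~ In p (box K) -> Rabs (g p) <= 18 * C / (INR K * sqrt (INR K))).
  { intros p p_out. apply lt_weight_out_box in p_out. pose proof (sqrt_lt_R0 (INR K) ltac:(lra)).
    eapply Rle_trans; [apply Rabs_cell_sum_le|].
    replace (18 * C / (INR K * sqrt (INR K))) with (3 * (6 * sqrt (INR K) * (C / INR K ^ 2))).
    2:{ rewrite <- (sqrt_sqrt (INR K)) at 2 3 by lra. field. lra. }
    rewrite <- (cell_sum_const _ p). apply cell_sum_le. intros i. unfold field_abs. rewrite Rabs_mult.
    apply Rmult_le_compat; auto using Rabs_pos.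
    - unfold rot. eapply Rle_trans; [apply Rabs_triang|]. rewrite Rabs_Ropp.
      pose proof (Rabs_truncated_potential_le K (left_face i p) ltac:(lia)).
      pose proof (Rabs_truncated_potential_le K (right_face i p) ltac:(lia)). lra.
    - eapply Rle_trans; [apply d_le|]. apply Rmult_le_compat_l; [lra|].
      apply Rinv_le_contravar; [apply pow_lt; lra|]. apply pow_incr. lra. }
  pose proof (layer_small K g ltac:(lia)) as upper. pose proof (layer_small K (fun p => -1 * g p) ltac:(lia)) as lower.
  rewrite !lsum_scal in lower.
  assert (g_bounds : forall p, ~ In p (box K) ->
    - (18 * C / (INR K * sqrt (INR K))) <= g p <= 18 * C / (INR K * sqrt (INR K))).
  { intros p p_out. apply Rabs_le_between. auto. }
  apply Rabs_le. split.
  - enough (lsum g (box (K + 2)) <= lsum g (box K) + eps) by lra. apply upper. intros p p_out. now apply g_bounds.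
  - enough (-1 * lsum g (box (K + 2)) <= -1 * lsum g (box K) + eps) by lra. apply lower. intros p p_out.
    specialize (g_bounds p p_out). lra.
Qed.

End LogFieldSummationByParts.

(** * Lattice symmetries *)

Record lattice_symmetry := {
  sym_site : site -> site;
  sym_sign : R;
  sym_shift_x : R;
  sym_shift_y : R;
  sym_bond : dir -> site -> site;
  sym_bond_inv : dir -> site -> site;
  sym_face : face -> face;
  sym_face_inv : face -> face;
  sym_range : nat;
  sym_rigid : acts_rigidly sym_site sym_sign sym_shift_x sym_shift_y;
  sym_bondK : forall i p, sym_bond_inv i (sym_bond i p) = p;
  sym_faceK : forall f, sym_face_inv (sym_face f) = f;
  sym_face_invK : forall f, sym_face (sym_face_inv f) = f;
  sym_bond_in_box : forall i p N, In p (box N) -> In (sym_bond i p) (box (N + sym_range));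
  sym_bond_inv_in_box : forall i p N, In p (box N) -> In (sym_bond_inv i p) (box (N + sym_range));
  in_box_of_sym_face : forall f N, In (fst (sym_face f)) (box N) -> In (fst f) (box (N + sym_range));
  grad_sym : forall v i p, grad (fun q => v (sym_site q)) i p = sym_sign * grad v i (sym_bond i p);
  curl_sym : forall b f, curl (fun i p => sym_sign * b i (sym_bond i p)) f = curl b (sym_face f);
  face_sqdist_sym_face : forall f g, face_sqdist (sym_face f) (sym_face g) = face_sqdist f g
}.

Definition translation (a b : Z) : lattice_symmetry.
Proof.
  refine {|
    sym_site := shift a b; sym_sign := 1; sym_shift_x := - IZR a; sym_shift_y := - IZR b;
    sym_bond := fun _ => shift a b; sym_bond_inv := fun _ => shift (-a) (-b);
    sym_face := fun f => (shift a b (fst f), snd f); sym_face_inv := fun f => (shift (-a) (-b) (fst f), snd f);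
    sym_range := Z.abs_nat a + Z.abs_nat b |}.
  - split; [now left|]. intros p. unfold site_x, site_y, shift; simpl. rewrite !plus_IZR. split; ring.
  - intros i p. apply shift_opp_shift.
  - intros [p t]. simpl. now rewrite shift_opp_shift.
  - intros [p t]. simpl. now rewrite shift_shift_opp.
  - intros i p N. rewrite !in_box. unfold shift; simpl. lia.
  - intros i p N. rewrite !in_box. unfold shift; simpl. lia.
  - intros [p t] N. rewrite !in_box. unfold shift; simpl. lia.
  - intros v i p. unfold grad. rewrite Rmult_1_l.
    assert (shift a b (target i p) = target i (shift a b p)) as ->
      by (destruct i; simpl; rewrite !shift_shift; f_equal; lia).
    assert (shift a b (source i p) = source i (shift a b p)) as ->
      by (destruct i; simpl; rewrite ?shift_shift; f_equal; lia).
    reflexivity.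
  - intros c [p t]. unfold curl; simpl.
    rewrite !shift_shift, (Z.add_comm 1 a), (Z.add_comm 1 b), !Z.add_0_l, !Z.add_0_r. destruct t; ring.
  - intros f g. unfold face_sqdist, face_x, face_y, shift; cbn [fst snd]. f_equal; lia.
Defined.

Definition reflected_bond (a b : Z) (i : dir) (p : site) : site :=
  match i with
  | East => (a - fst p - 1, b - snd p)%Z
  | NorthEast => (a - fst p, b - snd p - 1)%Z
  | NorthWest => (a - fst p - 1, b - snd p - 1)%Z
  end.

Definition reflected_face (a b : Z) (f : face) : face :=
  ((a - fst (fst f) - 1, b - snd (fst f) - 1)%Z, negb (snd f)).

Lemma reflected_faceK a b f : reflected_face a b (reflected_face a b f) = f.
Proof. destruct f as [[m n] t]. unfold reflected_face; simpl. rewrite Bool.negb_involutive. do 2 f_equal; lia. Qed.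

Lemma reflected_bondK a b i p : reflected_bond a b i (reflected_bond a b i p) = p.
Proof. destruct p, i; simpl; f_equal; lia. Qed.

Lemma reflected_bond_in_box a b i p N :
  In p (box N) -> In (reflected_bond a b i p) (box (N + (Z.abs_nat a + Z.abs_nat b + 1))).
Proof. rewrite !in_box. destruct i; simpl; lia. Qed.

Definition point_reflection (a b : Z) : lattice_symmetry.
Proof.
  refine {|
    sym_site := fun p => (a - fst p, b - snd p)%Z; sym_sign := -1;
    sym_shift_x := IZR a + 2 / 3; sym_shift_y := IZR b + 2 / 3;
    sym_bond := reflected_bond a b; sym_bond_inv := reflected_bond a b;
    sym_face := reflected_face a b; sym_face_inv := reflected_face a b;
    sym_range := Z.abs_nat a + Z.abs_nat b + 1 |};
    auto using reflected_bondK, reflected_faceK, reflected_bond_in_box.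
  - split; [now right|]. intros p. unfold site_x, site_y; simpl. rewrite !minus_IZR. split; field.
  - intros [[m n] t] N. rewrite !in_box. simpl. lia.
  - intros v i [m n]. unfold grad.
    replace (-1 * _) with (v (source i (reflected_bond a b i (m, n))) - v (target i (reflected_bond a b i (m, n))))
      by ring.
    destruct i; unfold source, target, shift; cbn [reflected_bond fst snd]; f_equal; f_equal; f_equal; lia.
  - intros c [[m n] t]. unfold curl, reflected_face, shift. cbn [reflected_bond fst snd].
    destruct t; cbn [negb].
    + replace (a - (m + 1))%Z with (a - m - 1)%Z by lia. replace (b - (n + 0) - 1)%Z with (b - n - 1)%Z by lia.
      replace (a - (m + 0) - 1)%Z with (a - m - 1)%Z by lia. replace (b - (n + 1))%Z with (b - n - 1)%Z by lia. ring.
    + replace (a - m - 1 + 1)%Z with (a - m)%Z by lia. replace (b - n - 1 + 0)%Z with (b - n - 1)%Z by lia.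
      replace (a - m - 1 + 0)%Z with (a - m - 1)%Z by lia. replace (b - n - 1 + 1)%Z with (b - n)%Z by lia. ring.
  - intros [[m n] t] [[m' n'] t']. unfold face_sqdist, hexnormZ, face_x, face_y, reflected_face; cbn [fst snd].
    destruct t, t'; cbn [negb]; ring.
Defined.

Lemma symmetry_to_face_exists z : exists s : lattice_symmetry, sym_face s origin_face = z.
Proof.
  destruct z as [[a b] []].
  - exists (translation (a + 1) (b + 1)). unfold origin_face, down_face, shift. cbn [sym_face translation fst snd].
    apply f_equal2; [|reflexivity]. unfold shift. cbn [fst snd]. apply f_equal2; lia.
  - exists (point_reflection a b). unfold origin_face, down_face. cbn [sym_face point_reflection].
    unfold reflected_face; cbn [fst snd negb]. apply f_equal2; [|reflexivity]. apply f_equal2; lia.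
Qed.

(** * Moving the core of a deformation *)

Definition deformation (u : site -> R) : site -> R := fun p => yhat p + u p.
Definition moved (s : lattice_symmetry) (u : site -> R) : site -> R := fun p => deformation u (sym_site s p).
Definition moved_diff (s : lattice_symmetry) (u : site -> R) : field :=
  fun i p => strain (moved s u) i p - ref_strain i p.

Lemma wrap_sym_sign (s : lattice_symmetry) x : wrap (sym_sign s * x) = sym_sign s * wrap x.
Proof.
  destruct (proj1 (sym_rigid s)) as [-> | ->].
  - now rewrite !Rmult_1_l.
  - replace (-1 * x) with (- x) by ring. rewrite wrap_opp. ring.
Qed.

Lemma strain_sym s y i p :
  strain (fun q => y (sym_site s q)) i p = sym_sign s * strain y i (sym_bond s i p).
Proof. unfold strain. rewrite grad_sym. apply wrap_sym_sign. Qed.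

Lemma curl_strain_moved s u f :
  curl (strain (moved s u)) f = curl (strain (deformation u)) (sym_face s f).
Proof. rewrite <- (curl_sym s (strain (deformation u)) f). apply curl_ext. intros. apply strain_sym. Qed.

Lemma grad_deformation u i p : grad (deformation u) i p = grad yhat i p + grad u i p.
Proof. unfold grad, deformation. ring. Qed.

Lemma strain_deformation_out u l i p : field_supported (grad u) l -> ~ In p l ->
  strain (deformation u) i p = ref_strain i p.
Proof.
  intros supp_u p_out. unfold ref_strain, strain.
  rewrite grad_deformation, (field_supported_out (grad u) l), Rplus_0_r; auto.
Qed.

Section MovedDeformation.

Variables (s : lattice_symmetry) (u : site -> R) (N : nat).
Hypothesis supp_u : field_supported (grad u) (box N).

Lemma moved_diff_decays : decays 2 (moved_diff s u).
Proof.
  destruct (rigid_strain_decays _ _ _ _ (sym_rigid s)) as (C & C_pos & strain_le).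
  apply (decays_of_far 2 (2 * (N + sym_range s) + 2) _ C). intros i p far.
  assert (p_out : ~ In (sym_bond s i p) (box N)).
  { intros p_in. apply (sym_bond_inv_in_box s i) in p_in. rewrite sym_bondK in p_in.
    apply weight_le_in_box in p_in. rewrite plus_INR, mult_INR in far. simpl (INR 2) in far. lra. }
  unfold moved_diff, moved. rewrite strain_sym, (strain_deformation_out u (box N)) by auto.
  unfold ref_strain at 1. rewrite <- strain_sym. apply strain_le.
Qed.

Lemma curl_moved_diff f :
  curl (moved_diff s u) f = curl (strain (moved s u)) f - indicator origin_face f.
Proof. unfold moved_diff. now rewrite (curl_minus (strain (moved s u)) ref_strain), curl_ref_strain. Qed.

Lemma curl_strain_deformation_out f : ~ In (fst f) (box (S N)) ->
  curl (strain (deformation u)) f = indicator origin_face f.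
Proof.
  intros f_out. rewrite <- curl_ref_strain.
  enough (curl (fun i p => strain (deformation u) i p - ref_strain i p) f = 0) by (rewrite curl_minus in *; lra).
  assert (Rabs (curl (fun i p => strain (deformation u) i p - ref_strain i p) f) <= 3 * 0) as curl_le.
  { apply Rabs_curl_le. intros i a c a_le c_le.
    rewrite (strain_deformation_out u (box N)), Rminus_diag, Rabs_R0; auto; [lra|].
    intros f_in. apply f_out. rewrite <- (shift_opp_shift a c (fst f)). apply in_box_shift; auto; lia. }
  apply Rabs_le_between in curl_le. lra.
Qed.

Lemma curl_moved_diff_supported : face_supported (curl (moved_diff s u)) (box (S N + 2 + sym_range s)).
Proof.
  intros f neq_0. rewrite curl_moved_diff, curl_strain_moved in neq_0.
  destruct (classic (In (fst (sym_face s f)) (box (S N + 2)))) as [f_in|f_out].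
  - now apply (in_box_of_sym_face s) in f_in.
  - rewrite (curl_strain_deformation_out (sym_face s f)) in neq_0
      by (intros f_in; apply f_out, (incl_box (S N)); [lia|auto]).
    rewrite (indicator_neq origin_face (sym_face s f)) in neq_0
      by (intros origin_eq; apply f_out; rewrite <- origin_eq; apply in_box; simpl; lia).
    assert (f = origin_face) as ->; [|apply in_box; simpl; lia].
    apply NNPP. intros f_neq. rewrite (indicator_neq origin_face f) in neq_0 by congruence. lra.
Qed.

Lemma lsum_sym_bond_le i (g : site -> R) K : (forall p, 0 <= g p) ->
  lsum (fun p => g (sym_bond s i p)) (box K) <= lsum g (box (K + sym_range s)).
Proof.
  intros g_nonneg. rewrite <- (lsum_map (sym_bond s i) g). apply lsum_incl_le; auto using NoDup_box.
  - apply (NoDup_map_retract _ (sym_bond_inv s i)); [apply sym_bondK|apply NoDup_box].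
  - intros p p_in. apply in_map_iff in p_in. destruct p_in as (q & <- & q_in). now apply sym_bond_in_box.
Qed.

Variable psi : R -> R.
Hypothesis psi_ok : psi_hyp psi.
Local Notation mu := (Derive_n psi 2 0).

Lemma psi_strain_moved i p : psi (strain (moved s u) i p) = psi (strain (deformation u) i (sym_bond s i p)).
Proof.
  unfold moved. rewrite strain_sym. destruct (proj1 (sym_rigid s)) as [-> | ->]; [now rewrite Rmult_1_l|].
  rewrite <- psi_even by auto. f_equal. ring.
Qed.

Lemma psi_strain_deformation i p : psi (strain (deformation u) i p) = local_energy psi u i p + psi (ref_strain i p).
Proof.
  unfold strain, local_energy. rewrite psi_wrap, grad_deformation, psi_ref_strain by auto. ring.
Qed.

Lemma lsum_psi_strain_moved_le K :
  lsum (cell_sum (fun i p => psi (strain (moved s u) i p))) (box K) <=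
  lsum (cell_sum (fun i p => psi (strain (deformation u) i p))) (box (K + sym_range s)).
Proof.
  assert (dir_le : forall i, lsum (fun p => psi (strain (moved s u) i p)) (box K) <=
    lsum (fun p => psi (strain (deformation u) i p)) (box (K + sym_range s))).
  { intros i. rewrite (lsum_ext _ (fun p => psi (strain (deformation u) i (sym_bond s i p))))
      by (intros; apply psi_strain_moved).
    apply (lsum_sym_bond_le i (fun p => psi (strain (deformation u) i p))). intros. now apply psi_nonneg. }
  unfold cell_sum. rewrite !lsum_plus. pose proof (dir_le East). pose proof (dir_le NorthEast).
  pose proof (dir_le NorthWest). lra.
Qed.

Lemma psi_ref_strain_layer_small eps : 0 < eps -> exists K0, forall K, (K0 <= K)%nat ->
  lsum (cell_sum (fun i p => psi (ref_strain i p))) (box (K + sym_range s)) <=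
  lsum (cell_sum (fun i p => psi (ref_strain i p))) (box K) + eps.
Proof.
  intros eps_pos. destruct (psi_le_quadratic psi psi_ok) as (Cq & Cq_pos & quadratic).
  destruct ref_strain_sqr_decays as (Ca & Ca_pos & strain_le).
  assert (C_pos : 0 < Cq * Ca) by now apply Rmult_lt_0_compat.
  destruct (lsum_layer_small (3 * (Cq * Ca)) (sym_range s) eps) as (K0 & K0_ge & layer_small); [lra|auto|].
  exists K0. intros K K_ge. apply layer_small; auto. intros p p_out. apply lt_weight_out_box in p_out.
  assert (r_ge : 1 <= INR K) by (apply (le_INR 1); lia). set (r := INR K) in *.
  assert (sqrt_le : 0 < sqrt r <= r).
  { split; [apply sqrt_lt_R0; lra|]. rewrite <- (sqrt_square r) at 2 by lra. apply sqrt_le_1_alt. nra. }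
  apply Rle_trans with (cell_sum (fun _ _ => Cq * (Ca / r ^ 2)) p).
  - apply cell_sum_le. intros i. pose proof (Rabs_ref_strain_le i p). specialize (strain_le i p).
    apply Rabs_le_between in strain_le. eapply Rle_trans; [apply quadratic; lra|]. apply Rmult_le_compat_l; [lra|].
    apply Rle_trans with (Ca / weight p ^ 2); [lra|]. apply Rmult_le_compat_l; [lra|].
    apply Rinv_le_contravar; [apply pow_lt; lra|]. apply pow_incr. lra.
  - rewrite cell_sum_const. replace (3 * (Cq * (Ca / r ^ 2))) with (3 * (Cq * Ca) * / (r * r)) by (field; lra).
    apply Rmult_le_compat_l; [lra|]. apply Rinv_le_contravar; nra.
Qed.

Lemma lsum_psi_moved_le eps : 0 < eps -> exists K0, forall K, (K0 <= K)%nat ->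
  lsum (cell_sum (fun i p => psi (strain (moved s u) i p) - psi (ref_strain i p))) (box K) <= energy psi (grad u) + eps.
Proof.
  intros eps_pos. destruct (psi_ref_strain_layer_small eps eps_pos) as (K0 & layer_small).
  exists (K0 + N)%nat. intros K K_ge. specialize (layer_small K ltac:(lia)).
  pose proof (lsum_psi_strain_moved_le K) as moved_le.
  rewrite (lsum_cell_sum_ext (fun i p => psi (strain (deformation u) i p)) _ _
    (fun i p _ => psi_strain_deformation i p)) in moved_le.
  rewrite lsum_cell_sum_plus in moved_le.
  rewrite lsum_cell_sum_minus, (energy_grad psi u (box (K + sym_range s))); [lra|apply NoDup_box|].
  apply (field_supported_incl _ (box N)); auto. apply incl_box. lia.
Qed.

Lemma energy_moved_le :
  energy psi (moved_diff s u) + mu * face_sum (fun f => log_potential f * curl (moved_diff s u) f) <=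
    energy psi (grad u).
Proof.
  apply le_epsilon. intros eps eps_pos. pose proof (mu_pos psi psi_ok) as mu_pos.
  pose proof (energy_density_summable psi psi_ok _ (field_sqr_summable_of_decays _ moved_diff_decays))
    as summable_density.
  destruct (tsum_box_limit _ (eps / 3) (summable_cell_sum _ summable_density)) as (K1 & energy_near); [lra|].
  destruct (lsum_psi_moved_le (eps / 3)) as (K2 & psi_le); [lra|].
  destruct (log_field_summation_by_parts (moved_diff s u) _ moved_diff_decays curl_moved_diff_supported (eps / (3 * mu)))
    as (K3 & parts_near); [apply Rdiv_lt_0_compat; lra|].
  set (K := (K1 + K2 + K3)%nat).
  specialize (energy_near K ltac:(lia)). specialize (psi_le K ltac:(lia)). specialize (parts_near K ltac:(lia)).
  assert (density_eq : lsum (cell_sum (fun i p => energy_density psi i p (moved_diff s u i p))) (box K) =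
    lsum (cell_sum (fun i p => psi (strain (moved s u) i p) - psi (ref_strain i p))) (box K)
    - mu * lsum (cell_sum (fun i p => log_field i p * moved_diff s u i p)) (box K)).
  { rewrite <- lsum_cell_sum_scal, <- lsum_cell_sum_minus. apply lsum_cell_sum_ext. intros i p _.
    unfold energy_density. replace (ref_strain i p + moved_diff s u i p) with (strain (moved s u) i p)
      by (unfold moved_diff; ring). ring. }
  rewrite density_eq in energy_near.
  fold (field_sum (fun i p => energy_density psi i p (moved_diff s u i p))) in energy_near.
  fold (energy psi (moved_diff s u)) in energy_near. apply Rabs_def2 in energy_near.
  apply Rabs_le_between in parts_near.
  set (T := face_sum _) in *. set (L := lsum (cell_sum (fun i p => log_field i p * moved_diff s u i p)) (box K)) in *.
  assert (mu * (T - L) <= eps / 3); [|lra].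
  apply Rle_trans with (mu * (eps / (3 * mu))); [apply Rmult_le_compat_l; lra|]. right. field. lra.
Qed.

End MovedDeformation.

(** * The test field of a logarithmic profile *)

Definition test_potential (m : R -> R) (f : face) : R := - log_rate * m (face_dist f origin_face).
Definition test_field (m : R -> R) : field := rot (test_potential m).

(* The constant makes the difference of the two potentials vanish far away. *)
Definition potential_gap (m : R -> R) (Lam : R) (f : face) : R :=
  log_potential f - test_potential m f + log_rate * Lam.

Lemma rot_potential_gap m Lam i p : rot (potential_gap m Lam) i p = log_field i p - test_field m i p.
Proof. unfold rot, potential_gap, log_field, test_field, rot. ring. Qed.

Lemma test_field_between m i p : log_growth m ->
  0 <= test_field m i p <= log_field i p \/ log_field i p <= test_field m i p <= 0.
Proof.
  intros (m_0 & m_mono). unfold log_field, test_field, rot, log_potential, test_potential.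
  assert (m_max : forall r, m r = m (Rmax 1 r)).
  { intros r. unfold Rmax. destruct Rle_dec; auto. now rewrite !m_0 by lra. }
  rewrite (m_max (face_dist (left_face i p) _)), (m_max (face_dist (right_face i p) _)).
  set (a := Rmax 1 (face_dist (left_face i p) _)). set (b := Rmax 1 (face_dist (right_face i p) _)).
  assert (a_ge : 1 <= a) by apply Rmax_l. assert (b_ge : 1 <= b) by apply Rmax_l.
  pose proof log_rate_bounds. destruct (Rle_dec a b) as [a_le|a_gt]; [left|right].
  - specialize (m_mono a b a_ge a_le). split; nra.
  - specialize (m_mono b a b_ge ltac:(lra)). split; nra.
Qed.

Lemma Rabs_test_field_le m i p : log_growth m ->
  Rabs (test_field m i p) <= Rabs (log_field i p) /\
  Rabs (log_field i p - test_field m i p) <= Rabs (log_field i p).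
Proof.
  intros growth. destruct (test_field_between m i p growth).
  - rewrite !Rabs_pos_eq by lra. lra.
  - rewrite !Rabs_left1 by lra. lra.
Qed.

Lemma weight_le_shift a b p : (-1 <= a <= 1)%Z -> (-1 <= b <= 1)%Z -> weight p <= 3 * weight (shift a b p).
Proof.
  intros a_le b_le. rewrite !weight_IZR, <- mult_IZR. apply IZR_le. unfold shift; simpl fst; simpl snd. lia.
Qed.

Lemma Rabs_curl_test_field_le : exists C, 0 < C /\
  forall m f, log_growth m -> Rabs (curl (test_field m) f) <= C / weight (fst f).
Proof.
  destruct log_field_decays as (C & C_pos & log_le). exists (9 * C). split; [lra|]. intros m f growth.
  replace (9 * C / weight (fst f)) with (3 * (3 * C / weight (fst f))) by (pose proof (weight_pos (fst f)); field; lra).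
  apply Rabs_curl_le. intros i a c a_le c_le. eapply Rle_trans; [now apply Rabs_test_field_le|].
  eapply Rle_trans; [apply log_le|]. rewrite pow_1. pose proof (weight_le_shift a c (fst f) a_le c_le).
  pose proof (weight_pos (fst f)).
  replace (3 * C / weight (fst f)) with (C * / (weight (fst f) / 3)) by (field; lra).
  apply Rmult_le_compat_l; [lra|]. apply Rinv_le_contravar; lra.
Qed.

Section TestField.

Variables (m : R -> R) (Lam R0 : R).
Hypothesis profile : log_profile m Lam R0.

Lemma potential_gap_origin : potential_gap m Lam origin_face = log_rate * Lam.
Proof.
  destruct profile as [_ (m_0 & _) _]. unfold potential_gap, log_potential, test_potential.
  rewrite face_dist_refl, m_0, Rmax_left, ln_1 by lra. ring.
Qed.

Lemma potential_gap_supported : exists N, face_supported (potential_gap m Lam) (box N).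
Proof.
  destruct profile as [R0_ge _ m_far]. destruct (INR_unbounded (1.2 * R0 + 1)) as (N & N_large). exists N.
  intros [p t] gap_neq_0.
  assert (near : face_dist (p, t) origin_face < R0).
  { apply Rnot_le_lt. intros far. apply gap_neq_0. unfold potential_gap, log_potential, test_potential.
    rewrite m_far, Rmax_right by lra. ring. }
  rewrite face_dist_origin in near.
  destruct (Rabs_coord_le (IZR (face_x (p, t)) / 3) (IZR (face_y (p, t)) / 3)) as (x_le & y_le).
  assert (x_lt : Rabs (IZR (face_x (p, t)) / 3) < INR N - 1) by lra.
  assert (y_lt : Rabs (IZR (face_y (p, t)) / 3) < INR N - 1) by lra. apply Rabs_def2 in x_lt, y_lt.
  unfold face_x, face_y in x_lt, y_lt; cbn [fst snd] in x_lt, y_lt. rewrite plus_IZR, mult_IZR in x_lt, y_lt.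
  apply in_box. rewrite INR_IZR_INZ in x_lt, y_lt. cbn [fst].
  split; apply le_IZR; rewrite abs_IZR; apply Rabs_le; destruct t; lra.
Qed.

Lemma rot_potential_gap_mul_summable (b : field) :
  field_summable (fun i p => rot (potential_gap m Lam) i p * b i p).
Proof.
  destruct potential_gap_supported as (N & supp). apply (field_summable_of_support _ (box (S N))).
  apply (field_supported_sub (rot (potential_gap m Lam))); [intros i p ->; ring|now apply rot_supported].
Qed.

Lemma face_sum_potential_gap d L : NoDup L -> charges_in d L -> lsum (curl d) L = 0 ->
  face_sum (fun f => potential_gap m Lam f * curl d f) =
  face_sum (fun f => log_potential f * curl d f) - lsum (fun f => test_potential m f * curl d f) L.
Proof.
  intros nodup_L in_L neutral.
  assert (face_sum_L : forall h, face_sum (fun f => h f * curl d f) = lsum (fun f => h f * curl d f) L).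
  { intros h. apply face_sum_finite; auto. intros f neq_0. apply in_L. intros curl_0. apply neq_0. rewrite curl_0.
    ring. }
  rewrite !face_sum_L. unfold potential_gap.
  rewrite (lsum_ext _ (fun f => log_potential f * curl d f - test_potential m f * curl d f + log_rate * Lam * curl d f))
    by (intros; ring).
  rewrite lsum_plus, lsum_minus, lsum_scal, neutral. ring.
Qed.

End TestField.

Lemma ref_strain_minus_test_field_sqr_le : exists C, 0 < C /\ forall m Lam i p, log_growth m ->
  (ref_strain i p - test_field m i p) ^ 2 <= rot (potential_gap m Lam) i p * ref_strain i p + C * / weight p ^ 4.
Proof.
  destruct strain_gap_sqr_decays as (C1 & C1_pos & gap_sqr_le).
  destruct strain_gap_mul_log_field_decays as (C2 & C2_pos & gap_mul_le).
  exists (C1 + C2). split; [lra|]. intros m Lam i p growth. rewrite rot_potential_gap.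
  specialize (gap_sqr_le i p). destruct (Rabs_test_field_le m i p growth) as (_ & diff_le).
  pose proof (test_field_between m i p growth) as between.
  set (c := log_field i p) in *. set (j := test_field m i p) in *. set (e := ref_strain i p - c) in *.
  assert (cross_le : Rabs (e * (c - j)) <= C2 / weight p ^ 4).
  { eapply Rle_trans; [|apply gap_mul_le]. rewrite !Rabs_mult. apply Rmult_le_compat_l; auto using Rabs_pos. }
  apply Rabs_le_between in cross_le, gap_sqr_le. replace (ref_strain i p) with (e + c) by (unfold e; ring).
  assert ((c - j) ^ 2 <= (c - j) * c) by (destruct between; nra). unfold Rdiv in *.
  replace ((e + c - j) ^ 2) with (e ^ 2 + 2 * (e * (c - j)) + (c - j) ^ 2) by ring. lra.
Qed.

Lemma field_sqr_summable_ref_strain_minus_test_field m Lam R0 : log_profile m Lam R0 ->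
  field_summable (field_sqr (fun i p => ref_strain i p - test_field m i p)).
Proof.
  intros profile. destruct ref_strain_minus_test_field_sqr_le as (C & _ & sqr_le).
  apply (field_summable_le _ (fun i p => rot (potential_gap m Lam) i p * ref_strain i p + C * / weight p ^ 4)).
  - intros i p. rewrite Rabs_pos_eq by apply field_sqr_nonneg. apply sqr_le, (profile_growth _ _ _ profile).
  - apply field_summable_plus; [eapply rot_potential_gap_mul_summable, profile|].
    apply field_summable_scal, field_summable_inv_weight4.
Qed.

Lemma test_field_error : exists C, 0 < C /\ forall m Lam R0, log_profile m Lam R0 ->
  field_sum (field_sqr (fun i p => ref_strain i p - test_field m i p)) <= log_rate * Lam + C.
Proof.
  destruct ref_strain_minus_test_field_sqr_le as (C & C_pos & sqr_le). exists (27 * C). split; [lra|].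
  intros m Lam R0 profile. pose proof (rot_potential_gap_mul_summable m Lam R0 profile ref_strain) as summable_cross.
  pose proof (field_summable_scal C _ field_summable_inv_weight4) as summable_weight.
  eapply Rle_trans; [eapply field_sum_le|].
  - eapply field_sqr_summable_ref_strain_minus_test_field, profile.
  - apply (field_summable_plus _ _ summable_cross summable_weight).
  - intros i p. apply (sqr_le m Lam i p), (profile_growth _ _ _ profile).
  - rewrite (field_sum_plus _ _ summable_cross summable_weight).
    destruct (potential_gap_supported m Lam R0 profile) as (N & supp).
    rewrite (summation_by_parts_face_supported _ _ N supp).
    rewrite (face_sum_finite _ [origin_face]); [|repeat constructor; simpl; tauto|].
    + cbn [lsum]. rewrite curl_ref_strain, indicator_same, (potential_gap_origin m Lam R0 profile).
      pose proof (field_sum_inv_weight4_le C). lra.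
    + intros f neq_0. left. apply NNPP. intros f_neq. apply neq_0. rewrite curl_ref_strain, indicator_neq; auto. ring.
Qed.

Lemma field_sqr_summable_strain_minus_test_field m Lam R0 d :
  log_profile m Lam R0 -> field_summable (field_sqr d) ->
  field_summable (field_sqr (fun i p => ref_strain i p + d i p - test_field m i p)).
Proof.
  intros profile summable_d.
  apply (field_summable_ext (field_sqr (fun i p => (ref_strain i p - test_field m i p) - - d i p)));
    [intros; unfold field_sqr; ring|].
  apply field_sqr_summable_minus; [eapply field_sqr_summable_ref_strain_minus_test_field, profile|].
  apply (field_summable_ext (field_sqr d)); auto. intros; unfold field_sqr; ring.
Qed.

Section EnergyLowerBound.

Variable psi : R -> R.
Hypothesis psi_ok : psi_hyp psi.
Local Notation mu := (Derive_n psi 2 0).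

Lemma energy_ge_test_field : exists C, forall (d : field) m Lam R0 L,
  log_profile m Lam R0 -> field_summable (field_sqr d) -> (forall i p, Rabs (ref_strain i p + d i p) <= / 2) ->
  NoDup L -> charges_in d L -> lsum (curl d) L = 0 ->
  / 2 * mu * (field_sum (field_sqr (fun i p => ref_strain i p + d i p - test_field m i p))
              - field_sum (field_sqr (fun i p => ref_strain i p - test_field m i p)))
    + mu * lsum (fun f => test_potential m f * curl d f) L - C
  <= energy psi d + mu * face_sum (fun f => log_potential f * curl d f).
Proof.
  destruct (energy_density_ge_wrapped psi psi_ok) as (C & C_pos & density_ge). exists (27 * C).
  intros d m Lam R0 L profile summable_d wrapped nodup_L in_L neutral.
  pose proof (field_sqr_summable_ref_strain_minus_test_field m Lam R0 profile) as summable_a.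
  pose proof (field_sqr_summable_strain_minus_test_field m Lam R0 d profile summable_d) as summable_b.
  set (a := fun i p => ref_strain i p - test_field m i p) in *.
  set (b := fun i p => ref_strain i p + d i p - test_field m i p) in *.
  pose proof (rot_potential_gap_mul_summable m Lam R0 profile d) as summable_cross.
  pose proof (field_summable_minus _ _ summable_b summable_a) as summable_ba.
  pose proof (field_summable_scal (/ 2 * mu) _ summable_ba) as summable_quad.
  pose proof (field_summable_scal mu _ summable_cross) as summable_lin.
  pose proof (field_summable_scal C _ field_summable_inv_weight4) as summable_weight.
  pose proof (field_summable_minus _ _ summable_quad summable_lin) as summable_main.
  assert (energy_ge : field_sum (fun i p => / 2 * mu * (field_sqr b i p - field_sqr a i p)
      - mu * (rot (potential_gap m Lam) i p * d i p) - C * / weight p ^ 4) <= energy psi d).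
  { apply field_sum_le; [now apply field_summable_minus|now apply energy_density_summable|].
    intros i p. eapply Rle_trans; [|apply density_ge, wrapped]. rewrite rot_potential_gap. unfold field_sqr, a, b.
    right. field.
    pose proof (weight_pos p). lra. }
  rewrite (field_sum_minus _ _ summable_main summable_weight), (field_sum_minus _ _ summable_quad summable_lin),
    (field_sum_scal _ _ summable_ba), (field_sum_scal _ _ summable_cross),
      (field_sum_minus _ _ summable_b summable_a) in energy_ge.
  destruct (potential_gap_supported m Lam R0 profile) as (N & supp).
  rewrite (summation_by_parts_face_supported _ _ N supp), (face_sum_potential_gap m Lam d L) in energy_ge by auto.
  pose proof (field_sum_inv_weight4_le C). lra.
Qed.

End EnergyLowerBound.

(** * The cost of charges *)

Lemma sqr_sum3_le x y z : (x - y - z) ^ 2 <= 3 * (x ^ 2 + y ^ 2 + z ^ 2).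
Proof. pose proof (pow2_ge_0 (x + y)). pose proof (pow2_ge_0 (x + z)). pose proof (pow2_ge_0 (y - z)). nra. Qed.

Lemma lsum_weighted_curl_sqr_le (b : field) (a : face -> R) L : field_summable (field_sqr b) -> NoDup L ->
  (forall f, a f <> 0 -> In f L) -> (forall f, 0 <= a f) -> (forall i p, a (left_face i p) + a (right_face i p) <= 1) ->
  lsum (fun f => a f * (curl b f ^ 2 / 3)) L <= field_sum (field_sqr b).
Proof.
  intros summable_b nodup_L supp_a a_nonneg a_across.
  assert (a_le : forall f, a f <= 1).
  { intros [p []]; pose proof (a_across NorthWest p) as across; simpl in across.
    - pose proof (a_nonneg (up_face p)). fold (down_face p). lra.
    - pose proof (a_nonneg (down_face p)). fold (up_face p). lra. }
  assert (summable_a : forall g : dir -> site -> face, field_summable (fun i p => a (g i p) * field_sqr b i p)).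
  { intros g. apply (field_summable_le _ (field_sqr b)); auto. intros i p. pose proof (field_sqr_nonneg b i p).
    pose proof (a_le (g i p)). rewrite Rabs_pos_eq by now apply Rmult_le_pos. nra. }
  apply Rle_trans with
    (field_sum (fun i p => a (left_face i p) * field_sqr b i p + a (right_face i p) * field_sqr b i p)).
  - rewrite (field_sum_by_faces a (field_sqr b) (field_sqr b) (summable_a left_face) (summable_a right_face)).
    rewrite (face_sum_finite _ L nodup_L) by (intros f neq_0; apply supp_a; intros a_0; apply neq_0; rewrite a_0; ring).
    apply lsum_le. intros f _. apply Rmult_le_compat_l; auto. unfold curl, field_sqr. destruct (snd f).
    + pose proof (sqr_sum3_le (b NorthEast (shift 1 0 (fst f))) (b East (shift 0 1 (fst f))) (b NorthWest (fst f))).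
      lra.
    + pose proof (sqr_sum3_le (b NorthEast (fst f)) (b East (fst f)) (b NorthWest (fst f))) as sqr_le.
      replace (b East (fst f) + b NorthWest (fst f) - b NorthEast (fst f)) with
        (- (b NorthEast (fst f) - b East (fst f) - b NorthWest (fst f))) by ring. lra.
  - apply field_sum_le; auto.
    + apply field_summable_plus; apply summable_a.
    + intros i p. pose proof (a_across i p). pose proof (field_sqr_nonneg b i p). nra.
Qed.

Lemma lsum_faces_inv_weight4 L : NoDup L -> lsum (fun f : face => / weight (fst f) ^ 4) L <= 18.
Proof.
  intros nodup_L. destruct (incl_some_box (map fst L)) as (N & L_in_box).
  apply Rle_trans with (lsum (fun f : face => / weight (fst f) ^ 4) (faces_over (box N))).
  - apply lsum_incl_le; auto using NoDup_faces_over, NoDup_box.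
    + intros f f_in. apply in_faces_over, L_in_box, in_map; auto.
    + intros f _. left. apply inv_weight_pow_pos.
  - rewrite <- lsum_face_cell_sum. unfold face_cell_sum; simpl fst. rewrite lsum_plus.
    pose proof (lsum_inv_weight4 (box N) (NoDup_box N)). lra.
Qed.

(* x <= eta + x^4 / eta^3 *)
Lemma lsum_faces_inv_weight_le L C eta : 0 < C -> 0 < eta -> NoDup L ->
  lsum (fun f : face => C / weight (fst f)) L <= eta * INR (length L) + 18 * (C ^ 4 / eta ^ 3).
Proof.
  intros C_pos eta_pos nodup_L. assert (eta3_pos : 0 < eta ^ 3) by now apply pow_lt.
  assert (0 < C ^ 4 / eta ^ 3) by (apply Rdiv_lt_0_compat; auto; now apply pow_lt).
  apply Rle_trans with (lsum (fun f : face => eta + C ^ 4 / eta ^ 3 * / weight (fst f) ^ 4) L).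
  - apply lsum_le. intros f _. pose proof (weight_pos (fst f)) as w_pos. set (w := weight (fst f)) in *.
    replace (C ^ 4 / eta ^ 3 * / w ^ 4) with ((C / w) ^ 4 / eta ^ 3) by (field; lra).
    assert (x_pos : 0 < C / w) by now apply Rdiv_lt_0_compat. set (x := C / w) in *.
    assert (0 < x ^ 4 / eta ^ 3) by (apply Rdiv_lt_0_compat; auto; now apply pow_lt).
    destruct (Rle_dec x eta); [lra|]. enough (x <= x ^ 4 / eta ^ 3) by lra.
    apply (Rle_div_r x _ (eta ^ 3)); auto. replace (x ^ 4) with (x * x ^ 3) by ring. apply Rmult_le_compat_l; [lra|].
    apply pow_incr. lra.
  - rewrite lsum_plus, lsum_const, lsum_scal. pose proof (lsum_faces_inv_weight4 L nodup_L). nra.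
Qed.

(** * Compactness modulo lattice symmetries *)

Lemma lsum_curl_supported b l L :
  field_supported b l -> NoDup L -> charges_in b L -> lsum (curl b) L = 0.
Proof.
  intros supp_b nodup_L in_L. pose proof (summation_by_parts_field_supported (fun _ => 1) b l supp_b) as parts.
  rewrite (field_sum_finite _ nil) in parts; [|constructor|intros i p neq_0; unfold rot in neq_0; lra].
  rewrite (face_sum_finite _ L) in parts; auto; [|intros f neq_0; apply in_L; lra].
  rewrite (lsum_ext _ (fun f => 1 * curl b f)) by (intros; ring). now symmetry.
Qed.

Lemma lsum_mul_minus_indicator (h q : face -> R) g P : NoDup P -> (forall f, q f <> 0 -> In f P) ->
  lsum (fun f => h f * (q f - indicator g f)) (union [g] P) = lsum (fun f => h f * q f) P - h g.
Proof.
  intros nodup_P supp_q.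
  rewrite (lsum_ext _ (fun f => h f * q f - h f * indicator g f)), lsum_minus by (intros; ring). f_equal.
  - symmetry. apply lsum_incl_eq; auto using NoDup_union, incl_union_r.
    intros f _ f_out. replace (q f) with 0; [ring|]. symmetry. apply NNPP. auto.
  - rewrite <- (lsum_incl_eq _ [g]); auto using NoDup_union, incl_union_l.
    + simpl. rewrite indicator_same. ring.
    + repeat constructor; simpl; tauto.
    + intros f _ f_out. rewrite indicator_neq; [ring|]. intros ->. apply f_out. now left.
Qed.

Lemma curl_strain_sqr y f : curl (strain y) f <> 0 -> curl (strain y) f ^ 2 = 1.
Proof.
  intros neq_0. destruct (curl_strain_int y f) as (k & curl_eq).
  assert (Rabs (curl (strain y) f) <= 3 * / 2) as curl_le by (apply Rabs_curl_le; intros; apply Rabs_wrap_le).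
  rewrite curl_eq in *. rewrite <- abs_IZR in curl_le.
  assert (Z.abs k < 2)%Z by (apply lt_IZR; lra).
  assert (k <> 0%Z) by (intros ->; now apply neq_0).
  assert (k = 1 \/ k = -1)%Z as [-> | ->] by lia; simpl; ring.
Qed.

Lemma charged_faces_exist u N : field_supported (grad u) (box N) ->
  exists P, NoDup P /\ (forall f, In f P <-> curl (strain (deformation u)) f <> 0) /\
    lsum (curl (strain (deformation u))) P = 1.
Proof.
  intros supp_u. set (q := curl (strain (deformation u))).
  set (P := select (fun f => q f <> 0) (faces_over (box (S N + 2)))).
  assert (nodup_P : NoDup P) by apply NoDup_select, NoDup_faces_over, NoDup_box.
  assert (in_P : forall f, In f P <-> q f <> 0).
  { intros f. unfold P. rewrite in_select, in_faces_over. split; [tauto|]. intros q_neq_0. split; auto.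
    apply NNPP. intros f_out. apply q_neq_0. unfold q. rewrite (curl_strain_deformation_out u N supp_u).
    - apply indicator_neq. intros <-. apply f_out, in_box. simpl. lia.
    - intros f_in. apply f_out. apply (incl_box (S N)); [lia|auto]. }
  exists P. split; [auto|]. split; [auto|].
  set (b := fun i p => strain (deformation u) i p - ref_strain i p).
  assert (curl_b : forall f, curl b f = q f - indicator origin_face f).
  { intros f. unfold b. now rewrite (curl_minus (strain (deformation u)) ref_strain), curl_ref_strain. }
  assert (neutral : lsum (curl b) (union [origin_face] P) = 0).
  { apply (lsum_curl_supported b (box N)); [|apply NoDup_union|].
    - intros i p neq_0. apply NNPP. intros p_out. apply neq_0. unfold b.
      rewrite (strain_deformation_out u (box N)); auto. ring.
    - intros f neq_0. rewrite curl_b in neq_0. destruct (classic (origin_face = f)) as [<-|f_neq].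
      + apply incl_union_l. now left.
      + apply incl_union_r, in_P. rewrite indicator_neq in neq_0; auto. lra. }
  rewrite (lsum_ext _ (fun f => 1 * (q f - indicator origin_face f))) in neutral by (intros; rewrite curl_b; ring).
  rewrite (lsum_mul_minus_indicator (fun _ => 1)) in neutral; auto; [|intros; now apply in_P].
  rewrite (lsum_ext _ q) in neutral by (intros; ring). lra.
Qed.

Definition isolated_in (P : list face) (f : face) : Prop :=
  forall g, In g P -> g <> f -> (8 < face_sqdist f g)%Z.

(* The share of the energy of its three sides that a charged face may claim: adjacent charged faces split
   their common side, while the neighbours of an isolated one claim nothing. *)
Definition isolation_weight (P : list face) (f : face) : R :=
  if excluded_middle_informative (In f P)
  then if excluded_middle_informative (isolated_in P f) then 1 else / 2
  else 0.

Lemma isolation_weight_bounds P f : 0 <= isolation_weight P f <= 1.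
Proof. unfold isolation_weight. repeat destruct excluded_middle_informative; lra. Qed.

Lemma isolation_weight_ge_half P f : In f P -> / 2 <= isolation_weight P f.
Proof. intros f_in. unfold isolation_weight. repeat destruct excluded_middle_informative; try contradiction; lra. Qed.

Lemma isolation_weight_isolated P f : In f P -> isolated_in P f -> isolation_weight P f = 1.
Proof. intros f_in isolated. unfold isolation_weight. repeat destruct excluded_middle_informative; tauto. Qed.

Lemma isolation_weight_supported P f : isolation_weight P f <> 0 -> In f P.
Proof. unfold isolation_weight. destruct excluded_middle_informative; tauto. Qed.

Lemma isolation_weight_across P i p :
  isolation_weight P (left_face i p) + isolation_weight P (right_face i p) <= 1.
Proof.
  pose proof (face_sqdist_across i p) as dist_eq. set (f := left_face i p) in *. set (g := right_face i p) in *.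
  assert (f_neq_g : f <> g) by (intros f_eq_g; rewrite f_eq_g, face_sqdist_refl in dist_eq; discriminate).
  assert (f_near : In g P -> ~ isolated_in P f).
  { intros g_in isolated. specialize (isolated g g_in (not_eq_sym f_neq_g)). lia. }
  assert (g_near : In f P -> ~ isolated_in P g).
  { intros f_in isolated. specialize (isolated f f_in f_neq_g). rewrite face_sqdist_sym in isolated. lia. }
  unfold isolation_weight. repeat destruct excluded_middle_informative; try lra; tauto.
Qed.

Lemma lsum_sym_face s (h : face -> R) P :
  lsum (fun f => h (sym_face s f)) (map (sym_face_inv s) P) = lsum h P.
Proof. rewrite lsum_map. apply lsum_ext. intros f _. now rewrite sym_face_invK. Qed.

Lemma in_map_sym_face_inv s P f : In f (map (sym_face_inv s) P) <-> In (sym_face s f) P.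
Proof.
  rewrite in_map_iff. split.
  - intros (g & <- & g_in). now rewrite sym_face_invK.
  - intros f_in. exists (sym_face s f). split; auto. apply sym_faceK.
Qed.

Lemma isolation_weight_sym s P f :
  isolation_weight (map (sym_face_inv s) P) f = isolation_weight P (sym_face s f).
Proof.
  assert (isolated_iff : isolated_in (map (sym_face_inv s) P) f <-> isolated_in P (sym_face s f)).
  { unfold isolated_in. split; intros isolated g g_in g_neq.
    - rewrite <- (sym_face_invK s g) in g_in |- *. rewrite face_sqdist_sym_face. apply isolated.
      + now apply in_map_sym_face_inv.
      + intros <-. apply g_neq. now rewrite sym_face_invK.
    - rewrite <- (face_sqdist_sym_face s). apply isolated; [now apply in_map_sym_face_inv|].
      intros sym_eq. apply g_neq. now rewrite <- (sym_faceK s g), sym_eq, sym_faceK. }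
  pose proof (in_map_sym_face_inv s P f). unfold isolation_weight. repeat destruct excluded_middle_informative; tauto.
Qed.

Record centred_charges (q : face -> R) (P : list face) (m : R -> R) (Lam R0 : R) : Prop := {
  centred_nodup : NoDup P;
  centred_support : forall f, In f P <-> q f <> 0;
  centred_total : lsum q P = 1;
  centred_profile : log_profile m Lam R0;
  centred_test : 0 <= lsum (fun f => test_potential m f * q f) P;
  centred_loss : log_rate * Lam <= 1 + 49 / 50 * (lsum (isolation_weight P) P / 3)
}.

Lemma centring_symmetry_exists u N : field_supported (grad u) (box N) ->
  exists s P m Lam R0, centred_charges (curl (strain (moved s u))) P m Lam R0.
Proof.
  intros supp_u. destruct (charged_faces_exist u N supp_u) as (P & nodup_P & in_P & charge_1).
  set (q := curl (strain (deformation u))) in *.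
  destruct (low_loss_centre_exists q (isolation_weight P) P) as (z & m & Lam & R0 & z_in & profile & test & loss); auto.
  { apply curl_strain_int. } { apply isolation_weight_ge_half. } { apply isolation_weight_isolated. }
  destruct (symmetry_to_face_exists z) as (s & sym_origin).
  exists s, (map (sym_face_inv s) P), m, Lam, R0. split; auto.
  - apply (NoDup_map_retract _ (sym_face s)); [apply sym_face_invK|auto].
  - intros f. rewrite curl_strain_moved, in_map_sym_face_inv. apply in_P.
  - rewrite <- charge_1, <- (lsum_sym_face s q). apply lsum_ext. intros f _. apply curl_strain_moved.
  - rewrite (lsum_ext _ (fun f => (fun g => - log_rate * (q g * m (face_dist g z))) (sym_face s f))).
    + rewrite (lsum_sym_face s (fun g => - log_rate * (q g * m (face_dist g z)))), lsum_scal.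
      pose proof log_rate_bounds. nra.
    + intros f _. rewrite curl_strain_moved. fold q. unfold test_potential, face_dist.
      rewrite <- sym_origin, face_sqdist_sym_face. ring.
  - rewrite (lsum_ext _ (fun f => isolation_weight P (sym_face s f))) by (intros; apply isolation_weight_sym).
    now rewrite (lsum_sym_face s (isolation_weight P)).
Qed.

Lemma field_sum_sqr_ge_charges : exists C, forall (b : field) m P, log_growth m -> NoDup P ->
  (forall f, In f P -> curl b f ^ 2 = 1) ->
  field_summable (field_sqr (fun i p => b i p - test_field m i p)) ->
  lsum (isolation_weight P) P / 3 - INR (length P) / 600 - C <=
  field_sum (field_sqr (fun i p => b i p - test_field m i p)).
Proof.
  destruct Rabs_curl_test_field_le as (C & C_pos & test_le). exists (2 / 3 * (18 * (C ^ 4 / (/ 400) ^ 3))).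
  intros b m P growth nodup_P unit_charges summable_b.
  eapply Rle_trans; [|apply (lsum_weighted_curl_sqr_le _ (isolation_weight P) P summable_b nodup_P)].
  - apply Rle_trans with (lsum (fun f => / 3 * isolation_weight P f - 2 / 3 * (C / weight (fst f))) P).
    + rewrite lsum_minus, !lsum_scal. pose proof (lsum_faces_inv_weight_le P C (/ 400) C_pos ltac:(lra) nodup_P). lra.
    + apply lsum_le. intros f f_in. specialize (unit_charges f f_in). specialize (test_le m f growth).
      rewrite (curl_minus b (test_field m)). set (c := curl b f) in *. set (k := curl (test_field m) f) in *.
      set (v := C / weight (fst f)) in *. pose proof (isolation_weight_bounds P f).
      set (a := isolation_weight P f) in *.
      assert (cross_le : Rabs (c * k) <= v).
      { rewrite Rabs_mult. replace (Rabs c) with 1; [lra|]. rewrite <- (Rabs_pos_eq 1) by lra.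
        apply Rsqr_eq_abs_0. unfold Rsqr. lra. }
      apply Rabs_le_between in cross_le.
      assert (sqr_ge : 1 - 2 * v <= (c - k) ^ 2).
      { replace ((c - k) ^ 2) with (c ^ 2 - 2 * (c * k) + k ^ 2) by ring. pose proof (pow2_ge_0 k). lra. }
      assert (a * (1 - 2 * v) <= a * (c - k) ^ 2) by (apply Rmult_le_compat_l; lra).
      assert (a * v <= 1 * v) by (apply Rmult_le_compat_r; lra). lra.
  - apply isolation_weight_supported.
  - intros f. apply isolation_weight_bounds.
  - apply isolation_weight_across.
Qed.

Section BoundedCompetitor.

Variable psi : R -> R.
Hypothesis psi_ok : psi_hyp psi.
Local Notation mu := (Derive_n psi 2 0).

Lemma charges_in_moved_diff s u P m Lam R0 : centred_charges (curl (strain (moved s u))) P m Lam R0 ->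
  charges_in (moved_diff s u) (union [origin_face] P).
Proof.
  intros [_ in_P _ _ _ _] f neq_0. rewrite curl_moved_diff in neq_0.
  destruct (classic (origin_face = f)) as [<-|f_neq]; [apply incl_union_l; now left|].
  apply incl_union_r, in_P. rewrite indicator_neq in neq_0; auto. lra.
Qed.

Lemma moved_excess_le : exists C, forall s u N P m Lam R0,
  field_supported (grad u) (box N) -> energy psi (grad u) <= 0 ->
  centred_charges (curl (strain (moved s u))) P m Lam R0 ->
  field_sum (field_sqr (fun i p => ref_strain i p + moved_diff s u i p - test_field m i p)) <= log_rate * Lam + C.
Proof.
  destruct (energy_ge_test_field psi psi_ok) as (C1 & energy_ge). destruct test_field_error as (C2 & C2_pos & test_le).
  pose proof (mu_pos psi psi_ok) as mu_pos. exists (C2 + 2 * C1 / mu).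
  intros s u N P m Lam R0 supp_u energy_le centred. pose proof (charges_in_moved_diff _ _ _ _ _ _ centred) as in_P.
  destruct centred as [nodup_P q_in_P total profile test _].
  assert (curl_sum : forall h, lsum (fun f => h f * curl (moved_diff s u) f) (union [origin_face] P) =
    lsum (fun f => h f * curl (strain (moved s u)) f) P - h origin_face).
  { intros h. rewrite <- lsum_mul_minus_indicator by (auto; intros; now apply q_in_P).
    apply lsum_ext. intros f _. now rewrite curl_moved_diff. }
  assert (neutral : lsum (curl (moved_diff s u)) (union [origin_face] P) = 0).
  { rewrite (lsum_ext _ (fun f => 1 * curl (moved_diff s u) f)) by (intros; ring).
    rewrite (curl_sum (fun _ => 1)), (lsum_ext _ (curl (strain (moved s u)))) by (intros; ring). lra. }
  assert (test_origin : test_potential m origin_face = 0).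
  { unfold test_potential. rewrite face_dist_refl, (proj1 (profile_growth _ _ _ profile)) by lra. ring. }
  assert (wrapped : forall i p, Rabs (ref_strain i p + moved_diff s u i p) <= / 2).
  { intros i p. replace (ref_strain i p + moved_diff s u i p) with (strain (moved s u) i p)
      by (unfold moved_diff; ring). apply Rabs_wrap_le. }
  pose proof (field_sqr_summable_of_decays _ (moved_diff_decays s u N supp_u)) as summable_d.
  pose proof (energy_ge (moved_diff s u) m Lam R0 _ profile summable_d wrapped (NoDup_union _ _) in_P neutral) as lower.
  pose proof (energy_moved_le s u N supp_u psi psi_ok) as upper. specialize (test_le m Lam R0 profile).
  rewrite curl_sum, test_origin in lower.
  set (X := field_sum (field_sqr (fun i p => ref_strain i p + moved_diff s u i p - test_field m i p))) in *.
  set (Y := field_sum (field_sqr (fun i p => ref_strain i p - test_field m i p))) in *.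
  assert (X - Y <= 2 * C1 / mu); [|lra].
  apply (Rmult_le_reg_l (/ 2 * mu)); [lra|]. replace (/ 2 * mu * (2 * C1 / mu)) with C1 by (field; lra). nra.
Qed.

(* The loss of the centre is at most 49/50 of the energy that the charges force on the excess field, so
   the remaining fiftieth bounds the number of charges. *)
Lemma centred_charges_bounded : exists K, forall s u N P m Lam R0,
  field_supported (grad u) (box N) -> energy psi (grad u) <= 0 ->
  centred_charges (curl (strain (moved s u))) P m Lam R0 ->
  INR (length P) <= K /\ log_rate * Lam <= K.
Proof.
  destruct moved_excess_le as (C1 & excess_le). destruct field_sum_sqr_ge_charges as (C2 & charges_le).
  exists (Rabs (600 * (1 + C1 + C2)) + 1).
  intros s u N P m Lam R0 supp_u energy_le centred. specialize (excess_le s u N P m Lam R0 supp_u energy_le centred).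
  destruct centred as [nodup_P in_P _ profile _ loss].
  assert (unit_charges : forall f, In f P -> curl (fun i p => ref_strain i p + moved_diff s u i p) f ^ 2 = 1).
  { intros f f_in. rewrite (curl_ext _ (strain (moved s u))) by (intros; unfold moved_diff; ring).
    apply curl_strain_sqr. now apply in_P. }
  pose proof (field_sqr_summable_of_decays _ (moved_diff_decays s u N supp_u)) as summable_d.
  specialize (charges_le (fun i p => ref_strain i p + moved_diff s u i p) m P (profile_growth _ _ _ profile) nodup_P
    unit_charges (field_sqr_summable_strain_minus_test_field m Lam R0 _ profile summable_d)).
  assert (half_le : INR (length P) / 2 <= lsum (isolation_weight P) P).
  { unfold Rdiv. rewrite Rmult_comm, <- lsum_const. apply lsum_le. apply isolation_weight_ge_half. }
  assert (le_length : lsum (isolation_weight P) P <= INR (length P)).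
  { rewrite <- (Rmult_1_l (INR _)), <- lsum_const. apply lsum_le. intros f _. apply isolation_weight_bounds. }
  pose proof (Rle_abs (600 * (1 + C1 + C2))). split; lra.
Qed.

Lemma moved_diff_bounded : exists n C, forall u N,
  field_supported (grad u) (box N) -> energy psi (grad u) <= 0 ->
  exists s L, (length L <= n)%nat /\ NoDup L /\ charges_in (moved_diff s u) L /\ l2_bounded (moved_diff s u) C.
Proof.
  destruct centred_charges_bounded as (K & few_charges). destruct moved_excess_le as (C1 & excess_le).
  destruct test_field_error as (C2 & _ & test_le). destruct (INR_unbounded K) as (n & n_large).
  exists (S n), (2 * (K + C1) + 2 * (K + C2)). intros u N supp_u energy_le.
  destruct (centring_symmetry_exists u N supp_u) as (s & P & m & Lam & R0 & centred).
  specialize (few_charges s u N P m Lam R0 supp_u energy_le centred) as (length_le & Lam_le).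
  specialize (excess_le s u N P m Lam R0 supp_u energy_le centred).
  exists s, (union [origin_face] P).
  split; [|split; [apply NoDup_union|split; [eapply charges_in_moved_diff, centred|]]].
  - assert (length P < n)%nat by (apply INR_lt; lra).
    assert (length (union [origin_face] P) <= length ([origin_face] ++ P))%nat; [|simpl in *; lia].
    apply NoDup_incl_length; [apply NoDup_union|]. intros f f_in. now apply nodup_In in f_in.
  - pose proof (centred_profile _ _ _ _ _ centred) as profile. specialize (test_le m Lam R0 profile).
    pose proof (field_sqr_summable_of_decays _ (moved_diff_decays s u N supp_u)) as summable_d.
    pose proof (field_sqr_summable_ref_strain_minus_test_field m Lam R0 profile) as summable_a.
    pose proof (field_sqr_summable_strain_minus_test_field m Lam R0 _ profile summable_d) as summable_b.
    set (a := fun i p => ref_strain i p - test_field m i p) in *.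
    set (b := fun i p => ref_strain i p + moved_diff s u i p - test_field m i p) in *.
    apply (l2_bounded_ext (fun i p => b i p - a i p)); [intros; unfold a, b; ring|].
    apply (l2_bounded_weaken _ (2 * field_sum (field_sqr b) + 2 * field_sum (field_sqr a))); [lra|].
    apply l2_bounded_minus; now apply l2_bounded_field_sum.
Qed.

Lemma energy_density_minus_IZR i p t (k : Z) :
  energy_density psi i p (t - IZR k) = energy_density psi i p t + mu * (log_field i p * IZR k).
Proof.
  unfold energy_density. rewrite <- (psi_add_IZR psi psi_ok (ref_strain i p + (t - IZR k)) k).
  replace (ref_strain i p + (t - IZR k) + IZR k) with (ref_strain i p + t) by ring. ring.
Qed.

Lemma energy_minus_flow b N K : field_summable (field_sqr b) -> integer_flow K N ->
  energy psi (fun i p => b i p - N i p) = energy psi b + mu * face_sum (fun f => log_potential f * curl N f).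
Proof.
  intros summable_b ((l & supp_N) & int_N & _).
  pose proof (energy_density_summable psi psi_ok b summable_b) as summable_density.
  assert (summable_log : field_summable (fun i p => log_field i p * N i p)).
  { apply (field_summable_of_support _ l), (field_supported_sub N); auto. intros i p ->. ring. }
  unfold energy at 1.
  rewrite (field_sum_ext _ (fun i p => energy_density psi i p (b i p) + mu * (log_field i p * N i p))).
  2:{ intros i p. destruct (int_N i p) as (k & ->). apply energy_density_minus_IZR. }
  rewrite field_sum_plus, field_sum_scal by (auto; now apply field_summable_scal).
  unfold log_field. now rewrite (summation_by_parts_field_supported log_potential N l supp_N).
Qed.

Lemma bounded_competitor_exists : exists C, forall u N,
  field_supported (grad u) (box N) -> energy psi (grad u) <= 0 ->
  exists u', u' xi0 = 0 /\ l2_bounded (grad u') C /\ energy psi (grad u') <= energy psi (grad u).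
Proof.
  destruct moved_diff_bounded as (n & C & moved_bounded). destruct (integer_correction n C) as (K & correction).
  exists (2 * C + 2 * (K * K)). intros u N supp_u energy_le.
  destruct (moved_bounded u N supp_u energy_le) as (s & L & length_L & nodup_L & in_L & bounded).
  destruct (correction (moved_diff s u) L) as (F & flow_F & curl_F); auto.
  { intros f. rewrite curl_moved_diff. destruct (curl_strain_int (moved s u) f) as (k & ->).
    destruct (indicator_int origin_face f) as (j & ->). exists (k - j)%Z. now rewrite minus_IZR. }
  destruct (curl_free_is_grad (fun i p => moved_diff s u i p - F i p)) as (u' & u'_0 & grad_u').
  { intros f. rewrite curl_minus, curl_F. ring. }
  exists u'. split; auto. split.
  - apply (l2_bounded_ext (fun i p => moved_diff s u i p - F i p)); [auto|]. apply l2_bounded_minus_flow; auto.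
    apply flow_F.
  - eapply Rle_trans; [|apply (energy_moved_le s u N supp_u psi psi_ok)].
    rewrite (energy_ext psi _ _ grad_u'), (energy_minus_flow _ F K) by (auto; eapply field_sqr_summable, bounded).
    right. do 2 f_equal. apply tsum_ext. intros p. unfold face_cell_sum. now rewrite !curl_F.
Qed.

End BoundedCompetitor.

(** * Cluster points *)

Definition clusters {A : Type} (u : nat -> A -> R) (v : A -> R) (l : list A) : Prop :=
  forall eps, 0 < eps -> forall n0, exists n, (n0 <= n)%nat /\ forall a, In a l -> Rabs (u n a - v a) < eps.

Definition pointwise_cluster {A : Type} (u : nat -> A -> R) (v : A -> R) : Prop := forall l, clusters u v l.

(* The value at the next point is the largest x such that u_n exceeds every smaller number infinitely often
   along the indices at which the values already chosen are approached. *)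
Lemma clusters_extend {A} (u : nat -> A -> R) v l a B : (forall n, Rabs (u n a) <= B) -> clusters u v l ->
  exists x, forall eps, 0 < eps -> forall n0, exists n, (n0 <= n)%nat /\
    Rabs (u n a - x) < eps /\ forall c, In c l -> Rabs (u n c - v c) < eps.
Proof.
  intros u_le cluster. set (close := fun eps n => forall c, In c l -> Rabs (u n c - v c) < eps).
  set (often_above := fun x => forall eps, 0 < eps -> forall n0, exists n, (n0 <= n)%nat /\ close eps n /\ x < u n a).
  destruct (completeness often_above) as (x & x_ub & x_least).
  - exists B. intros y above. destruct (above 1 Rlt_0_1 O) as (n & _ & _ & y_lt).
    specialize (u_le n). apply Rabs_le_between in u_le. lra.
  - exists (- B - 1). intros eps eps_pos n0. destruct (cluster eps eps_pos n0) as (n & n_ge & near). exists n.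
    repeat split; auto. specialize (u_le n). apply Rabs_le_between in u_le. lra.
  - exists x. intros eps eps_pos n0.
    assert (below : exists y, often_above y /\ x - eps < y).
    { apply NNPP. intros none. assert (x <= x - eps); [|lra]. apply x_least. intros y above. apply Rnot_lt_le. eauto. }
    destruct below as (y & above & y_gt).
    assert (not_above : ~ often_above (x + eps / 2)) by (intros above'; specialize (x_ub _ above'); lra).
    apply not_all_ex_not in not_above. destruct not_above as (e & not_above).
    apply imply_to_and in not_above. destruct not_above as (e_pos & not_above).
    apply not_all_ex_not in not_above. destruct not_above as (m & not_above).
    destruct (above (Rmin eps e) ltac:(apply Rmin_pos; auto) (n0 + m)%nat) as (n & n_ge & near & y_lt).
    exists n. split; [lia|]. split.
    + assert (u n a <= x + eps / 2); [|apply Rabs_def1; lra].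
      apply Rnot_lt_le. intros u_gt. apply not_above. exists n. split; [lia|]. split; auto.
      intros c c_in. eapply Rlt_le_trans; [now apply near|apply Rmin_r].
    + intros c c_in. eapply Rlt_le_trans; [now apply near|apply Rmin_l].
Qed.

Lemma cluster_sequence_exists (u : nat -> nat -> R) : (forall k, exists B, forall n, Rabs (u n k) <= B) ->
  exists v, forall k, clusters u v (seq 0 k).
Proof.
  intros bounded.
  assert (next : forall vs, exists x, clusters u (fun k => nth k vs 0) (seq 0 (length vs)) ->
    clusters u (fun k => nth k (vs ++ [x]) 0) (seq 0 (S (length vs)))).
  { intros vs. destruct (classic (clusters u (fun k => nth k vs 0) (seq 0 (length vs)))) as [cluster|];
      [|exists 0; tauto].
    destruct (bounded (length vs)) as (B & u_le). destruct (clusters_extend u _ _ _ B u_le cluster) as (x & extended).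
    exists x. intros _ eps eps_pos n0. destruct (extended eps eps_pos n0) as (n & n_ge & near_x & near). exists n.
    split; auto.
    intros k k_in. apply in_seq in k_in. destruct (Nat.eq_dec k (length vs)) as [->|k_neq].
    - now rewrite nth_middle.
    - rewrite app_nth1 by lia. apply near, in_seq. lia. }
  destruct (choice _ next) as (f & f_next).
  set (values := fix values k := match k with O => [] | S k => values k ++ [f (values k)] end).
  assert (length_values : forall k, length (values k) = k).
  { induction k as [|k IH]; simpl; auto. rewrite length_app, IH. simpl. lia. }
  assert (values_cluster : forall k, clusters u (fun j => nth j (values k) 0) (seq 0 k)).
  { induction k as [|k IH]; [intros eps eps_pos n0; exists n0; split; auto; intros j []|].
    pose proof (f_next (values k)) as extend. rewrite length_values in extend. now apply extend. }
  assert (nth_values : forall k j, (j < k)%nat -> nth j (values k) 0 = f (values j)).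
  { induction k as [|k IH]; intros j j_lt; [lia|]. simpl. destruct (Nat.eq_dec j k) as [->|j_neq].
    - rewrite <- (length_values k) at 1. now rewrite nth_middle.
    - rewrite app_nth1 by (rewrite length_values; lia). apply IH. lia. }
  exists (fun j => f (values j)). intros k eps eps_pos n0.
  destruct (values_cluster k eps eps_pos n0) as (n & n_ge & near).
  exists n. split; auto. intros j j_in. rewrite <- (nth_values k); [auto|]. apply in_seq in j_in. lia.
Qed.

Lemma pointwise_cluster_exists {A} (code : A -> nat) (decode : nat -> A) (u : nat -> A -> R) :
  (forall a, decode (code a) = a) -> (forall a, exists B, forall n, Rabs (u n a) <= B) ->
  exists v, pointwise_cluster u v.
Proof.
  intros codeK bounded. destruct (cluster_sequence_exists (fun n k => u n (decode k))) as (v & cluster); [auto|].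
  exists (fun a => v (code a)). intros l eps eps_pos n0.
  destruct (cluster (S (list_max (map code l))) eps eps_pos n0) as (n & n_ge & near). exists n. split; auto.
  intros a a_in. rewrite <- (codeK a) at 1. apply near, in_seq.
  assert (code a <= list_max (map code l))%nat; [|lia].
  pose proof (proj1 (list_max_le (map code l) _) (le_n _)) as all_le. rewrite Forall_forall in all_le.
  apply all_le, in_map, a_in.
Qed.

Definition site_code (p : site) : nat :=
  to_nat (to_nat (Z.to_nat (fst p), Z.to_nat (- fst p)), to_nat (Z.to_nat (snd p), Z.to_nat (- snd p))).

Definition site_decode (n : nat) : site :=
  let coordinate k := (Z.of_nat (fst (of_nat k)) - Z.of_nat (snd (of_nat k)))%Z in
  (coordinate (fst (of_nat n)), coordinate (snd (of_nat n))).

Lemma site_codeK p : site_decode (site_code p) = p.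
Proof.
  destruct p. unfold site_decode, site_code. rewrite !cancel_of_to. cbn [fst snd]. rewrite !cancel_of_to. simpl.
  f_equal; lia.
Qed.

Lemma gradient_bound_pointwise K p : exists B, forall u, u xi0 = 0 -> l2_bounded (grad u) K -> Rabs (u p) <= B.
Proof.
  set (bounded_at := fun q => exists B, forall u, u xi0 = 0 -> l2_bounded (grad u) K -> Rabs (u q) <= B).
  assert (across : forall i q, bounded_at (source i q) <-> bounded_at (target i q)).
  { intros i q. split; intros (B & u_le); exists (B + (1 + K)); intros u u_0 u_bounded;
      specialize (u_le u u_0 u_bounded);
      pose proof (l2_bounded_Rabs_le _ _ i q u_bounded) as grad_le; unfold grad in grad_le;
      apply Rabs_le_between in grad_le, u_le; apply Rabs_le; lra. }
  assert (at_xi0 : bounded_at xi0) by (exists 0; intros u -> _; rewrite Rabs_R0; lra).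
  change (bounded_at p). destruct p as [m n].
  assert (column : bounded_at (0, n)%Z).
  { revert n. apply Z_iff_ind.
    - apply (across NorthEast xi0), at_xi0.
    - intros n. apply (across NorthEast (0, n)%Z). }
  revert m. apply Z_iff_ind; [auto|]. intros m. rewrite (across East (m, n)). unfold target, shift; simpl.
  now rewrite Z.add_0_r.
Qed.

Definition field_cluster (b : nat -> field) (d : field) : Prop :=
  forall l eps, 0 < eps -> forall n0, exists n, (n0 <= n)%nat /\
    forall i p, In p l -> Rabs (b n i p - d i p) <= eps.

Lemma field_cluster_grad (u : nat -> site -> R) v :
  pointwise_cluster u v -> field_cluster (fun n => grad (u n)) (grad v).
Proof.
  intros cluster l eps eps_pos n0. destruct (incl_some_box l) as (N & l_in_box).
  destruct (cluster (box (S N)) (eps / 2) ltac:(lra) n0) as (n & n_ge & near). exists n. split; auto.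
  intros i p p_in. apply l_in_box in p_in.
  pose proof (near _ (target_in_box N i p p_in)) as near_target.
  pose proof (near _ (source_in_box N i p p_in)) as near_source.
  apply Rabs_def2 in near_target, near_source. unfold grad. apply Rabs_le. lra.
Qed.

Lemma field_cluster_minus_l (a : field) (b : nat -> field) d :
  field_cluster b d -> field_cluster (fun n i p => a i p - b n i p) (fun i p => a i p - d i p).
Proof.
  intros cluster l eps eps_pos n0. destruct (cluster l eps eps_pos n0) as (n & n_ge & near). exists n. split; auto.
  intros i p p_in. specialize (near i p p_in). rewrite <- Rabs_Ropp. now replace (- _) with (b n i p - d i p) by ring.
Qed.

Lemma l2_bounded_cluster (b : nat -> field) d K n0 :
  field_cluster b d -> (forall n, (n0 <= n)%nat -> l2_bounded (b n) K) -> l2_bounded d K.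
Proof.
  intros cluster bounded l nodup_l. apply le_epsilon. intros eps eps_pos.
  set (M := lsum (cell_sum (field_abs d)) l).
  assert (M_nonneg : 0 <= M) by (apply lsum_nonneg; intros; apply cell_sum_nonneg; intros; apply Rabs_pos).
  set (e := eps / (2 * M + 1)). assert (e_pos : 0 < e) by (apply Rdiv_lt_0_compat; lra).
  destruct (cluster l e e_pos n0) as (n & n_ge & near). specialize (bounded n n_ge l nodup_l).
  apply Rle_trans with (lsum (cell_sum (fun i p => field_sqr (b n) i p + 2 * e * field_abs d i p)) l).
  - apply lsum_cell_sum_le. intros i p p_in. unfold field_sqr, field_abs.
    assert (cross_le : Rabs (d i p * (b n i p - d i p)) <= Rabs (d i p) * e)
      by (rewrite Rabs_mult; apply Rmult_le_compat_l; auto using Rabs_pos).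
    apply Rabs_le_between in cross_le. nra.
  - rewrite lsum_cell_sum_plus, lsum_cell_sum_scal. fold M.
    assert (2 * e * M <= eps); [|lra].
    replace (2 * e * M) with (eps * (2 * M) / (2 * M + 1)) by (unfold e; field; lra). apply Rle_div_l; nra.
Qed.

Section LowerSemicontinuity.

Variable psi : R -> R.
Hypothesis psi_ok : psi_hyp psi.

Let density (b : field) : field := fun i p => energy_density psi i p (b i p).

Lemma energy_ge_box_sum K eps : 0 < eps ->
  exists N0, forall N b, (N0 <= N)%nat -> l2_bounded b K -> lsum (cell_sum (density b)) (box N) - eps <= energy psi b.
Proof.
  intros eps_pos. destruct (energy_density_ge psi psi_ok) as (C & C_pos & density_ge).
  destruct (tsum_tail (cell_sum (fun _ p => C * / weight p ^ 4)) (eps / 2)) as (l0 & _ & tail_le);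
    [apply summable_cell_sum, field_summable_scal, field_summable_inv_weight4|lra|].
  destruct (incl_some_box l0) as (N1 & l0_in_box).
  destruct (INR_unbounded (1 + 2 * C * Rabs K / eps)) as (N2 & N2_large).
  exists (N1 + N2)%nat. intros N b N_ge bounded.
  assert (quot_nonneg : 0 <= 2 * C * Rabs K / eps).
  { apply Rdiv_le_0_compat; auto. apply Rmult_le_pos; [lra|apply Rabs_pos]. }
  assert (r_gt : 1 + 2 * C * Rabs K / eps < INR N) by (eapply Rlt_le_trans; [exact N2_large|apply le_INR; lia]).
  apply (tsum_ge _ (box N)).
  { apply summable_cell_sum, (energy_density_summable psi psi_ok). eapply field_sqr_summable, bounded. }
  intros k nodup_k box_in_k. fold (density b). rewrite (lsum_incl_split _ (box N) k) by auto using NoDup_box.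
  set (r := select (fun p => ~ In p (box N)) k). assert (nodup_r : NoDup r) by now apply NoDup_select.
  assert (lower : lsum (cell_sum (fun i p => -1 * (C * / weight p ^ 4) + - (C / INR N) * field_sqr b i p)) r
    <= lsum (cell_sum (density b)) r).
  { apply lsum_cell_sum_le. intros i p p_in. apply in_select in p_in. destruct p_in as (_ & p_out).
    apply lt_weight_out_box in p_out. eapply Rle_trans; [|apply density_ge].
    assert (C * / weight p <= C / INR N) by (apply Rmult_le_compat_l; [lra|]; apply Rinv_le_contravar; lra).
    unfold field_sqr. nra. }
  rewrite lsum_cell_sum_plus, !lsum_cell_sum_scal in lower.
  assert (weight_tail : lsum (cell_sum (fun _ p => C * / weight p ^ 4)) r <= eps / 2).
  { eapply Rle_trans; [apply lsum_le; intros; apply Rle_abs|]. apply (tail_le r nodup_r).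
    intros p p_in p_in_l0. apply in_select in p_in. apply (proj2 p_in), (incl_box N1); [lia|auto]. }
  rewrite lsum_cell_sum_scal in weight_tail.
  assert (sqr_tail : C / INR N * lsum (cell_sum (field_sqr b)) r <= eps / 2); [|lra].
  apply Rle_trans with (C / INR N * Rabs K).
  - apply Rmult_le_compat_l; [apply Rdiv_le_0_compat; lra|].
    eapply Rle_trans; [apply (bounded r nodup_r)|apply Rle_abs].
  - replace (C / INR N * Rabs K) with (2 * C * Rabs K / eps * eps / 2 / INR N) by (field; lra). apply Rle_div_l; nra.
Qed.

Lemma energy_lower_semicontinuous (b : nat -> field) d K I :
  field_cluster b d -> (forall n, l2_bounded (b n) K) ->
  (forall eps, 0 < eps -> exists n0, forall n, (n0 <= n)%nat -> energy psi (b n) <= I + eps) ->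
  energy psi d <= I.
Proof.
  intros cluster bounded energy_le. apply le_epsilon. intros eps eps_pos.
  pose proof (l2_bounded_cluster b d K 0 cluster (fun n _ => bounded n)) as d_bounded.
  destruct (energy_ge_box_sum K (eps / 4)) as (N1 & box_sum_le); [lra|].
  pose proof (energy_density_summable psi psi_ok d (field_sqr_summable d K d_bounded)) as summable_density.
  destruct (tsum_box_limit _ (eps / 4) (summable_cell_sum _ summable_density)) as (N2 & box_sum_near); [lra|].
  fold (density d) in box_sum_near. set (N := (N1 + N2)%nat).
  destruct (finite_energy_continuous psi psi_ok d (box N) (eps / 4)) as (delta & delta_pos & near_energy); [lra|].
  destruct (energy_le (eps / 4)) as (n0 & eventually_le); [lra|].
  destruct (cluster (box N) delta delta_pos n0) as (n & n_ge & near).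
  specialize (box_sum_le N (b n) ltac:(lia) (bounded n)). specialize (box_sum_near N ltac:(lia)).
  specialize (eventually_le n n_ge). specialize (near_energy (b n) near).
  assert (box_diff : Rabs (lsum (cell_sum (fun i p => density (b n) i p - density d i p)) (box N)) <= eps / 4).
  { eapply Rle_trans; [apply Rabs_lsum_le|]. eapply Rle_trans; [|exact near_energy].
    apply lsum_le. intros; apply Rabs_cell_sum_le. }
  rewrite lsum_cell_sum_minus in box_diff. apply Rabs_le_between in box_diff.
  change (tsum (cell_sum (density d))) with (energy psi d) in box_sum_near. apply Rabs_def2 in box_sum_near. lra.
Qed.

End LowerSemicontinuity.

(** * Density of the compactly supported displacements *)

Definition source_inv (i : dir) (p : site) : site :=
  match i with NorthWest => shift (-1) 0 p | _ => p end.
Definition target_inv (i : dir) (p : site) : site :=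
  match i with East => shift (-1) 0 p | _ => shift 0 (-1) p end.

Definition divergence (b : field) (p : site) : R :=
  cell_sum (fun i q => b i (source_inv i q) - b i (target_inv i q)) p.

Lemma source_invK i p : source i (source_inv i p) = p.
Proof. destruct p, i; unfold source, source_inv, shift; simpl; auto; f_equal; lia. Qed.

Lemma sourceK i p : source_inv i (source i p) = p.
Proof. destruct p, i; unfold source, source_inv, shift; simpl; auto; f_equal; lia. Qed.

Lemma target_invK i p : target i (target_inv i p) = p.
Proof. destruct p, i; unfold target, target_inv, shift; simpl; f_equal; lia. Qed.

Lemma targetK i p : target_inv i (target i p) = p.
Proof. destruct p, i; unfold target, target_inv, shift; simpl; f_equal; lia. Qed.

Lemma field_sqr_summable_grad u : summable (fun p => u p ^ 2) -> field_summable (field_sqr (grad u)).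
Proof.
  intros summable_u i. apply (summable_le _ (fun p => 2 * u (target i p) ^ 2 + 2 * u (source i p) ^ 2)).
  - intros p. rewrite Rabs_pos_eq by apply field_sqr_nonneg. unfold field_sqr, grad.
    pose proof (pow2_ge_0 (u (target i p) + u (source i p))). nra.
  - apply summable_plus; apply summable_scal.
    + apply (summable_reindex _ (target_inv i) (targetK i) (fun p => u p ^ 2)), summable_u.
    + apply (summable_reindex _ (source_inv i) (sourceK i) (fun p => u p ^ 2)), summable_u.
Qed.

Lemma field_sum_mul_grad b u : field_summable (field_sqr b) -> summable (fun p => u p ^ 2) ->
  field_sum (fun i p => b i p * grad u i p) = - tsum (fun p => u p * divergence b p).
Proof.
  intros summable_b summable_u.
  set (in_flow := fun i p => b i (target_inv i p) * u p). set (out_flow := fun i p => b i (source_inv i p) * u p).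
  assert (summable_target : forall i, summable (in_flow i)).
  { intros i. apply summable_mul; auto.
    apply (summable_reindex _ (target i) (target_invK i) (fun p => b i p ^ 2)), summable_b. }
  assert (summable_source : forall i, summable (out_flow i)).
  { intros i. apply summable_mul; auto.
    apply (summable_reindex _ (source i) (source_invK i) (fun p => b i p ^ 2)), summable_b. }
  assert (dir_sum : forall i, summable (fun p => b i p * grad u i p) /\
    tsum (fun p => b i p * grad u i p) = tsum (in_flow i) - tsum (out_flow i)).
  { intros i.
    assert (grad_eq : forall p, in_flow i (target i p) - out_flow i (source i p) = b i p * grad u i p).
    { intros p. unfold in_flow, out_flow, grad. rewrite targetK, sourceK. ring. }
    pose proof (summable_reindex _ _ (targetK i) _ (summable_target i)) as summable_target'.
    pose proof (summable_reindex _ _ (sourceK i) _ (summable_source i)) as summable_source'. split.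
    - apply (summable_ext _ _ grad_eq), summable_minus; auto.
    - rewrite <- (tsum_ext _ _ grad_eq), tsum_minus by auto.
      now rewrite (tsum_reindex _ _ (targetK i) (in_flow i) (target_invK i)),
        (tsum_reindex _ _ (sourceK i) (out_flow i) (source_invK i)) by auto. }
  destruct (dir_sum East) as (s1 & e1), (dir_sum NorthEast) as (s2 & e2), (dir_sum NorthWest) as (s3 & e3).
  unfold field_sum, cell_sum. rewrite !tsum_plus, e1, e2, e3 by auto using summable_plus.
  rewrite (tsum_ext (fun p => u p * divergence b p) (fun p => (out_flow East p - in_flow East p)
    + (out_flow NorthEast p - in_flow NorthEast p) + (out_flow NorthWest p - in_flow NorthWest p)))
    by (intros p; unfold divergence, cell_sum, in_flow, out_flow; ring).
  rewrite !tsum_plus, !tsum_minus by auto using summable_plus, summable_minus. ring.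
Qed.

Definition point_mass (p : site) : site -> R := fun q => if classic_eq_dec p q then 1 else 0.

Lemma point_mass_supported p q : point_mass p q <> 0 -> In q [p].
Proof. unfold point_mass. destruct classic_eq_dec; [left; auto|lra]. Qed.

Lemma divergence_point_mass b p : field_summable (field_sqr b) ->
  divergence b p = - field_sum (fun i q => b i q * grad (point_mass p) i q).
Proof.
  intros summable_b. rewrite field_sum_mul_grad, (tsum_finite _ [p]); auto.
  - cbn [lsum]. unfold point_mass. destruct classic_eq_dec; [ring|congruence].
  - repeat constructor; simpl; tauto.
  - intros q neq_0. apply point_mass_supported. intros mass_0. apply neq_0. rewrite mass_0. ring.
  - apply (summable_of_support _ [p]). intros q neq_0. apply point_mass_supported. intros mass_0. apply neq_0.
    rewrite mass_0. ring.
Qed.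

Lemma grad_grad u i j p : grad (grad u i) j p = grad u j (target i p) - grad u j (source i p).
Proof.
  destruct p as [m n]. unfold grad, source, target, shift. destruct i, j; simpl fst; simpl snd;
    rewrite ?(Z.add_comm _ 0), ?Z.add_0_l; ring.
Qed.

Lemma divergence_grad_grad u i p :
  divergence (grad (grad u i)) p = divergence (grad u) (target i p) - divergence (grad u) (source i p).
Proof.
  unfold divergence, cell_sum. rewrite !grad_grad.
  assert (comm : forall j q, target i (source_inv j q) = source_inv j (target i q) /\
    source i (source_inv j q) = source_inv j (source i q) /\ target i (target_inv j q) = target_inv j (target i q) /\
    source i (target_inv j q) = target_inv j (source i q)).
  { intros j [m n]. unfold source, target, source_inv, target_inv, shift.
    destruct i, j; simpl; repeat split; f_equal; lia. }
  destruct (comm East p) as (-> & -> & -> & ->), (comm NorthEast p) as (-> & -> & -> & ->),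
    (comm NorthWest p) as (-> & -> & -> & ->). ring.
Qed.

Lemma grad_0_summable_0 u : (forall i p, grad u i p = 0) -> summable (fun p => u p ^ 2) -> forall p, u p = 0.
Proof.
  intros grad_0 (C & sums_le) p.
  assert (row_const : forall k, u (shift (Z.of_nat k) 0 p) = u p).
  { induction k as [|k IH]; [now rewrite shift_0|]. rewrite <- IH. specialize (grad_0 East (shift (Z.of_nat k) 0 p)).
    unfold grad, source, target in grad_0. rewrite shift_shift in grad_0.
    replace (Z.of_nat k + 1)%Z with (Z.of_nat (S k)) in grad_0 by lia. simpl Z.add in grad_0. lra. }
  assert (row_sum : forall n, INR n * u p ^ 2 <= C).
  { intros n. specialize (sums_le (map (fun k => shift (Z.of_nat k) 0 p) (seq 0 n))).
    rewrite lsum_map, (lsum_ext _ (fun _ => u p ^ 2)), lsum_const, length_seq in sums_le.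
    - rewrite Rmult_comm. apply sums_le, FinFun.Injective_map_NoDup, seq_NoDup.
      intros j k eq. unfold shift in eq. injection eq. lia.
    - intros k _. rewrite row_const. apply Rabs_pos_eq, pow2_ge_0. }
  apply NNPP. intros u_neq_0. assert (sqr_pos : 0 < u p ^ 2) by now apply pow2_gt_0.
  destruct (INR_unbounded (C / u p ^ 2)) as (n & n_large). specialize (row_sum n).
  apply Rlt_div_l in n_large; lra.
Qed.

(* The components of the gradient of a harmonic function are harmonic, and summation by parts against a
   square-summable harmonic function leaves only its Dirichlet energy. *)
Lemma harmonic_l2_gradient_0 w : field_summable (field_sqr (grad w)) -> (forall p, divergence (grad w) p = 0) ->
  forall i p, grad w i p = 0.
Proof.
  intros summable_w harmonic i. pose proof (summable_w i : summable (fun p => grad w i p ^ 2)) as summable_i.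
  pose proof (field_sqr_summable_grad _ summable_i) as summable_grad. apply grad_0_summable_0; auto.
  pose proof (field_sum_mul_grad _ _ summable_grad summable_i) as parts.
  rewrite (tsum_ext _ (fun _ => 0)), (tsum_finite _ nil) in parts;
    [|constructor|tauto|intros p; rewrite divergence_grad_grad, !harmonic; ring].
  rewrite (field_sum_ext _ (field_sqr (grad (grad w i)))) in parts by (intros; unfold field_sqr; ring). simpl in parts.
  intros j p. pose proof (l2_bounded_sqr_le _ _ j p (l2_bounded_field_sum _ summable_grad)) as sqr_le.
  rewrite parts in sqr_le. nra.
Qed.

Lemma quadratic_discriminant_le a b c : 0 <= a -> (forall t, 0 <= c - 2 * t * b + t ^ 2 * a) -> b ^ 2 <= a * c.
Proof.
  intros [a_pos|<-] nonneg.
  - specialize (nonneg (b / a)). replace (c - 2 * (b / a) * b + (b / a) ^ 2 * a) with (c - b ^ 2 / a) in nonneg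
      by (field; lra).
    rewrite Rmult_comm. apply Rle_div_l; lra.
  - destruct (Req_dec b 0) as [->|b_neq_0]; [lra|]. specialize (nonneg ((c + 1) / (2 * b))).
    replace (2 * ((c + 1) / (2 * b)) * b) with (c + 1) in nonneg by (field; auto). lra.
Qed.

Definition field_dot (a b : field) : R := field_sum (fun i p => a i p * b i p).

Lemma field_sum_sqr_minus_scal a b t : field_summable (field_sqr a) -> field_summable (field_sqr b) ->
  field_sum (field_sqr (fun i p => a i p - t * b i p)) =
  field_sum (field_sqr a) - 2 * t * field_dot a b + t ^ 2 * field_sum (field_sqr b).
Proof.
  intros summable_a summable_b. pose proof (field_mul_summable a b summable_a summable_b) as summable_ab.
  rewrite (field_sum_ext _ (fun i p => field_sqr a i p - 2 * t * (a i p * b i p) + t ^ 2 * field_sqr b i p))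
    by (intros; unfold field_sqr; ring).
  pose proof (field_summable_scal (2 * t) _ summable_ab). pose proof (field_summable_scal (t ^ 2) _ summable_b).
  rewrite field_sum_plus, field_sum_minus, !field_sum_scal by auto using field_summable_minus. reflexivity.
Qed.

Lemma field_sum_sqr_nonneg b : field_summable (field_sqr b) -> 0 <= field_sum (field_sqr b).
Proof. intros. apply field_sum_nonneg; auto. intros; apply field_sqr_nonneg. Qed.

Lemma field_sqr_summable_scal t b : field_summable (field_sqr b) -> field_summable (field_sqr (fun i p => t * b i p)).
Proof.
  intros summable_b. apply (field_summable_ext (fun i p => t ^ 2 * field_sqr b i p)); [intros; unfold field_sqr; ring|].
  now apply field_summable_scal.
Qed.

Lemma field_dot_sqr_le a b : field_summable (field_sqr a) -> field_summable (field_sqr b) ->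
  field_dot a b ^ 2 <= field_sum (field_sqr b) * field_sum (field_sqr a).
Proof.
  intros summable_a summable_b. apply quadratic_discriminant_le; [now apply field_sum_sqr_nonneg|]. intros t.
  rewrite <- field_sum_sqr_minus_scal by auto.
  now apply field_sum_sqr_nonneg, field_sqr_summable_minus, field_sqr_summable_scal.
Qed.

Lemma W0_of_supported u N : u xi0 = 0 -> field_supported (grad u) (box N) -> W0 u.
Proof.
  intros u_0 supp_u. split; auto. exists (lsum (fun p => vnorm (pos p)) (box (S N))).
  assert (in_box_bound : forall p, In p (box (S N)) -> vnorm (pos p) <= lsum (fun p => vnorm (pos p)) (box (S N))).
  { intros p p_in. apply Rle_trans with (lsum (fun p => vnorm (pos p)) [p]); [simpl; lra|].
    apply lsum_incl_le;
      [repeat constructor; simpl; tauto|apply NoDup_box|intros q [<-|[]]; auto|intros; apply sqrt_pos]. }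
  intros p q bond_pq D_neq_0. destruct (bond_in_some_cell p q bond_pq) as (r & pq_in). apply in_ordered_bonds in pq_in.
  assert (exists i, grad u i r <> 0 /\ (p = source i r /\ q = target i r \/ p = target i r /\ q = source i r))
    as (i & grad_neq_0 & ends).
  { destruct pq_in as (i & ends). exists i. split; auto. unfold D in D_neq_0. unfold grad.
    destruct ends as [(-> & ->)|(-> & ->)]; lra. }
  apply supp_u in grad_neq_0. pose proof (source_in_box N i r grad_neq_0). pose proof (target_in_box N i r grad_neq_0).
  destruct ends as [(-> & ->)|(-> & ->)]; auto.
Qed.

Lemma W0_plus_scal u v t : W0 u -> W0 v -> W0 (fun p => u p + t * v p).
Proof.
  intros u_W0 v_W0. destruct (W0_supported u u_W0) as (N & supp_u), (W0_supported v v_W0) as (M & supp_v).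
  apply (W0_of_supported _ (N + M)).
  - rewrite (proj1 u_W0), (proj1 v_W0). ring.
  - intros i p grad_neq_0. apply NNPP. intros p_out. apply grad_neq_0.
    assert (grad u i p = 0) by (apply (field_supported_out _ (box N)); auto; intros p_in; apply p_out, (incl_box N);
      auto; lia).
    assert (grad v i p = 0) by (apply (field_supported_out _ (box M)); auto; intros p_in; apply p_out, (incl_box M);
      auto; lia).
    unfold grad in *. nra.
Qed.

Lemma W0_point_mass p : W0 (fun q => point_mass p q - point_mass p xi0).
Proof.
  destruct (incl_some_box [p]) as (N & p_in). apply (W0_of_supported _ (S N)); [ring|].
  intros i q grad_neq_0. apply NNPP. intros q_out. apply grad_neq_0.
  assert (mass_0 : forall r, ~ In r (box N) -> point_mass p r = 0).
  { intros r r_out. apply NNPP. intros neq_0. apply r_out, p_in, point_mass_supported, neq_0. }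
  unfold grad. rewrite (mass_0 (target i q)), (mass_0 (source i q)); [ring|..];
    rewrite in_box in *; destruct i; unfold source, target, shift in *; simpl in *; lia.
Qed.

Lemma W0_0 : W0 (fun _ => 0).
Proof. apply (W0_of_supported _ O); auto. intros i p neq_0. unfold grad in neq_0. lra. Qed.

Lemma minimising_sequence_exists {A} (P : A -> Prop) (F : A -> R) B :
  (exists a, P a) -> (forall a, P a -> B <= F a) ->
  exists I (a : nat -> A), (forall c, P c -> I <= F c) /\ forall n, P (a n) /\ F (a n) <= I + / (INR n + 1).
Proof.
  intros (a0 & P_a0) lower. destruct (completeness (fun x => exists a, P a /\ x = - F a)) as (s & s_ub & s_least).
  - exists (- B). intros x (a & P_a & ->). specialize (lower a P_a). lra.
  - eauto.
  - assert (near_min : forall n : nat, exists a, P a /\ F a <= - s + / (INR n + 1)).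
    { intros n. apply NNPP. intros none. assert (0 < / (INR n + 1))
        by (apply Rinv_0_lt_compat; pose proof (pos_INR n); lra).
      assert (s <= s - / (INR n + 1)); [|lra]. apply s_least. intros x (a & P_a & ->).
      apply Rnot_lt_le. intros F_lt. apply none. exists a. split; auto. lra. }
    destruct (choice _ near_min) as (a & a_near). exists (- s), a. split; auto.
    intros c P_c. enough (- F c <= s) by lra. apply s_ub. eauto.
Qed.

Lemma inv_succ_bounds n : 0 < / (INR n + 1) <= 1.
Proof.
  pose proof (pos_INR n). split; [apply Rinv_0_lt_compat; lra|]. rewrite <- Rinv_1. apply Rinv_le_contravar; lra.
Qed.

Lemma inv_succ_small eps : 0 < eps -> exists n0, forall n, (n0 <= n)%nat -> / (INR n + 1) <= eps.
Proof.
  intros eps_pos. destruct (INR_unbounded (/ eps)) as (n0 & n0_large). exists n0. intros n n_ge. apply le_INR in n_ge.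
  pose proof (Rinv_0_lt_compat eps eps_pos). rewrite <- (Rinv_inv eps). apply Rinv_le_contravar; lra.
Qed.

Section Projection.

Variable v : site -> R.
Hypothesis summable_v : field_summable (field_sqr (grad v)).

Let residual (u : site -> R) : field := fun i p => grad v i p - grad u i p.
Let error (u : site -> R) : R := field_sum (field_sqr (residual u)).

Lemma residual_summable u : W0 u -> field_summable (field_sqr (residual u)).
Proof. intros. apply field_sqr_summable_minus; auto using W0_summable. Qed.

Lemma error_variation u phi t : W0 u -> W0 phi ->
  error (fun p => u p + t * phi p) =
  error u - 2 * t * field_dot (residual u) (grad phi) + t ^ 2 * field_sum (field_sqr (grad phi)).
Proof.
  intros u_W0 phi_W0. unfold error. rewrite <- field_sum_sqr_minus_scal by auto using residual_summable, W0_summable.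
  apply field_sum_ext. intros i p. unfold field_sqr, residual, grad. ring.
Qed.

Variable d : R.
Hypothesis error_ge : forall u, W0 u -> d <= error u.

Lemma residual_almost_orthogonal u phi eps : W0 u -> error u <= d + eps -> W0 phi ->
  field_dot (residual u) (grad phi) ^ 2 <= field_sum (field_sqr (grad phi)) * eps.
Proof.
  intros u_W0 u_min phi_W0. apply quadratic_discriminant_le; [now apply field_sum_sqr_nonneg, W0_summable|].
  intros t. pose proof (error_ge _ (W0_plus_scal u phi t u_W0 phi_W0)) as lower.
  rewrite error_variation in lower by auto. lra.
Qed.

Lemma almost_minimisers_close u u' eps : W0 u -> W0 u' -> error u <= d + eps -> error u' <= d + eps ->
  l2_bounded (fun i p => grad u' i p - grad u i p) (4 * eps).
Proof.
  intros u_W0 u'_W0 u_min u'_min. set (phi := fun p => u' p + -1 * u p).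
  assert (phi_W0 : W0 phi) by now apply W0_plus_scal.
  pose proof (error_ge _ (W0_plus_scal u phi (/ 2) u_W0 phi_W0)) as lower. rewrite error_variation in lower by auto.
  pose proof (error_variation u phi 1 u_W0 phi_W0) as full.
  replace (error (fun p => u p + 1 * phi p)) with (error u') in full
    by (apply field_sum_ext; intros; unfold field_sqr, residual, grad, phi; ring).
  apply (l2_bounded_ext (grad phi)); [intros; unfold grad, phi; ring|].
  apply (l2_bounded_weaken _ (field_sum (field_sqr (grad phi)))); [lra|]. now apply l2_bounded_field_sum, W0_summable.
Qed.

Variable u : nat -> site -> R.
Hypothesis u_W0 : forall n, W0 (u n).
Hypothesis u_min : forall n, error (u n) <= d + / (INR n + 1).

Lemma error_minimiser_le n m : (n <= m)%nat -> error (u m) <= d + / (INR n + 1).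
Proof.
  intros n_le_m. eapply Rle_trans; [apply u_min|]. apply Rplus_le_compat_l, Rinv_le_contravar.
  - pose proof (pos_INR n). lra.
  - apply le_INR in n_le_m. lra.
Qed.

Lemma minimising_sequence_cluster_exists : exists w, pointwise_cluster u w.
Proof.
  apply (pointwise_cluster_exists site_code site_decode); [apply site_codeK|]. intros p.
  destruct (gradient_bound_pointwise (2 * field_sum (field_sqr (grad v)) + 2 * (d + 1)) p) as (B & bound).
  exists B. intros n. apply bound; [apply u_W0|].
  apply (l2_bounded_ext (fun i p => grad v i p - residual (u n) i p)); [intros; unfold residual; ring|].
  apply l2_bounded_minus; [now apply l2_bounded_field_sum|].
  apply (l2_bounded_weaken _ (error (u n))); [|now apply l2_bounded_field_sum, residual_summable].
  pose proof (u_min n). pose proof (inv_succ_bounds n). lra.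
Qed.

Variable w : site -> R.
Hypothesis cluster : pointwise_cluster u w.

Lemma minimising_sequence_near_cluster n :
  l2_bounded (fun i p => grad (u n) i p - grad w i p) (4 * / (INR n + 1)).
Proof.
  apply (l2_bounded_cluster _ _ _ n (field_cluster_minus_l (grad (u n)) _ _ (field_cluster_grad u w cluster))).
  intros m n_le_m. apply almost_minimisers_close; auto using error_minimiser_le.
Qed.

Lemma cluster_residual_summable : field_summable (field_sqr (residual w)).
Proof.
  apply (field_summable_ext (field_sqr (fun i p => residual (u 0) i p - (grad w i p - grad (u 0%nat) i p))));
    [intros; unfold field_sqr, residual; ring|].
  apply field_sqr_summable_minus; [now apply residual_summable|].
  apply (field_summable_ext (field_sqr (fun i p => grad (u 0%nat) i p - grad w i p)));
    [intros; unfold field_sqr; ring|].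
  eapply field_sqr_summable, minimising_sequence_near_cluster.
Qed.

Lemma cluster_residual_orthogonal phi : W0 phi -> field_dot (residual w) (grad phi) = 0.
Proof.
  intros phi_W0. pose proof (W0_summable phi phi_W0) as summable_phi. set (Q := field_sum (field_sqr (grad phi))).
  assert (Q_nonneg : 0 <= Q) by now apply field_sum_sqr_nonneg.
  assert (dot_le : forall n, field_dot (residual w) (grad phi) ^ 2 <= 10 * Q * / (INR n + 1)).
  { intros n. pose proof (residual_almost_orthogonal (u n) phi _ (u_W0 n) (u_min n) phi_W0) as near_orthogonal.
    fold Q in near_orthogonal.
    pose proof (minimising_sequence_near_cluster n) as near. pose proof (field_sqr_summable _ _ near) as summable_near.
    pose proof (field_dot_sqr_le _ _ summable_near summable_phi) as near_dot. fold Q in near_dot.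
    pose proof (field_sum_sqr_le _ _ near) as near_le. set (gap := fun i p => grad (u n) i p - grad w i p) in *.
    assert (field_dot gap (grad phi) ^ 2 <= Q * (4 * / (INR n + 1)))
      by (eapply Rle_trans; [exact near_dot|]; now apply Rmult_le_compat_l).
    assert (dot_split : field_dot (residual w) (grad phi) =
      field_dot (residual (u n)) (grad phi) + field_dot gap (grad phi)).
    { unfold field_dot. rewrite <- field_sum_plus by (apply field_mul_summable; auto using residual_summable).
      apply field_sum_ext. intros i p. unfold residual, gap. ring. }
    rewrite dot_split.
    pose proof (pow2_ge_0 (field_dot (residual (u n)) (grad phi) - field_dot gap (grad phi))). nra. }
  apply NNPP. intros dot_neq_0. assert (sqr_pos : 0 < field_dot (residual w) (grad phi) ^ 2) by now apply pow2_gt_0.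
  destruct (inv_succ_small (field_dot (residual w) (grad phi) ^ 2 / (10 * Q + 1))) as (n & small);
    [apply Rdiv_lt_0_compat; lra|].
  specialize (dot_le n). specialize (small n (le_n n)). apply Rle_div_r in small; [|lra]. nra.
Qed.

Lemma grad_cluster : forall i p, grad w i p = grad v i p.
Proof.
  set (z := fun p => v p - w p).
  assert (grad_z : forall i p, grad z i p = residual w i p) by (intros; unfold grad, residual, z, grad; ring).
  assert (summable_z : field_summable (field_sqr (grad z))).
  { apply (field_summable_ext (field_sqr (residual w))); [|apply cluster_residual_summable].
    intros i p. unfold field_sqr. now rewrite grad_z. }
  assert (harmonic : forall p, divergence (grad z) p = 0).
  { intros p. rewrite divergence_point_mass by auto.
    rewrite (field_sum_ext _ (fun i q => residual w i q * grad (fun q => point_mass p q - point_mass p xi0) i q)).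
    - fold (field_dot (residual w) (grad (fun q => point_mass p q - point_mass p xi0))).
      rewrite cluster_residual_orthogonal by apply W0_point_mass. ring.
    - intros i q. rewrite grad_z. unfold grad. ring. }
  intros i p. pose proof (harmonic_l2_gradient_0 z summable_z harmonic i p) as grad_0. rewrite grad_z in grad_0.
  unfold residual in grad_0. lra.
Qed.

End Projection.

Lemma W0_dense v eps : field_summable (field_sqr (grad v)) -> 0 < eps ->
  exists u, W0 u /\ l2_bounded (fun i p => grad u i p - grad v i p) eps.
Proof.
  intros summable_v eps_pos.
  destruct (minimising_sequence_exists W0 (fun u => field_sum (field_sqr (fun i p => grad v i p - grad u i p))) 0)
    as (d & u & error_ge & u_spec); [exists (fun _ => 0); apply W0_0| |].
  { intros u u_W0. apply field_sum_sqr_nonneg, field_sqr_summable_minus; auto using W0_summable. }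
  pose proof (fun n => proj1 (u_spec n)) as u_W0. pose proof (fun n => proj2 (u_spec n)) as u_min.
  destruct (minimising_sequence_cluster_exists v summable_v d u u_W0 u_min) as (w & cluster).
  destruct (inv_succ_small (eps / 4)) as (n & small); [lra|]. exists (u n). split; [apply u_W0|].
  apply (l2_bounded_weaken _ (4 * / (INR n + 1))); [specialize (small n (le_n n)); lra|].
  apply (l2_bounded_ext (fun i p => grad (u n) i p - grad w i p)).
  - intros i p. now rewrite (grad_cluster v summable_v d error_ge u u_W0 u_min w cluster).
  - apply (minimising_sequence_near_cluster v summable_v d error_ge u u_W0 u_min w cluster).
Qed.

(** * Existence of a minimiser *)

Lemma l2_bounded_of_l2norm g b delta : represents g b -> field_summable (field_sqr b) -> 0 < delta ->
  l2norm g < sqrt delta -> l2_bounded b delta.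
Proof.
  intros g_b summable_b delta_pos norm_lt. rewrite (l2norm_field_sum g b) in norm_lt by auto.
  apply sqrt_lt_0_alt in norm_lt.
  apply (l2_bounded_weaken _ (field_sum (field_sqr b))); [lra|]. now apply l2_bounded_field_sum.
Qed.

Section Minimiser.

Variable psi : R -> R.
Hypothesis psi_ok : psi_hyp psi.

Lemma E_ext_value_energy v : W12 v -> E_ext_value psi v (2 * energy psi (grad v)).
Proof.
  intros v_W12 eps eps_pos. apply W12_iff_summable in v_W12. destruct v_W12 as (_ & summable_v).
  destruct (energy_continuous psi psi_ok (grad v) (eps / 4)) as (delta & delta_pos & near_energy); [auto|lra|].
  exists (sqrt delta). split; [now apply sqrt_lt_R0|]. intros u u_W0 norm_lt e e_value.
  rewrite (E0_value_energy psi psi_ok u e u_W0 e_value). pose proof (W0_summable u u_W0) as summable_u.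
  assert (close : l2_bounded (fun i p => grad u i p - grad v i p) delta).
  { apply (l2_bounded_of_l2norm (fun p q => D u p q - D v p q)); auto using field_sqr_summable_minus.
    apply represents_minus; apply represents_D. }
  specialize (near_energy (grad u) summable_u close). apply Rabs_le_between in near_energy. apply Rabs_def1; lra.
Qed.

Lemma energy_ge_of_W0 I v : (forall u, W0 u -> I <= energy psi (grad u)) -> W12 v -> I <= energy psi (grad v).
Proof.
  intros W0_ge v_W12. apply W12_iff_summable in v_W12. destruct v_W12 as (_ & summable_v). apply le_epsilon.
  intros eps eps_pos.
  destruct (energy_continuous psi psi_ok (grad v) eps) as (delta & delta_pos & near_energy); auto.
  destruct (W0_dense v delta summable_v delta_pos) as (u & u_W0 & close).
  specialize (near_energy (grad u) (W0_summable u u_W0) close). specialize (W0_ge u u_W0).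
  apply Rabs_le_between in near_energy. lra.
Qed.

Lemma W0_energy_bounded_below : exists B, forall u, W0 u -> B <= energy psi (grad u).
Proof.
  destruct (bounded_competitor_exists psi psi_ok) as (K & competitor).
  destruct (Rabs_energy_le psi psi_ok) as (C & energy_le).
  exists (- Rabs (C * (K + 27))). pose proof (Rabs_pos (C * (K + 27))). pose proof (Rle_abs (C * (K + 27))).
  intros u u_W0. destruct (Rle_dec (energy psi (grad u)) 0) as [nonpos|]; [|lra].
  destruct (W0_supported u u_W0) as (N & supp_u). destruct (competitor u N supp_u nonpos) as (u' & _ & bounded & le_u).
  specialize (energy_le _ _ bounded). apply Rabs_le_between in energy_le. lra.
Qed.

Lemma bounded_minimising_sequence_exists : exists K I (u : nat -> site -> R),
  (forall v, W0 v -> I <= energy psi (grad v)) /\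
  forall n, u n xi0 = 0 /\ l2_bounded (grad (u n)) K /\ energy psi (grad (u n)) <= I + / (INR n + 1).
Proof.
  destruct W0_energy_bounded_below as (B & energy_ge).
  destruct (minimising_sequence_exists (fun v => W0 v /\ energy psi (grad v) <= 0) (fun v => energy psi (grad v)) B)
    as (I & v & I_le & v_min).
  { exists (fun _ => 0). split; [apply W0_0|]. rewrite energy_grad_0. lra. }
  { intros v (v_W0 & _). auto. }
  destruct (bounded_competitor_exists psi psi_ok) as (K & competitor).
  assert (u_exists : forall n : nat, exists u,
    u xi0 = 0 /\ l2_bounded (grad u) K /\ energy psi (grad u) <= I + / (INR n + 1)).
  { intros n. destruct (v_min n) as ((v_W0 & nonpos) & v_le). destruct (W0_supported _ v_W0) as (N & supp_v).
    destruct (competitor _ N supp_v nonpos) as (u & u_0 & bounded & le_v). exists u. repeat split; auto. lra. }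
  destruct (choice _ u_exists) as (u & u_spec). exists K, I, u. split; auto.
  intros v' v'_W0. destruct (Rle_dec (energy psi (grad v')) 0); [auto|].
  specialize (I_le (fun _ => 0)). rewrite energy_grad_0 in I_le. specialize (I_le (conj W0_0 (Rle_refl 0))). lra.
Qed.

Lemma energy_minimiser_exists : exists u, W12 u /\ forall v, W12 v -> energy psi (grad u) <= energy psi (grad v).
Proof.
  destruct bounded_minimising_sequence_exists as (K & I & u & I_le & u_spec).
  destruct (pointwise_cluster_exists site_code site_decode u site_codeK) as (w & cluster).
  { intros p. destruct (gradient_bound_pointwise K p) as (B & bound). exists B. intros n. apply bound; apply u_spec. }
  pose proof (field_cluster_grad u w cluster) as grad_cluster.
  assert (bounded : l2_bounded (grad w) K) by (apply (l2_bounded_cluster _ _ _ 0 grad_cluster); intros; apply u_spec).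
  assert (w_0 : w xi0 = 0).
  { apply NNPP. intros w_neq_0. destruct (cluster [xi0] (Rabs (w xi0)) (Rabs_pos_lt _ w_neq_0) O) as (n & _ & near).
    specialize (near xi0 (or_introl eq_refl)). rewrite (proj1 (u_spec n)), Rminus_0_l, Rabs_Ropp in near. lra. }
  assert (w_W12 : W12 w) by (apply W12_iff_summable; eauto using field_sqr_summable).
  exists w. split; auto. intros v v_W12. apply Rle_trans with I; [|now apply energy_ge_of_W0].
  apply (energy_lower_semicontinuous psi psi_ok _ _ K I grad_cluster); [intros; apply u_spec|].
  intros eps eps_pos. destruct (inv_succ_small eps eps_pos) as (n0 & small). exists n0. intros n n_ge.
  specialize (small n n_ge). destruct (u_spec n) as (_ & _ & u_le). lra.
Qed.

End Minimiser.

Theorem theorem4p5 (psi : R -> R) (Hpsi : psi_hyp psi) :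
  exists u : site -> R, W12 u /\
    exists Lu, E_ext_value psi u Lu /\
      forall v : site -> R, W12 v ->
        exists Lv, E_ext_value psi v Lv /\ Lu <= Lv.
Proof.
  destruct (energy_minimiser_exists psi Hpsi) as (u & u_W12 & u_min). exists u. split; [exact u_W12|].
  exists (2 * energy psi (grad u)). split; [now apply E_ext_value_energy|]. intros v v_W12.
  exists (2 * energy psi (grad v)). split; [now apply E_ext_value_energy|].
  specialize (u_min v v_W12). lra.
Qed.
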